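(* Let $H\in\mathcal C_+$, and write $H(x)=P_{\varphi(x)}$ for almost every $x>0$, with $\varphi:(0,\infty)\to\mathbb{R}$ a decreasing function satisfying $\pi/2\ge\varphi(0+)\ge\varphi(\infty)\ge-\pi/2$. Then $\sigma_{ess}(H)=\emptyset$ if and only if \[ \varphi(x)-\varphi(\infty)=o(1/x)\quad\text{as }x\to\infty . \]
   Context: $J=\begin{pmatrix}0&-1\\1&0\end{pmatrix}$. For $\alpha\in\mathbb{R}$, $e_\alpha=(\cos\alpha,\sin\alpha)^t$ and $P_\alpha=e_\alpha e_\alpha^*$ (projection onto $e_\alpha$). ''Decreasing'' means non-increasing, $\varphi(0+)=\lim_{x\to0+}\varphi(x)$, $\varphi(\infty)=\lim_{x\to\infty}\varphi(x)$. A half line canonical system is the equation $Ju'(x)=-zH(x)u(x)$, $x\in[0,\infty)$, where $H$ is a measurable function with values in the real symmetric $2\times2$ matrices, $H(x)\ge0$, $\operatorname{tr}H(x)=1$ for a.e. $x$; the boundary condition $u_2(0)=0$ is always imposed. $L^2_H(0,\infty)$ is the Hilbert space of measurable $f:(0,\infty)\to\mathbb{C}^2$ with $\int_0^\infty f^*Hf\,dx<\infty$, modulo functions with $\int f^*Hf\,dx=0$. The system generates the self-adjoint relation $\mathcal S$ of all pairs $(f,g)\in L^2_H\times L^2_H$ such that $f$ has a representative $f_0$, locally absolutely continuous on $[0,\infty)$, with $Jf_0'=-Hg$ a.e. and second component $f_{0,2}(0)=0$. Its multi-valued part is $\mathcal S(0)=\{g:(0,g)\in\mathcal S\}$, and $\overline{D(\mathcal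 S)}=\mathcal S(0)^\perp$. The self-adjoint operator $S$ of the system acts on $\overline{D(\mathcal S)}$ and has graph $\mathcal S\cap(\overline{D(\mathcal S)}\times\overline{D(\mathcal S)})$. $\sigma(H)$ and $\sigma_{ess}(H)$ denote the spectrum and essential spectrum of $S$ (empty if $\overline{D(\mathcal S)}=0$). $\mathcal C_+$ is the set of such coefficient functions $H$ on $(0,\infty)$ with $\sigma(H)\subseteq[0,\infty)$. By a theorem of Winkler and Woracek, $H\in\mathcal C_+$ if and only if $H=P_\varphi$ a.e. for some $\varphi$ as in the claim, so such a $\varphi$ exists. *)

(* Defs.v *)
From HB Require Import structures.
From mathcomp Require Import all_boot all_order all_algebra.
From mathcomp Require Import complex.
From mathcomp Require Import all_classical all_reals all_analysis.

Set Implicit Arguments.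
Unset Strict Implicit.
Unset Printing Implicit Defensive.

Import Order.TTheory GRing.Theory Num.Theory.
Import numFieldNormedType.Exports.

Local Open Scope classical_set_scope.
Local Open Scope ring_scope.

(* Functions on the half line are total functions on R of which only the
   values on (0,oo) matter (on [0,oo) for locally absolutely continuous ones).
   Elements of the Hilbert space L^2_H are handled through representatives:
   vectors are functions satisfying [L2 H], equality of vectors is [L2eq H],
   and every notion below is invariant under [L2eq H]. *)

(* lets the library's little-o notation be used at +oo *)
Canonical pinfty_nbhs_filterType (K : numFieldType) :=
  FilterType (pinfty_nbhs K) _.

Section CanonicalSystems.
Variable R : realType.

Notation C := R[i].
Notation C2 := ('cV[C]_2).
Notation mu := (@lebesgue_measure R).
Notation half_line := (`]0, +oo[%classic : set R).

Definition rotJ : 'M[C]_2 :=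
  \matrix_(i, j) ((j < i)%N%:R - (i < j)%N%:R).

Definition evec (a : R) : 'cV[R]_2 :=
  \col_i (if i == 0 then cos a else sin a).

Definition proj_dir (a : R) : 'M[R]_2 := evec a *m (evec a)^T.

(* Lebesgue (not only Borel) measurability on (0,oo): the sigma-algebra that
   the library puts on R is the Borel one, which is completed here. On
   nonnegative functions that are measurable in this sense the library
   integral, a supremum over simple functions, is the Lebesgue integral. *)
Definition leb_measurable (f : R -> R) : Prop :=
  exists2 g : R -> R, measurable_fun half_line g &
    {ae mu, forall x, 0 < x -> f x = g x}.

Definition leb_measurable_vec (f : R -> C2) : Prop :=
  forall i, leb_measurable (fun x => complex.Re (f x i 0)) /\
            leb_measurable (fun x => complex.Im (f x i 0)).

Definition coefficient (H : R -> 'M[R]_2) : Prop :=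
  [/\ forall i j, leb_measurable (fun x => H x i j),
      forall x, 0 < x -> (H x)^T = H x &
      {ae mu, forall x, 0 < x ->
         (forall v : 'cV[R]_2, 0 <= (v^T *m H x *m v) 0 0) /\ \tr (H x) = 1}].

Definition cplx_mx (A : 'M[R]_2) : 'M[C]_2 := map_mx (real_complex R) A.

(* v^* A v, which is a real number when A is real symmetric. *)
Definition qform (A : 'M[R]_2) (v : C2) : R :=
  complex.Re ((map_mx (@conjc R) v^T *m cplx_mx A *m v) 0 0).

Definition L2int (H : R -> 'M[R]_2) (f : R -> C2) : \bar R :=
  (\int[mu]_(x in half_line) (qform (H x) (f x))%:E)%E.

Definition L2 (H : R -> 'M[R]_2) (f : R -> C2) : Prop :=
  leb_measurable_vec f /\ (L2int H f < +oo)%E.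

Definition L2norm (H : R -> 'M[R]_2) (f : R -> C2) : R :=
  Num.sqrt (fine (L2int H f)).

Definition L2eq (H : R -> 'M[R]_2) (f g : R -> C2) : Prop :=
  L2int H (f - g) = 0%E.

Definition abs_continuous (a b : R) (f : R -> R) : Prop :=
  forall e : R, 0 < e -> exists2 d : R, 0 < d &
    forall (n : nat) (s t : 'I_n -> R),
      (forall i, a <= s i /\ s i <= t i /\ t i <= b) ->
      trivIset setT (fun i => `]s i, t i[%classic) ->
      \sum_(i < n) (t i - s i) < d ->
      \sum_(i < n) `|f (t i) - f (s i)| < e.

Definition loc_abs_continuous (f : R -> C2) : Prop :=
  forall (b : R) (i : 'I_2), 0 < b ->
    abs_continuous 0 b (fun x => complex.Re (f x i 0)) /\
    abs_continuous 0 b (fun x => complex.Im (f x i 0)).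

Definition has_deriv (f : R -> C2) (x : R) (v : C2) : Prop :=
  forall i, is_derive x 1 (fun y => complex.Re (f y i 0)) (complex.Re (v i 0)) /\
            is_derive x 1 (fun y => complex.Im (f y i 0)) (complex.Im (v i 0)).

Section Relation.
Variable H : R -> 'M[R]_2.

(* The self-adjoint relation (f, g) : J f0' = - H g a.e. for some locally
   absolutely continuous representative f0 of f with f0_2(0) = 0; the second
   component has index 1. *)
Definition sysrel (f g : R -> C2) : Prop :=
  [/\ L2 H f, L2 H g &
      exists f0 : R -> C2,
        [/\ L2 H f0 /\ L2eq H f f0,
            loc_abs_continuous f0,
            {ae mu, forall x, 0 < x ->
               exists2 v : C2, has_deriv f0 x v &
                 rotJ *m v = - (cplx_mx (H x) *m g x)} &
            f0 0 1 0 = 0]].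

Definition sysdom_closure (f : R -> C2) : Prop :=
  L2 H f /\
  forall e : R, 0 < e ->
    exists2 f' : R -> C2, (exists g, sysrel f' g) & L2norm H (f - f') < e.

(* graph of the self-adjoint operator S on the closure of the domain *)
Definition sysop (f g : R -> C2) : Prop :=
  [/\ sysrel f g, sysdom_closure f & sysdom_closure g].

(* S - z is a bijection from the domain of S onto the Hilbert space
   [sysdom_closure], with bounded inverse. *)
Definition resolvent_set : set C :=
  [set z | [/\ forall f g, sysop f g -> L2eq H (g - z *: f) 0 -> L2eq H f 0,
               forall h, sysdom_closure h ->
                 exists f g, sysop f g /\ L2eq H (g - z *: f) h &
               exists M : R, forall f g, sysop f g ->
                 L2norm H f <= M * L2norm H (g - z *: f)]].

Definition spectrum : set C := ~` resolvent_set.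

(* f is in the kernel of S - z *)
Definition eigenfun (z : C) (f : R -> C2) : Prop :=
  exists2 g, sysop f g & L2eq H g (z *: f).

Definition finite_multiplicity (z : C) : Prop :=
  exists (n : nat) (b : 'I_n -> R -> C2),
    (forall i, eigenfun z (b i)) /\
    forall f, eigenfun z f ->
      exists c : 'I_n -> C, L2eq H f (\sum_(i < n) c i *: b i).

(* For self-adjoint operators the essential spectrum is what remains of the
   spectrum after removing its isolated points that are eigenvalues of finite
   multiplicity. *)
Definition discrete_spectrum : set C :=
  [set z | [/\ spectrum z,
               exists2 e : R, 0 < e &
                 forall w, spectrum w -> `|w - z| < real_complex R e -> w = z,
               exists2 f, eigenfun z f & ~ L2eq H f 0 &
               finite_multiplicity z]].

Definition essential_spectrum : set C := spectrum `\` discrete_spectrum.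

End Relation.

Definition Cplus (H : R -> 'M[R]_2) : Prop :=
  coefficient H /\
  spectrum H `<=` [set real_complex R t | t in [set t : R | 0 <= t]].

End CanonicalSystems.

(* Main.v *)
(** Since [H] is the projection onto [e_phi], an element of [L^2_H] is determined
    by its coordinate [F] along [e_phi], and the real and imaginary parts
    decouple. Put [d = phi - phi(oo)], which decreases from at most [pi] to [0].
    In the basis [e_phi(oo)], [J e_phi(oo)] the equation [J f' = - H g] reads
    [al' = - sin d G], [be' = cos d G], and [F = al cos d + be sin d].

    If [x d(x) -> 0], a monotone quantity bounds the tail of [F] by [G], so that
    bounded sequences in the relation have convergent first components; the
    spectrum is then discrete, eigenfunctions being unique up to a scalar.

    If [x d(x)] does not tend to [0], there are far away normalized [F_n] with
    bounded [G_n], hence [F_n] is weakly null. If the spectrum consisted of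
    isolated simple eigenvalues, the resolvent [A] at [-1] would turn weak into
    strong convergence, which contradicts [1 = <F_n, F_n> = <A F_n, F_n + G_n>].
    That property of [A] is obtained without the spectral theorem: on sequences,
    the largest value [l] of [|A f_n|] is approached by approximate
    eigenvectors for [l] or [-l], and near an isolated spectral point the
    Hilbert space splits. *)
Require Import Defs.
From HB Require Import structures.
From mathcomp Require Import all_boot all_order all_algebra.
From mathcomp Require Import complex ring lra.
From mathcomp Require Import all_classical all_reals all_analysis measurable_realfun.

Set Implicit Arguments.
Unset Strict Implicit.
Unset Printing Implicit Defensive.

Import Order.TTheory GRing.Theory Num.Theory.
Import numFieldNormedType.Exports.

Local Open Scope classical_set_scope.
Local Open Scope ring_scope.

(** No quotient is formed: vectors remain functions, the form is only semidefinite, and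
    [inorm x = 0] replaces [x = 0]. Self-adjointness enters through [Cplus], which places [-1] and
    every non-real number in the resolvent set. The real point [-1] lets the Hilbert space argument
    run over the real field. The non-real points are used when their imaginary part tends to 0: this
    gives surjectivity of [S - w] at a real [w] that is not an eigenvalue. The far away [F_n] must
    vanish near infinity, which puts two conditions on [G_n], one for [al] and one for [be]. A
    function [G] living on two intervals can meet the condition on [be]; one such pair is placed far
    away, and a multiple of a fixed near pair corrects its effect on [al]. The cost in [|G|^2] is of
    the order of the position [X] of the far pair. It is affordable because [X d(X)] is bounded
    below, which makes [F] at least a constant on an interval of length comparable to [X]. *)

Section SemiInnerProduct.
Variables (R : realType) (E : lmodType R) (ip : E -> E -> R).

Definition semi_inner : Prop :=
  [/\ forall x y, ip x y = ip y x,
      forall x y z, ip (x + y) z = ip x z + ip y z,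
      forall c x z, ip (c *: x) z = c * ip x z &
      forall x, 0 <= ip x x].

Definition inorm x : R := Num.sqrt (ip x x).

Definition icauchy (u : nat -> E) : Prop :=
  forall e, 0 < e -> exists N, forall m n, (N <= m)%N -> (N <= n)%N ->
    inorm (u m - u n) < e.

Definition icvg (u : nat -> E) (l : E) : Prop :=
  forall e, 0 < e -> exists N, forall n, (N <= n)%N -> inorm (u n - l) < e.

Definition icomplete : Prop := forall u, icauchy u -> exists l, icvg u l.

Definition weakly_null (u : nat -> E) : Prop :=
  forall k e, 0 < e -> exists N, forall n, (N <= n)%N -> `|ip (u n) k| < e.

Hypothesis sip : semi_inner.

Lemma ipC x y : ip x y = ip y x. Proof. by case: sip. Qed.
Lemma ipDl x y z : ip (x + y) z = ip x z + ip y z. Proof. by case: sip. Qed.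
Lemma ipZl c x z : ip (c *: x) z = c * ip x z. Proof. by case: sip. Qed.
Lemma ip_ge0 x : 0 <= ip x x. Proof. by case: sip. Qed.
Lemma ipDr x y z : ip z (x + y) = ip z x + ip z y.
Proof. by rewrite ipC ipDl !(ipC _ z). Qed.
Lemma ipZr c x z : ip z (c *: x) = c * ip z x.
Proof. by rewrite ipC ipZl (ipC _ z). Qed.
Lemma ipNl x z : ip (- x) z = - ip x z.
Proof. by rewrite -scaleN1r ipZl mulN1r. Qed.
Lemma ipNr x z : ip z (- x) = - ip z x.
Proof. by rewrite ipC ipNl (ipC _ z). Qed.
Lemma ip0l z : ip 0 z = 0.
Proof. by rewrite -(scale0r 0) ipZl mul0r. Qed.

Definition ipE := (ipDl, ipDr, ipZl, ipZr, ipNl, ipNr).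

Lemma inorm_ge0 x : 0 <= inorm x. Proof. exact: sqrtr_ge0. Qed.
Lemma inorm_sqr x : inorm x ^+ 2 = ip x x.
Proof. by rewrite sqr_sqrtr ?ip_ge0. Qed.

Lemma ip_cauchy_sqr x y : ip x y ^+ 2 <= ip x x * ip y y.
Proof.
have [y0|y0] := eqVneq (ip y y) 0.
  (* When [ip y y = 0] the quadratic in [t] degenerates to an affine function, which can stay
     nonnegative only if it is constant. The [t] chosen below would make it [-1]. *)
  have H t : 0 <= ip x x + 2 * t * ip x y.
    have := ip_ge0 (x + t *: y); rewrite !ipE y0 (ipC y x); lra.
  have [->|xy0] := eqVneq (ip x y) 0; first by rewrite y0 expr0n mulr0.
  have := H (- (ip x x + 1) / (2 * ip x y)).
  rewrite (_ : _ + _ = -1); last by field.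
  lra.
have y1 : 0 < ip y y by rewrite lt_neqAle eq_sym y0 ip_ge0.
have := ip_ge0 (x - (ip x y / ip y y) *: y).
rewrite !ipE (ipC y x) => h.
have : 0 <= (ip x x - ip x y ^+ 2 / ip y y) * ip y y.
  apply: mulr_ge0; last exact: ltW.
  by move: h; rewrite (_ : _ - _ + _ = ip x x - ip x y ^+ 2 / ip y y) //; field.
rewrite mulrBl divfK // subr_ge0 //.
Qed.

Lemma ip_cauchy x y : `|ip x y| <= inorm x * inorm y.
Proof.
rewrite -(ler_pXn2r (n := 2)) ?nnegrE ?mulr_ge0 ?inorm_ge0 //.
by rewrite exprMn !inorm_sqr real_normK ?num_real // ip_cauchy_sqr.
Qed.

Lemma inormD x y : inorm (x + y) <= inorm x + inorm y.
Proof.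
rewrite -(ler_pXn2r (n := 2)) ?nnegrE ?addr_ge0 ?inorm_ge0 //.
rewrite sqrrD !inorm_sqr !ipE (ipC y x).
have := le_trans (ler_norm _) (ip_cauchy x y); lra.
Qed.

Lemma inormZ c x : inorm (c *: x) = `|c| * inorm x.
Proof.
by rewrite /inorm !ipE mulrA -expr2 sqrtrM ?sqr_ge0 // sqrtr_sqr.
Qed.

Lemma inormN x : inorm (- x) = inorm x.
Proof. by rewrite -scaleN1r inormZ normrN1 mul1r. Qed.

Lemma inormB x y : inorm (x - y) = inorm (y - x).
Proof. by rewrite -inormN opprB. Qed.

Lemma inorm0 : inorm 0 = 0.
Proof. by rewrite -(scale0r 0) inormZ normr0 mul0r. Qed.

Lemma ip_nulll x y : inorm x = 0 -> ip x y = 0.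
Proof.
by move=> x0; apply/eqP; rewrite -normr_le0 (le_trans (ip_cauchy x y)) // x0 mul0r.
Qed.

Lemma ip_congl x x' y : inorm (x - x') = 0 -> ip x y = ip x' y.
Proof. by move=> /ip_nulll - /(_ y); rewrite !ipE => /eqP; rewrite subr_eq0 => /eqP. Qed.

Lemma inorm_le x y : inorm x <= inorm (x - y) + inorm y.
Proof. by have := inormD (x - y) y; rewrite subrK. Qed.

Lemma inorm_dist y x z : inorm (x - z) <= inorm (x - y) + inorm (y - z).
Proof. by have := inormD (x - y) (y - z); rewrite addrA subrK. Qed.

Lemma inorm_congr x x' : inorm (x - x') = 0 -> inorm x = inorm x'.
Proof.
move=> h; apply/le_anti/andP; split.
  by have := inorm_le x x'; rewrite h add0r.
by have := inorm_le x' x; rewrite inormB h add0r.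
Qed.

(** Testing against [y := x] suffices. This is how an equation up to null vectors is turned into an
    identity between real numbers. *)
Lemma inorm_ip_ext x : (forall y, ip x y = 0) -> inorm x = 0.
Proof. by move=> h; rewrite /inorm h sqrtr0. Qed.

Lemma inorm_small x : (forall e, 0 < e -> inorm x <= e) -> inorm x = 0.
Proof.
move=> h; apply/le_anti/andP; split; last exact: inorm_ge0.
by apply/ler_addgt0Pl => e e0; rewrite addr0 h.
Qed.

Lemma icvg_ip u l k : icvg u l -> (fun n => ip (u n) k) @ \oo --> ip l k.
Proof.
move=> ul; apply/cvgrPdist_lt => e e0.
have d0 : 0 < e / (inorm k + 1) by rewrite divr_gt0 // ltr_wpDl ?inorm_ge0.
have [N hN] := ul _ d0; exists N => // n /= Nn.
rewrite -opprB normrN -[_ - _]/(ip (u n) k + - ip l k) -ipNl -ipDl.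
apply: le_lt_trans (ip_cauchy _ _) _.
have := hN _ Nn; rewrite ltr_pdivlMr ?ltr_wpDl ?inorm_ge0 //.
have := inorm_ge0 k; have := inorm_ge0 (u n - l); nra.
Qed.

End SemiInnerProduct.

(** * Bounded symmetric operators near an isolated spectral point *)

Section SymmetricOperator.
Variables (R : realType) (E : lmodType R) (ip : E -> E -> R).
Hypothesis sip : semi_inner ip.
Local Notation "`[ x ]" := (inorm ip x) (format "`[ x ]").
Let ipE := ipE sip.
Let ipC := ipC sip.
Let nn := inorm_ge0 ip.
Let nsq := inorm_sqr sip.

Definition ip_symmetric (T : E -> E) := forall x y, ip (T x) y = ip x (T y).
Definition ip_bounded (T : E -> E) := exists M, forall x, `[T x] <= M * `[x].
Definition bounded_below (T : E -> E) := exists2 c, 0 < c & forall x, c * `[x] <= `[T x].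
Definition ip_onto (T : E -> E) := forall h, exists x, `[T x - h] = 0.
Definition ip_invertible (T : E -> E) := bounded_below T /\ ip_onto T.
Definition shift (T : E -> E) (s : R) x := T x - s *: x.

Lemma shift_symmetric T s : ip_symmetric T -> ip_symmetric (shift T s).
Proof. by move=> h x y; rewrite /shift !ipE h. Qed.

(** [T] is a bare function. Symmetry moves it to the other side, where the form is additive, so [T]
    is linear up to null vectors. *)
Lemma symDl T x y z : ip_symmetric T -> ip (T (x + y)) z = ip (T x) z + ip (T y) z.
Proof. by move=> h; rewrite !h ipE. Qed.

Lemma symZl T c x z : ip_symmetric T -> ip (T (c *: x)) z = c * ip (T x) z.
Proof. by move=> h; rewrite !h ipE. Qed.

Lemma symBl T x y z : ip_symmetric T -> ip (T (x - y)) z = ip (T x) z - ip (T y) z.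
Proof. by move=> h; rewrite !h !ipE. Qed.

Lemma shift_bounded T s : ip_bounded T -> ip_bounded (shift T s).
Proof.
move=> [M hM]; exists (M + `|s|) => x; rewrite /shift.
apply: le_trans (inormD sip _ _) _.
by rewrite inormN // inormZ // mulrDl lerD2r.
Qed.

(* For m = inf |Tx| / |x| the operator T^2 - m^2 is not bounded below, so m or
   -m is not a regular value. *)
Lemma gap T (r : R) : ip_symmetric T -> ip_bounded T -> 0 < r ->
  (forall s, `|s| < r -> ip_invertible (shift T s)) ->
  forall x, r * `[x] <= `[T x].
Proof.
move=> symT [M0 hM0] r0 inv x0; rewrite leNgt; apply/negP => x0r.
pose M := `|M0| + 1.
have M1 : 0 < M by rewrite ltr_wpDl.
have hM x : `[T x] <= M * `[x].
  apply: le_trans (hM0 x) _; apply: ler_wpM2r; first exact: nn.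
  by rewrite /M (le_trans (ler_norm _)) // lerDl.
have inv0 : ip_invertible (shift T 0) by apply: inv; rewrite normr0.
have shift0 x : shift T 0 x = T x by rewrite /shift scale0r subr0.
(* The infimum of [|Tx| / |x|] is obtained as the largest constant in a lower bound, so null vectors
   [x] need no separate treatment. *)
pose A := [set t | forall x, t * `[x] <= `[T x]].
have x0p : 0 < `[x0].
  rewrite lt_neqAle nn andbT; apply/eqP => h; move: x0r; rewrite -h mulr0.
  by rewrite ltNge nn.
have ubA : ubound A (`[T x0] / `[x0]).
  by move=> t /(_ x0); rewrite -ler_pdivlMr.
case: inv0 => -[c c0 hc] ont.
have Ac : A c by move=> x; rewrite -shift0; exact: hc.
have supA : has_sup A by split; [exists c | exists (`[T x0] / `[x0])].
pose m := sup A.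
have cm : c <= m by apply: ub_le_sup => //; exists (`[T x0] / `[x0]).
have m0 : 0 < m by exact: lt_le_trans cm.
have mr : m < r.
  apply: le_lt_trans (_ : `[T x0] / `[x0] < r); first by apply: ge_sup => //; exists c.
  by rewrite ltr_pdivrMr.
have Am x : m * `[x] <= `[T x].
  rewrite leNgt; apply/negP => h.
  have xp : 0 < `[x].
    rewrite lt_neqAle nn andbT; apply/eqP => h'; move: h; rewrite -h' mulr0.
    by rewrite ltNge nn.
  have : m <= `[T x] / `[x].
    by apply: ge_sup; [exists c | move=> t /(_ x); rewrite -ler_pdivlMr].
  by rewrite ler_pdivlMr // leNgt h.
have [c1 c10 hc1] : bounded_below (shift T m).
  by have [] : ip_invertible (shift T m) by apply: inv; rewrite gtr0_norm.
have [c2 c20 hc2] : bounded_below (shift T (- m)).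
  by have [] : ip_invertible (shift T (- m)) by apply: inv; rewrite normrN gtr0_norm.
pose k := (c1 * c2) ^+ 2.
have k0 : 0 < k by rewrite exprn_gt0 // mulr_gt0.
(* (2 m e + e^2) M^2 < k *)
pose e := Num.min 1 (k / ((2 * m + 1) * M ^+ 2 * 2)).
have D0 : 0 < (2 * m + 1) * M ^+ 2 * 2.
  by rewrite !mulr_gt0 ?exprn_gt0 // addr_gt0 // mulr_gt0.
have e0 : 0 < e by rewrite lt_min ltr01 divr_gt0.
have e1 : e <= 1 by rewrite ge_min lexx.
have e2 : e * ((2 * m + 1) * M ^+ 2 * 2) <= k.
  by rewrite -ler_pdivlMr // ge_min lexx orbT.
have [x hx] : exists x, `[T x] < (m + e) * `[x].
  apply: contrapT => h.
  have : m + e <= m.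
    apply: ub_le_sup; first by exists (`[T x0] / `[x0]).
    by move=> x; rewrite leNgt; apply/negP => h'; apply: h; exists x.
  lra.
(* [T^2 - m^2] is applied to a preimage [y] of the nearly minimising [x]. Its norm then involves
   only [|Tx|], [|x|] and [|y|]; applied to [x] it would bring in [|T^2 x|], for which near
   minimality gives no upper bound. *)
have [y hy] := ont x; rewrite shift0 in hy.
have ipTy z : ip (T y) z = ip x z by apply: (ip_congl sip).
have nTy : `[T y] = `[x] by exact: (inorm_congr sip).
have key : `[shift T m (shift T (- m) y)] ^+ 2 =
    `[T x] ^+ 2 - 2 * m ^+ 2 * `[x] ^+ 2 + m ^+ 4 * `[y] ^+ 2.
  rewrite !nsq.
  have E1 z : ip (shift T m (shift T (- m) y)) z = ip (T x) z - m ^+ 2 * ip y z.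
    rewrite /shift; rewrite !ipE !(symDl _ _ _ symT) -scaleN1r scalerA.
    rewrite mulN1r opprK (symZl _ _ _ symT) symT ipTy -(symT x) ipTy; ring.
  have T1 : ip (T x) y = ip x x by rewrite symT ipC ipTy.
  rewrite E1 (ipC (T x)) (ipC y) !E1 (ipC y (T x)) T1; ring.
have b1 : c1 * c2 * `[y] <= `[shift T m (shift T (- m) y)].
  apply: le_trans (hc1 _); rewrite -mulrA ler_wpM2l ?(ltW c10) //.
have b2 : k * `[y] ^+ 2 <= `[shift T m (shift T (- m) y)] ^+ 2.
  rewrite /k -exprMn ler_pXn2r ?nnegrE ?mulr_ge0 ?nn ?(ltW c10) ?(ltW c20) //.
have b3 : m ^+ 2 * `[y] ^+ 2 <= `[x] ^+ 2.
  by rewrite -nTy -exprMn ler_pXn2r ?nnegrE ?mulr_ge0 ?nn ?(ltW m0) ?Am.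
have b4 : `[T x] ^+ 2 <= (m + e) ^+ 2 * `[x] ^+ 2.
  by rewrite -exprMn ler_pXn2r ?nnegrE ?mulr_ge0 ?nn ?(ltW hx) // addr_ge0 ?ltW.
have b5 : `[x] ^+ 2 <= M ^+ 2 * `[y] ^+ 2.
  by rewrite -nTy -exprMn ler_pXn2r ?nnegrE ?mulr_ge0 ?nn ?hM ?(ltW M1).
have yp : 0 < `[y] ^+ 2.
  rewrite exprn_gt0 // lt_neqAle nn andbT; apply/eqP => h.
  have := hM y; rewrite -h mulr0 nTy => hx0.
  have {}hx0 : `[x] = 0 by apply/le_anti; rewrite hx0 nn.
  by move: hx; rewrite hx0 mulr0 ltNge nn.
have b6 : k * `[y] ^+ 2 <= (2 * m * e + e ^+ 2) * `[x] ^+ 2.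
  apply: le_trans b2 _; rewrite key.
  have := ler_wpM2l (sqr_ge0 m) b3.
  have -> : m ^+ 2 * (m ^+ 2 * `[y] ^+ 2) = m ^+ 4 * `[y] ^+ 2 by ring.
  move: b4; rewrite sqrrD => b4 b4'; lra.
have b7 : (2 * m * e + e ^+ 2) * `[x] ^+ 2 <= e * (2 * m + 1) * (M ^+ 2 * `[y] ^+ 2).
  apply: ler_pM => //; first by rewrite addr_ge0 ?sqr_ge0 ?mulr_ge0 ?(ltW e0) ?(ltW m0).
    exact: sqr_ge0.
  by nra.
have : k * `[y] ^+ 2 * 2 <= k * `[y] ^+ 2.
  apply: le_trans (_ : e * ((2 * m + 1) * M ^+ 2 * 2) * `[y] ^+ 2 <= _); last first.
    by rewrite ler_wpM2r // ltW.
  have := le_trans b6 b7; lra.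
have : 0 < k * `[y] ^+ 2 by rewrite mulr_gt0.
lra.
Qed.

(** The interval [(0, r)] is the ball of radius [r / 2] around [r / 2], so [gap] applies to
    [T - r / 2]. Squared, its estimate says that [T (T - r)] is a nonnegative form. *)
Lemma isolated_form T (r : R) : ip_symmetric T -> ip_bounded T -> 0 < r ->
  (forall s, 0 < s < r -> ip_invertible (shift T s)) ->
  forall x, r * ip (T x) x <= ip (T x) (T x).
Proof.
move=> symT bT r0 inv x.
have r2 : 0 < r / 2 by rewrite divr_gt0.
have shS s : shift (shift T (r / 2)) s = shift T (r / 2 + s).
  by apply/funext => y; rewrite /shift scalerDl opprD addrA.
have inv' s : `|s| < r / 2 -> ip_invertible (shift (shift T (r / 2)) s).
  by rewrite shS ltr_norml => /andP[s1 s2]; apply: inv; apply/andP; split; lra.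
have := gap (shift_symmetric (r / 2) symT) (shift_bounded (r / 2) bT) r2 inv' x.
rewrite -(ler_pXn2r (n := 2)) ?nnegrE ?mulr_ge0 ?nn ?(ltW r2) //.
rewrite exprMn !nsq /shift !ipE (ipC x (T x)).
move=> h.
  nra.
exact: ltW.
Qed.

(** This lower bound on the range of [T] takes the place of a spectral projection onto the
    complement of the kernel. *)
Lemma isolated_range T (r : R) : ip_symmetric T -> ip_bounded T -> 0 < r ->
  (forall s, 0 < `|s| < r -> ip_invertible (shift T s)) ->
  forall g, r * `[T g] <= `[T (T g)].
Proof.
move=> symT bT r0 inv g.
have invp s : 0 < s < r -> ip_invertible (shift T s).
  by move=> /andP[s0 sr]; apply: inv; rewrite gtr0_norm // s0.
pose U x := - T x.
have symU : ip_symmetric U by move=> x y; rewrite /U !ipE symT.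
have bU : ip_bounded U.
  by case: bT => M hM; exists M => x; rewrite /U inormN.
have invU s : 0 < s < r -> ip_invertible (shift U s).
  move=> /andP[s0 sr].
  have [[c c0 hc] ont] : ip_invertible (shift T (- s)).
    by apply: inv; rewrite normrN gtr0_norm // s0.
  have eU x : shift U s x = - shift T (- s) x.
    by rewrite /shift /U scaleNr opprK opprD.
  split; first by exists c => // x; rewrite eU inormN.
  move=> h; have [x hx] := ont (- h); exists x.
  by rewrite eU -opprD inormN // -(opprK h).
have P := isolated_form symT bT r0 invp.
have Q := isolated_form symU bU r0 invU.
(* P at (T + r) g plus Q at (T - r) g is <T(T^2 - r^2)Tg, g> >= 0 *)
have := P (T g + r *: g); have := Q (T g - r *: g); rewrite /U.
rewrite !ipE.
have e1 w : ip (T (T g + r *: g)) w = ip (T (T g)) w + r * ip (T g) w.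
  by rewrite symDl // symZl.
have e2 w : ip (T (T g - r *: g)) w = ip (T (T g)) w - r * ip (T g) w.
  by rewrite -scaleNr symDl // symZl // mulNr.
have e1r w : ip w (T (T g + r *: g)) = ip w (T (T g)) + r * ip w (T g).
  by rewrite !(ipC w) e1.
have e2r w : ip w (T (T g - r *: g)) = ip w (T (T g)) - r * ip w (T g).
  by rewrite !(ipC w) e2.
rewrite !(e1, e2, e1r, e2r) // => h1 h2.
rewrite -(ler_pXn2r (n := 2)) ?nnegrE ?mulr_ge0 ?nn ?(ltW r0) // exprMn !nsq.
have e3 : ip (T (T g)) g = ip (T g) (T g) by rewrite symT.
move: h1 h2; rewrite !(ipC _ (T (T g))) !e3 => h1 h2; nra.
Qed.

End SymmetricOperator.

(** * From weak to strong convergence *)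

Section WeakToStrong.
Variables (R : realType) (E : lmodType R) (ip : E -> E -> R).
Hypothesis sip : semi_inner ip.
Hypothesis comp : icomplete ip.
Local Notation "`[ x ]" := (inorm ip x) (format "`[ x ]").
Let ipE := ipE sip.
Let ipC := ipC sip.
Let nn := inorm_ge0 ip.
Let nsq := inorm_sqr sip.

(** The component [l] of [h] orthogonal to the kernel is the limit of [l_s = T (T - s)^-1 h] as [s]
    tends to 0. Indeed [T l_s = T h + s l_s], and as [l_s] lies in the range of [T],
    [isolated_range] keeps it bounded and makes it Cauchy. *)
Lemma isolated_decomposition T (r : R) :
  ip_symmetric ip T -> ip_bounded ip T -> 0 < r ->
  (forall s, 0 < `|s| < r -> ip_invertible ip (shift T s)) ->
  forall h, exists l, [/\ `[T (h - l)] = 0, r / 2 * `[l] <= `[T h] &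
    forall k, `[T k] = 0 -> ip l k = 0].
Proof.
move=> symT bT r0 inv h; have [M0 hM0] := bT.
(* Staying below [r / 2] lets the error [s n |l n|] be absorbed by half of [r |l n|]. *)
pose s (n : nat) : R := r / 2 * n.+1%:R^-1.
have s0 n : 0 < s n by rewrite mulr_gt0 ?invr_gt0 ?divr_gt0.
have s1 n : s n <= r / 2.
  by rewrite ler_piMr ?divr_ge0 ?(ltW r0) // invf_le1 // ler1n.
have ex n : exists x, `[shift T (s n) x - h] = 0.
  have [] : ip_invertible ip (shift T (s n)); last by move=> _; apply.
  by apply: inv; rewrite gtr0_norm // s0 /=; move: (s1 n) r0; lra.
have [x hx] := choice ex.
pose l n := T (x n).
have lip n y : ip (l n) y = s n * ip (x n) y + ip h y.
  have := ip_nulll sip y (hx n); rewrite /shift !ipE /l; lra.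
have range g : r * `[T g] <= `[T (T g)] by exact: isolated_range.
have Tl n y : ip (T (l n)) y = ip (T h) y + s n * ip (l n) y.
  by rewrite symT lip -!symT /l; lra.
have Tln n : `[T (l n) - T h] = s n * `[l n].
  have -> : `[T (l n) - T h] = `[s n *: l n].
    by rewrite /inorm !ipE !Tl !(ipC _ (T (l n))) !Tl !(ipC _ (T h)); congr Num.sqrt; ring.
  by rewrite inormZ // gtr0_norm.
have ln n : r / 2 * `[l n] <= `[T h].
  have := range (x n); have := inormD sip (T (l n) - T h) (T h).
  rewrite subrK Tln -/(l n); have := ler_wpM2r (nn (l n)) (s1 n); lra.
have Cl : icauchy ip l.
  move=> e e0.
  pose B := 2 / r * `[T h].
  have B0 : 0 <= B by rewrite mulr_ge0 ?nn ?divr_ge0 ?(ltW r0).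
  have B1 : 0 < B + 1 by rewrite ltr_wpDl.
  have [N /= _ hN] := near_infty_natSinv_lt (PosNum (divr_gt0 e0 B1)).
  exists N => m n Nm Nn.
  have hs k : (N <= k)%N -> s k * `[l k] < r * e / 2.
    move=> Nk; have := hN k Nk; rewrite /= ltr_pdivlMr // => hk.
    have h1 : `[l k] <= B by rewrite /B -ler_pdivrMl ?divr_gt0 // invf_div.
    have k0 : 0 < k.+1%:R^-1 :> R by rewrite invr_gt0.
    have h2 : k.+1%:R^-1 * `[l k] < e.
      by apply: le_lt_trans hk; rewrite ler_pM2l //; lra.
    rewrite /s; have : r / 2 * (k.+1%:R^-1 * `[l k]) < r / 2 * e.
      by rewrite ltr_pM2l // divr_gt0.
    by rewrite !mulrA (mulrAC r e).
  have dT : `[T (l m - l n)] <= s m * `[l m] + s n * `[l n].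
    have -> : `[T (l m - l n)] = `[(T (l m) - T h) - (T (l n) - T h)].
      apply: (inorm_congr sip); apply: inorm_ip_ext => y.
      rewrite !ipE symBl //; ring.
    by apply: le_trans (inormD sip _ _) _; rewrite inormN // !Tln.
  have dl : r * `[l m - l n] <= `[T (l m - l n)].
    have e1 : `[(l m - l n) - T (x m - x n)] = 0.
      apply: inorm_ip_ext => y.
      by rewrite !ipE symBl // /l; ring.
    have e2 : `[T (l m - l n) - T (T (x m - x n))] = 0.
      apply: inorm_ip_ext => y.
      by rewrite !ipE (symT (l m - l n)) (symT (T (x m - x n))) (ip_congl sip _ e1) subrr.
    by rewrite (inorm_congr sip e1) (inorm_congr sip e2).
  have : r * `[l m - l n] < r * e.
    apply: le_lt_trans dl (le_lt_trans dT _).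
    have := hs m Nm; have := hs n Nn; lra.
  by rewrite ltr_pM2l.
have [L hL] := comp Cl.
have ipL y : (fun n => ip (l n) y) @ \oo --> ip L y by exact: (icvg_ip sip).
have nL : r / 2 * `[L] <= `[T h].
  apply/ler_addgt0Pl => e e0.
  have e1 : 0 < 2 / r * e by rewrite mulr_gt0 // divr_gt0.
  have [N /(_ N (leqnn N))] := hL _ e1.
  rewrite mulrAC ltr_pdivlMr // => h1.
  have := ln N; have := inorm_le sip L (l N); rewrite inormB // => h2 h3.
  have : r / 2 * `[L] <= r / 2 * (`[l N - L] + `[l N]) by rewrite ler_pM2l // divr_gt0.
  lra.
exists L; split => //; last first.
  move=> k kk; have h0 : (fun n => ip (l n) k) = fun=> 0.
    by apply/funext => n; rewrite /l symT ipC; exact: (ip_nulll sip).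
  have := ipL k; rewrite h0 => h1.
  exact: (cvg_unique _ h1 (cvg_cst 0)).
apply: inorm_small => e e0.
have Ml : `|M0| + r / 2 + 1 > 0 by rewrite ltr_wpDl // addr_ge0 // divr_ge0 // ltW.
have e1 : 0 < e / (`|M0| + r / 2 + 1) / 2 by rewrite !divr_gt0.
have [N1 hN1] := hL _ e1.
pose B := 2 / r * `[T h].
have B0 : 0 <= B by rewrite mulr_ge0 ?nn ?divr_ge0 ?(ltW r0).
have B1 : 0 < r / 2 * B + 1 by rewrite ltr_wpDl // mulr_ge0 // divr_ge0 // ltW.
have e2 : 0 < e / 2 by rewrite divr_gt0.
have [N2 /= _ hN2] := near_infty_natSinv_lt (PosNum (divr_gt0 e2 B1)).
pose n := maxn N1 N2.
have := hN1 n (leq_maxl _ _); have := hN2 n (leq_maxr _ _) => /=.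
rewrite ltr_pdivlMr // => h2 h1.
have h3 : `[l n] <= B by rewrite /B -ler_pdivrMl ?divr_gt0 // invf_div.
have h4 : s n * `[l n] <= e / 2.
  apply: le_trans (ler_wpM2l (ltW (s0 n)) h3) _; rewrite /s.
  have k0 : 0 < n.+1%:R^-1 :> R by rewrite invr_gt0.
  move: h2 k0; rewrite mulrDr mulr1 [leLHS]mulrAC [leLHS]mulrC.
  by move: (_^-1) => t; lra.
have h5 : `[T (l n - L)] <= e / 2.
  apply: le_trans (hM0 _) _.
  have h6 : (`|M0| + r / 2 + 1) * `[l n - L] <= e / 2.
    by rewrite mulrC -ler_pdivlMr // mulrAC ltW.
  have := ler_wpM2r (nn (l n - L)) (ler_norm M0); have := nn (l n - L).
  move: h6; rewrite !mulrDl mul1r.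
  have : 0 <= r / 2 * `[l n - L] by rewrite mulr_ge0 ?nn ?divr_ge0 ?(ltW r0).
  lra.
have -> : `[T (h - L)] = `[T (l n - L) - (T (l n) - T h)].
  apply: (inorm_congr sip); apply: inorm_ip_ext => y.
  rewrite !ipE !symBl //; ring.
by apply: le_trans (inormD sip _ _) _; rewrite inormN // Tln; lra.
Qed.

(** What invertibility and an isolated zero with one-dimensional kernel have in common: along a
    weakly null sequence the kernel component fades away, so [T] acts there as if bounded below. *)
Definition regular_on_weakly_null (T : E -> E) := exists2 C, 0 < C &
  forall u, weakly_null ip u -> forall e, 0 < e ->
    (exists N, forall n, (N <= n)%N -> `[T (u n)] <= e) ->
    exists N, forall n, (N <= n)%N -> `[u n] <= C * e.

Lemma invertible_regular T : ip_invertible ip T -> regular_on_weakly_null T.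
Proof.
move=> [[c c0 hc] _]; exists c^-1; first by rewrite invr_gt0.
move=> u _ e e0 [N hN]; exists N => n Nn.
by rewrite -ler_pdivrMl ?invr_gt0 // invrK (le_trans (hc _)) // hN.
Qed.

(** Split [u n = nu + l] with [nu] in the kernel. Then [l] is controlled by [T (u n)], while
    [|nu|^2 = ip (u n) nu] is a multiple of [ip (u n) b], which tends to 0. *)
Lemma isolated_regular T (r : R) (b : E) :
  ip_symmetric ip T -> ip_bounded ip T -> 0 < r ->
  (forall s, 0 < `|s| < r -> ip_invertible ip (shift T s)) ->
  (forall x, `[T x] = 0 -> exists c, `[x - c *: b] = 0) ->
  regular_on_weakly_null T.
Proof.
move=> symT bT r0 inv ker.
exists (2 / r + 1); first by rewrite addr_gt0 // divr_gt0.
move=> u wu e e0 [N1 hN1].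
(* The boolean term keeps the tolerance positive when [b] is a null vector. *)
have e1 : 0 < e * `[b] + (`[b] == 0)%:R.
  have [b0|b0] := eqVneq `[b] 0; first by rewrite b0 mulr0 add0r.
  by rewrite addr0 mulr_gt0 // lt_neqAle eq_sym b0 nn.
have [N2 hN2] := wu b _ e1.
exists (maxn N1 N2) => n; rewrite geq_max => /andP[/hN1 h1 /hN2 h2].
have [l [h3 h4 h5]] := isolated_decomposition symT bT r0 inv (u n).
set nu := u n - l in h3.
have [c hc] := ker _ h3.
have unul : u n = nu + l by rewrite /nu subrK.
clearbody nu.
apply: le_trans (_ : `[nu] + `[l] <= _); first by rewrite {1}unul; exact: inormD.
have lbd : `[l] <= 2 / r * e.
  by rewrite -ler_pdivrMl ?divr_gt0 // invf_div (le_trans h4).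
rewrite mulrDl mul1r addrC lerD //.
have nuu : ip (u n) nu = `[nu] ^+ 2 by rewrite nsq {1}unul !ipE (h5 _ h3) addr0.
have nub : ip (u n) nu = c * ip (u n) b.
  by rewrite ipC (ip_congl sip _ hc) ipE ipC.
have cb : `[nu] = `|c| * `[b] by rewrite (inorm_congr sip hc) inormZ.
have [b0|b0] := eqVneq `[b] 0; first by rewrite cb b0 mulr0 ltW.
move: h2; rewrite (negbTE b0) addr0 => h2.
have h6 : `[nu] * `[nu] <= e * `[nu].
  rewrite -expr2 -nuu nub (le_trans (ler_norm _)) // normrM cb mulrCA.
  by rewrite ler_wpM2l // ltW.
have [->|nu0] := eqVneq `[nu] 0; first exact: ltW.
by move: h6; rewrite ler_pM2r // lt_neqAle eq_sym nu0 nn.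
Qed.

(** Subsequences are index maps with [n <= k n]; this is enough to preserve weak convergence. *)
Lemma eventually_wlog (P : nat -> Prop) :
  ~ (exists N, forall n, (N <= n)%N -> P n) ->
  exists2 k : nat -> nat, forall n, (n <= k n)%N & forall n, ~ P (k n).
Proof.
move=> h.
have /choice[k hk] N : exists n, (N <= n)%N /\ ~ P n.
  apply: contrapT => h'; apply: h; exists N => n Nn.
  by apply: contrapT => h''; apply: h'; exists n.
by exists k => n; have [] := hk n.
Qed.

Lemma weakly_null_sub u (k : nat -> nat) : (forall n, (n <= k n)%N) ->
  weakly_null ip u -> weakly_null ip (u \o k).
Proof.
move=> hk wu y e e0; have [N hN] := wu y e e0; exists N => n Nn.
exact/hN/(leq_trans Nn).
Qed.

Lemma weakly_null_sym T u :
  ip_symmetric ip T -> weakly_null ip u -> weakly_null ip (T \o u).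
Proof.
move=> symT wu y e e0; have [N hN] := wu (T y) e e0; exists N => n Nn.
by rewrite /= symT hN.
Qed.

Lemma weakly_null_scale u (c : nat -> R) M : (forall n, `|c n| <= M) ->
  weakly_null ip u -> weakly_null ip (fun n => c n *: u n).
Proof.
move=> hc wu y e e0.
have M1 : 0 < `|M| + 1 by rewrite ltr_wpDl.
have [N hN] := wu y _ (divr_gt0 e0 M1); exists N => n Nn.
rewrite ipE normrM.
have := hN n Nn; rewrite ltr_pdivlMr //; apply: le_lt_trans.
rewrite mulrC ler_wpM2l // (le_trans (hc n)) // (le_trans (ler_norm _)) //.
by rewrite lerDl.
Qed.

(* With l the largest asymptotic value of |A f_n| over weakly null unit
   sequences, (A^2 - l^2) f_n is asymptotically small along a nearly
   maximising sequence. *)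
Theorem weak_to_strong A : ip_symmetric ip A -> ip_bounded ip A ->
  (forall m, m != 0 -> regular_on_weakly_null (shift A m)) ->
  forall u, weakly_null ip u -> (exists M, forall n, `[u n] <= M) ->
  forall e, 0 < e -> exists N, forall n, (N <= n)%N -> `[A (u n)] <= e.
Proof.
move=> symA [M0 hM0] reg.
pose M := `|M0| + 1.
have M1 : 0 < M by rewrite ltr_wpDl.
have hM x : `[A x] <= M * `[x].
  apply: le_trans (hM0 x) _; apply: ler_wpM2r; first exact: nn.
  by rewrite /M (le_trans (ler_norm _)) // lerDl.
(* The lower bound is imposed for every [n]; a bound that holds infinitely often reduces to it by
   passing to a subsequence. *)
pose L := [set r : R | exists f, [/\ weakly_null ip f,
  forall n, `[f n] <= 1 & forall n, r <= `[A (f n)]]].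
have LM r : L r -> r <= M.
  move=> [f [_ f1 rf]]; apply: le_trans (rf 0%N) (le_trans (hM _) _).
  by rewrite ger_pMr.
have L0 : L 0.
  exists (fun=> 0); split => // [y e e0|n].
    by exists 0%N => n _; rewrite ip0l // normr0.
  by rewrite inorm0 // ltW.
have hL : has_sup L by split; [exists 0 | exists M].
pose l := sup L.
have l0 : 0 <= l by apply: ub_le_sup => //; exists M.
have Ll r : L r -> r <= l by move=> Lr; apply: ub_le_sup => //; exists M.
have main f : weakly_null ip f -> (forall n, `[f n] <= 1) ->
    forall e, 0 < e -> exists N, forall n, (N <= n)%N -> `[A (f n)] <= l + e.
  move=> wf f1 e e0; apply: contrapT => /eventually_wlog[k hk hk'].
  suff : l + e <= l by rewrite leNgt ltrDl e0.
  apply: Ll; exists (f \o k); split => //; first exact: weakly_null_sub.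
    by move=> n; exact: f1.
  by move=> n; apply: ltW; rewrite ltNge; apply/negP; exact: hk'.
have scaled f M' : weakly_null ip f -> (forall n, `[f n] <= M') ->
    forall e, 0 < e -> exists N, forall n, (N <= n)%N -> `[A (f n)] <= (l + e) * (`|M'| + 1).
  move=> wf fM e e0.
  have M'1 : 0 < `|M'| + 1 by rewrite ltr_wpDl.
  have [||N hN] := main (fun n => (`|M'| + 1)^-1 *: f n) _ _ e e0.
  - apply: (weakly_null_scale (M := (`|M'| + 1)^-1)) => // n.
    by rewrite gtr0_norm // invr_gt0.
  - move=> n; rewrite inormZ // gtr0_norm ?invr_gt0 // ler_pdivrMl // mulr1.
    by rewrite (le_trans (fM n)) // (le_trans (ler_norm _)) // lerDl.
  exists N => n Nn; rewrite mulrC -ler_pdivrMl //.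
  rewrite -(gtr0_norm (x := (`|M'| + 1)^-1)) ?invr_gt0 // -inormZ //.
  rewrite (_ : `[_] = `[A ((`|M'| + 1)^-1 *: f n)]) ?hN //.
  apply: (inorm_congr sip); apply: inorm_ip_ext => y.
  by rewrite !ipE symZl // subrr.
have [l00|lp] := eqVneq l 0.
  move=> u wu [M' hM'] e e0.
  have M'1 : 0 < `|M'| + 1 by rewrite ltr_wpDl.
  have [N hN] := scaled u M' wu hM' _ (divr_gt0 e0 M'1).
  by exists N => n /hN; rewrite l00 add0r divfK // gt_eqF.
exfalso.
have {}lp : 0 < l by rewrite lt_neqAle eq_sym lp.
have [C1 C10 hC1] := reg _ (lt0r_neq0 lp).
have [C2 C20 hC2] : regular_on_weakly_null (shift A (- l)).
  by apply: reg; rewrite oppr_eq0 gt_eqF.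
(* (l - e) / M < C2 C1 d with d^2 = 10 l^3 e *)
pose k := l / 2 / M / (C1 * C2) / 2.
have k0 : 0 < k by rewrite !divr_gt0 ?mulr_gt0.
pose e := Num.min (l / 10) (k ^+ 2 / (20 * l ^+ 3)).
have e0 : 0 < e.
  have k2 : 0 < k ^+ 2 by exact: exprn_gt0.
  have l3 : 0 < 20 * l ^+ 3 by rewrite mulr_gt0 ?exprn_gt0 ?ltr0n.
  by rewrite lt_min; apply/andP; split; apply: divr_gt0; rewrite ?ltr0n.
have e1 : e <= l / 10 by rewrite ge_min lexx.
have e2 : 20 * l ^+ 3 * e <= k ^+ 2.
  by rewrite -ler_pdivlMl ?mulr_gt0 ?exprn_gt0 // ge_min (mulrC _^-1) lexx orbT.
have [r Lr lr] := sup_adherent e0 hL; rewrite -/l in lr.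
have [f [wf f1 rf]] := Lr.
have wAf : weakly_null ip (A \o f) by exact: weakly_null_sym.
have r0 : 0 < r by lra.
have Afr n : r <= `[A (f n)] by exact: rf.
have [N1 hN1] := main f wf f1 e e0.
(* [A f_n] is normalised in order to be compared with [l] again. Since [|A f_n|] stays above [r],
   the division preserves weak nullity. *)
pose y n := `[A (f n)]^-1 *: A (f n).
have Afp n : 0 < `[A (f n)] by exact: lt_le_trans (Afr n).
have [||N2 hN2] := main y _ _ e e0.
- apply: (weakly_null_scale (M := r^-1)) => // n.
  by rewrite gtr0_norm ?invr_gt0 // lef_pV2 ?posrE.
- by move=> n; rewrite inormZ // gtr0_norm ?invr_gt0 // mulVf // gt_eqF.
have {hN2} hN2 n : (N2 <= n)%N -> `[A (A (f n))] <= (l + e) * `[A (f n)].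
  move=> /hN2 h; rewrite mulrC -ler_pdivrMl //; apply: le_trans h.
  rewrite -(gtr0_norm (x := `[A (f n)]^-1)) ?invr_gt0 // -inormZ //.
  rewrite (_ : `[_] = `[A (y n)]) //.
  apply: (inorm_congr sip); apply: inorm_ip_ext => z.
  by rewrite /y !ipE symZl // subrr.
have small n : (maxn N1 N2 <= n)%N ->
    `[shift A l (shift A (- l) (f n))] <= k.
  rewrite geq_max => /andP[/hN1 h1 /hN2 h2].
  rewrite -(ler_pXn2r (n := 2)) ?nnegrE ?nn ?(ltW k0) //.
  have -> : `[shift A l (shift A (- l) (f n))] ^+ 2 =
      `[A (A (f n))] ^+ 2 - 2 * l ^+ 2 * `[A (f n)] ^+ 2 + l ^+ 4 * `[f n] ^+ 2.
    have E1 z : ip (shift A l (shift A (- l) (f n))) z =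
        ip (A (A (f n))) z - l ^+ 2 * ip (f n) z.
      rewrite /shift !scaleNr !opprK !ipE !(symDl sip _ _ _ symA) !(symZl sip _ _ _ symA); ring.
    rewrite !nsq E1 (ipC (A (A _))) (ipC (f n)) !E1 (ipC (f n) (A (A _))).
    rewrite (symA (A (f n)) (f n)); ring.
  have b1 : `[A (A (f n))] ^+ 2 <= (l + e) ^+ 2 * `[A (f n)] ^+ 2.
    by rewrite -exprMn ler_pXn2r ?nnegrE ?mulr_ge0 ?nn ?addr_ge0 ?(ltW e0).
  have b2 : (l - e) ^+ 2 <= `[A (f n)] ^+ 2.
    have le1 : 0 <= l - e by lra.
    have le2 : l - e <= `[A (f n)] by rewrite (le_trans (ltW lr)).
    by rewrite ler_pXn2r ?nnegrE ?nn.
  have b3 : l ^+ 4 * `[f n] ^+ 2 <= l ^+ 4.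
    by rewrite ger_pMr ?exprn_gt0 // expr_le1 ?nn.
  (* The coefficient is negative because [e <= l / 10], so it is the lower bound [l - e] on
     [|A f_n|] that enters here. This is where near maximality is used. *)
  have b4 : ((l + e) ^+ 2 - 2 * l ^+ 2) * `[A (f n)] ^+ 2 <=
            ((l + e) ^+ 2 - 2 * l ^+ 2) * (l - e) ^+ 2.
    by apply: ler_wnM2l => //; nra.
  have b5 : ((l + e) ^+ 2 - 2 * l ^+ 2) * (l - e) ^+ 2 + l ^+ 4 <= 20 * l ^+ 3 * e.
    have -> : ((l + e) ^+ 2 - 2 * l ^+ 2) * (l - e) ^+ 2 + l ^+ 4 =
       4 * l ^+ 3 * e - 4 * l ^+ 2 * e ^+ 2 + e ^+ 4 by ring.
    have : e ^+ 4 <= l ^+ 3 * e.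
      rewrite exprS mulrC ler_pM2r // ler_pXn2r ?nnegrE ?(ltW e0) //; lra.
    have : 0 <= l ^+ 2 * e ^+ 2 by rewrite mulr_ge0 ?sqr_ge0.
    have : 0 <= l ^+ 3 * e by rewrite mulr_ge0 ?exprn_ge0 ?(ltW e0).
    lra.
  lra.
(* The factors [A - l] and [A + l] are cancelled one after the other, so [(A + l) f_n] must be
   weakly null too; symmetry of [A + l] gives this. *)
have wB : weakly_null ip (fun n => shift A (- l) (f n)).
  by apply: weakly_null_sym => //; exact: shift_symmetric.
have [|N3 hN3] := hC1 _ wB k k0; first by exists (maxn N1 N2).
have [||N4 hN4] := hC2 _ wf (C1 * k); first by rewrite mulr_gt0.
  by exists N3.
have := hN4 _ (leqnn _); set n := N4 => h1.
have := hM (f n); have := Afr n => h2 h3.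
have : l / 2 <= M * (C2 * (C1 * k)).
  apply: le_trans (_ : M * `[f n] <= _); last by rewrite ler_pM2l.
  lra.
have -> : M * (C2 * (C1 * k)) = l / 4.
  by rewrite /k; field; rewrite !gt_eqF.
lra.
Qed.

End WeakToStrong.

(** * Symmetric relations with a regular value at [-1] *)

Section SymmetricRelation.
Variables (R : realType) (E : lmodType R) (ip : E -> E -> R).
Hypothesis sip : semi_inner ip.
Hypothesis comp : icomplete ip.
Local Notation "`[ x ]" := (inorm ip x) (format "`[ x ]").
Let ipE := ipE sip.
Let ipC := ipC sip.
Let nn := inorm_ge0 ip.
Let nsq := inorm_sqr sip.

Variable S : E -> E -> Prop.

Definition symmetric_relation : Prop :=
  [/\ forall c f g f' g', S f g -> S f' g' -> S (c *: f + f') (c *: g + g'),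
      forall f g f' g', S f g -> `[f' - f] = 0 -> `[g' - g] = 0 -> S f' g' &
      forall f g f' g', S f g -> S f' g' -> ip f g' = ip g f'].

Definition regular_below (w : R) : Prop :=
  exists M, forall f g, S f g -> `[f] <= M * `[g - w *: f].

Definition regular_value (w : R) : Prop :=
  regular_below w /\ forall h, exists f g, S f g /\ `[g - w *: f - h] = 0.

Hypothesis symS : symmetric_relation.
Hypothesis reg1 : regular_value (-1).

Let Slin c f g f' g' : S f g -> S f' g' -> S (c *: f + f') (c *: g + g').
Proof. by case: symS => h _ _; exact: h. Qed.
Let Snull f g f' g' : S f g -> `[f' - f] = 0 -> `[g' - g] = 0 -> S f' g'.
Proof. by case: symS => _ h _; exact: h. Qed.
Let Ssym f g f' g' : S f g -> S f' g' -> ip f g' = ip g f'.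
Proof. by case: symS => _ _ h; exact: h. Qed.

Let SB f g f' g' : S f g -> S f' g' -> S (f - f') (g - g').
Proof. by move=> h1 h2; have := Slin (-1) h2 h1; rewrite !scaleN1r !(addrC (- _)). Qed.
Let SZ c f g : S f g -> S (c *: f) (c *: g).
Proof.
move=> h; have h0 : S 0 0 by have := SB h h; rewrite !subrr.
by have := Slin c h h0; rewrite !addr0.
Qed.

(** [A] is [(S + 1)^-1], the equation [(S + 1) A h = h] being written on the graph. *)
Lemma resolvent_exists : exists2 A : E -> E, forall h, S (A h) (h - A h) &
  ip_symmetric ip A /\ ip_bounded ip A.
Proof.
case: reg1 => -[M hM] ont.
have ex h : exists f, S f (h - f).
  have [f [g [Sfg h0]]] := ont h; exists f; apply: (Snull Sfg).
    by rewrite subrr inorm0.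
  by apply: inorm_ip_ext => y; have := ip_nulll sip y h0; rewrite !ipE; lra.
have [A hA] := choice ex; exists A => //; split.
  by move=> x y; have := Ssym (hA x) (hA y); rewrite !ipE; lra.
exists M => x; have := hM _ _ (hA x).
by rewrite scaleN1r opprK subrK.
Qed.

(** The identity [(S - w) A = 1 - (w + 1) A] transfers regularity from [S] at [w] to [A] at
    [(w + 1)^-1]. *)
Lemma regular_invertible A w : (forall h, S (A h) (h - A h)) ->
  w + 1 != 0 -> regular_value w -> ip_invertible ip (shift A (w + 1)^-1).
Proof.
move=> hA w1 [[M hM] ont].
have w0 : 0 < `|w + 1| by rewrite normr_gt0.
have key' x : `[x - A x - w *: A x] = `|w + 1| * `[shift A (w + 1)^-1 x].
  rewrite -normrN -inormZ //; apply: (inorm_congr sip); apply: inorm_ip_ext => y.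
  by rewrite /shift !ipE; field.
have D0 : 0 < `|w + 1| * `|M| + 1 by rewrite ltr_wpDl // mulr_ge0.
split.
  exists ((`|w + 1| * `|M| + 1) * `|w + 1|)^-1; first by rewrite invr_gt0 mulr_gt0.
  move=> x; rewrite ler_pdivrMl ?mulr_gt0 // -mulrA -key'.
  have h1 := hM _ _ (hA x).
  have h2 : `[x] <= `[x - A x - w *: A x] + `|w + 1| * `[A x].
    have -> : `[x] = `[(x - A x - w *: A x) + (w + 1) *: A x].
      by apply: (inorm_congr sip); apply: inorm_ip_ext => y; rewrite !ipE; ring.
    by apply: le_trans (inormD sip _ _) _; rewrite inormZ.
  have h3 : `[A x] <= `|M| * `[x - A x - w *: A x].
    by apply: le_trans h1 _; rewrite ler_wpM2r ?nn // ler_norm.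
  have := ler_wpM2l (ltW w0) h3; lra.
move=> h; have [f [g [Sfg h0]]] := ont (- (w + 1) *: h).
have [[M1 hM1] _] := reg1.
(* Up to a null vector [f = A (f + g)], so [A - (w + 1)^-1] sends [f + g] to [(w f - g) / (w + 1)],
   which is [h]. *)
exists (f + g).
have Af : `[f - A (f + g)] = 0.
  apply/le_anti; rewrite nn andbT.
  have h1 : `[g - (f + g - A (f + g)) - -1 *: (f - A (f + g))] = 0.
    by apply: inorm_ip_ext => y; rewrite !ipE; ring.
  by have := hM1 _ _ (SB Sfg (hA (f + g))); rewrite h1 mulr0.
have : `|w + 1| * `[shift A (w + 1)^-1 (f + g) - h] = 0.
  rewrite -normrN -inormZ // -h0; apply: (inorm_congr sip).
  apply: inorm_ip_ext => y; have := ip_nulll sip y Af.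
  by rewrite /shift !ipE => /eqP; rewrite subr_eq0 => /eqP <-; field.
by move/eqP; rewrite mulf_eq0 gt_eqF //= => /eqP.
Qed.

Theorem isolated_simple_weak_to_strong :
  (forall w, regular_value w \/
     (exists2 e, 0 < e & forall w', 0 < `|w' - w| < e -> regular_value w') /\
     (exists b, forall f, S f (w *: f) -> exists c, `[f - c *: b] = 0)) ->
  forall h f, weakly_null ip h -> (exists M, forall n, `[h n] <= M) ->
  (forall n, S (f n) (h n - f n)) ->
  forall e, 0 < e -> exists N, forall n, (N <= n)%N -> `[f n] <= e.
Proof.
move=> hyp h f wh bh Sfh e e0.
have [A hA [symA bA]] := resolvent_exists.
have [[M1 hM1] _] := reg1.
have Af n : `[A (h n)] = `[f n].
  apply: (inorm_congr sip); apply/le_anti; rewrite nn andbT.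
  have h1 : `[h n - A (h n) - (h n - f n) - -1 *: (A (h n) - f n)] = 0.
    by apply: inorm_ip_ext => y; rewrite !ipE; ring.
  by have := hM1 _ _ (SB (hA (h n)) (Sfh n)); rewrite h1 mulr0.
have [|N hN] := weak_to_strong sip symA bA _ wh bh e0; last first.
  by exists N => n /hN; rewrite Af.
move=> m m0; set w := m^-1 - 1.
have wm : (w + 1)^-1 = m by rewrite /w subrK invrK.
have w1 : w + 1 != 0 by rewrite /w subrK invr_eq0.
have [rw|[[d d0 iso] [b hb]]] := hyp w.
  by apply: invertible_regular => //; rewrite -wm; exact: regular_invertible.
(* [|s| < |m| / 2] keeps [|m + s|] above [|m| / 2]; then [(m + s)^-1 - m^-1 = - s / (m (m + s))] has
   modulus below [d] once [|s| < d m^2 / 2]. *)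
pose r := Num.min (`|m| / 2) (d * m ^+ 2 / 2).
have m0' : 0 < `|m| by rewrite normr_gt0.
have r0 : 0 < r.
  by rewrite lt_min !divr_gt0 // mulr_gt0 // -real_normK ?num_real // exprn_gt0.
apply: (isolated_regular (b := b) sip comp (shift_symmetric sip m symA)
   (shift_bounded sip m bA) r0).
  move=> s /andP[s0 sr].
  have -> : shift (shift A m) s = shift A (m + s).
    by apply/funext => x; rewrite /shift scalerDl opprD addrA.
  have sm : `|s| < `|m| / 2 by move: sr; rewrite lt_min => /andP[].
  have sd : `|s| < d * m ^+ 2 / 2 by move: sr; rewrite lt_min => /andP[].
  have ms : `|m| / 2 < `|m + s|.
    have := ler_normD (m + s) (- s); rewrite addrK normrN; lra.
  have ms0 : m + s != 0 by rewrite -normr_gt0; apply: lt_trans ms; rewrite divr_gt0.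
  have -> : m + s = (((m + s)^-1 - 1) + 1)^-1 by rewrite subrK invrK.
  apply: regular_invertible => //; first by rewrite subrK invr_eq0.
  apply: iso; rewrite /w (_ : _ - _ - _ = - s / (m * (m + s))); last first.
    by field; rewrite m0 ms0.
  rewrite normrM normrN normfV normrM.
  have D0 : 0 < `|m| * `|m + s| by rewrite mulr_gt0 // normr_gt0.
  apply/andP; split; first exact: divr_gt0.
  rewrite ltr_pdivrMr //; apply: lt_le_trans sd _.
  have m2 : m ^+ 2 = `|m| ^+ 2 by rewrite real_normK ?num_real.
  have -> : d * m ^+ 2 / 2 = d * (`|m| * (`|m| / 2)) by rewrite m2; ring.
  by rewrite !ler_pM2l // ltW.
(* [A] carries a kernel vector [x] of [A - m] to an eigenvector of [S] at [w], and [x] is recovered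
   as [m^-1 A x] up to a null vector. *)
move=> x hx; have [|c hc] := hb (A x).
  apply: (Snull (hA x)); first by rewrite subrr inorm0.
  rewrite -[RHS](mulr0 `|m^-1|) -hx -inormZ //; apply: (inorm_congr sip).
  by apply: inorm_ip_ext => y; rewrite /shift /w !ipE; field.
exists (m^-1 * c); rewrite -scalerA.
have -> : `[x - m^-1 *: (c *: b)] = `[m^-1 *: (A x - c *: b)].
  apply: (inorm_congr sip); rewrite -[RHS](mulr0 `|- m^-1|) -hx -inormZ //.
  by apply: (inorm_congr sip); apply: inorm_ip_ext => y; rewrite /shift !ipE; field.
by rewrite inormZ // hc mulr0.
Qed.

(** Membership in the graph amounts to [l = A (l + k)], and the lower bound at [-1] lets this
    equation pass to the limit. *)
Lemma relation_closed f g l k : (forall n, S (f n) (g n)) ->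
  icvg ip f l -> icvg ip g k -> S l k.
Proof.
move=> Sfg fl gk; have [A hA _] := resolvent_exists; have [[M hM] _] := reg1.
suff h0 : `[l - A (l + k)] = 0.
  apply: (Snull (hA (l + k))) => //.
  apply: inorm_ip_ext => y; have := ip_nulll sip y h0; rewrite !ipE; lra.
apply: inorm_small => e e0.
have D0 : 0 < 2 * (`|M| + 1) by rewrite mulr_gt0 // ltr_wpDl.
have d0 := divr_gt0 e0 D0.
have [N1 hN1] := fl _ d0; have [N2 hN2] := gk _ d0; pose n := maxn N1 N2.
have := hN1 n (leq_maxl _ _); have := hN2 n (leq_maxr _ _).
rewrite !ltr_pdivlMr // => h2 h1.
have := hM _ _ (SB (Sfg n) (hA (l + k))).
rewrite (_ : `[_ - -1 *: _] = `[(g n - k) + (f n - l)]); last first.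
  by apply: (inorm_congr sip); apply: inorm_ip_ext => y; rewrite !ipE; ring.
move=> h3; have h4 := inormD sip (g n - k) (f n - l).
have h5 : `[f n - A (l + k)] <= `|M| * (`[g n - k] + `[f n - l]).
  apply: le_trans h3 _; apply: le_trans (_ : `|M| * `[g n - k + (f n - l)] <= _).
    by rewrite ler_wpM2r ?nn ?ler_norm.
  by rewrite ler_wpM2l.
have h6 := inormD sip (l - f n) (f n - A (l + k)).
rewrite addrA subrK (inormB sip l (f n)) in h6.
have := nn (f n - l); have := nn (g n - k); have := normr_ge0 M.
move: h1 h2 h5 h6; nra.
Qed.

(** Compactness of the resolvent, expressed through sequences bounded in the graph norm. *)
Definition compact_relation : Prop := forall (f g : nat -> E) B,
  (forall n, S (f n) (g n)) -> (forall n, `[f n] <= B) -> (forall n, `[g n] <= B) ->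
  exists2 k : nat -> nat, (forall n, (n <= k n)%N) & icauchy ip (f \o k).

Hypothesis cptS : compact_relation.

Let harmonic_lt (e : R) : 0 < e -> exists N, forall n, (N <= n)%N -> n.+1%:R^-1 < e.
Proof.
by move=> e0; have [N _ hN] := near_infty_natSinv_lt (PosNum e0); exists N.
Qed.

(** Otherwise there are unit vectors [f n] with [(S - w) f n] tending to 0; a limit of a subsequence
    would be a unit vector in the kernel. *)
Lemma compact_below w : (forall f, S f (w *: f) -> `[f] = 0) -> regular_below w.
Proof.
move=> ker; apply: contrapT => /forallNP nb.
have /choice[p hp] n : exists p : E * E, [/\ S p.1 p.2, `[p.1] = 1 &
    `[p.2 - w *: p.1] <= n.+1%:R^-1].
  apply: contrapT => h; apply: (nb n.+1%:R) => f g Sfg.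
  rewrite leNgt; apply/negP => h1; apply: h.
  have f0 : 0 < `[f] by apply: le_lt_trans h1; rewrite mulr_ge0 ?nn.
  exists (`[f]^-1 *: f, `[f]^-1 *: g); split => /=; first exact: SZ.
    by rewrite inormZ // gtr0_norm ?invr_gt0 // mulVf // gt_eqF.
  rewrite scalerA mulrC -scalerA -scalerBr inormZ // gtr0_norm ?invr_gt0 //.
  by rewrite ler_pdivrMl // ler_pdivlMr // mulrC ltW.
pose f n := (p n).1; pose g n := (p n).2.
have Sfg n : S (f n) (g n) by have [] := hp n.
have f1 n : `[f n] = 1 by have [] := hp n.
have gw n : `[g n - w *: f n] <= n.+1%:R^-1 by have [] := hp n.
have [||k hk Ck] := cptS (B := `|w| + 1) Sfg.
- by move=> n; rewrite f1 lerDr.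
- move=> n; apply: le_trans (inorm_le sip _ (w *: f n)) _.
  by rewrite inormZ // f1 mulr1 addrC lerD2l (le_trans (gw n)) // invf_le1 ?ler1n ?ltr0n.
- have [l hl] := comp Ck.
have [N0 hN0] := hl _ ltr01.
have Sl : S l (w *: l).
  apply: (@relation_closed (f \o k) (g \o k) _ _ (fun n => Sfg (k n)) hl) => e e0.
  have D0 : 0 < 2 * (`|w| + 1) by rewrite mulr_gt0 // ltr_wpDl.
  have d0 := divr_gt0 e0 D0.
  have [N1 hN1] := hl _ d0.
  have [N2 hN2] := harmonic_lt (divr_gt0 e0 (ltr0n R 2 : 0 < 2)).
  exists (maxn N1 N2) => n; rewrite geq_max => /andP[n1 n2] /=.
  have h1 := hN1 n n1; rewrite /= ltr_pdivlMr // in h1.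
  have h2 := hN2 _ (leq_trans n2 (hk n)).
  have := inormD sip (g (k n) - w *: f (k n)) (w *: (f (k n) - l)).
  rewrite scalerBr addrA subrK -scalerBr inormZ // => h3.
  have h4 := le_lt_trans (gw (k n)) h2; have := nn (f (k n) - l).
  by clear h2; lra.
have l0 := ker _ Sl.
have [N hN] := hl _ ltr01.
have := hN N (leqnn N); have := inorm_le sip (f (k N)) l.
by rewrite f1 l0 /=; lra.
Qed.

(** The hypothesis is [(S - w - i d) (u + i v) = h] split into real and imaginary parts. As [d]
    tends to 0, the lower bound at [w] gives [|v| <= M d |u|]; hence [u] stays bounded and
    [(S - w) u] tends to [h]. *)
Lemma compact_onto w : regular_below w ->
  (forall d, d != 0 -> forall h, exists u v gu gv, [/\ S u gu, S v gv,
     `[gu - w *: u + d *: v - h] = 0 & `[gv - w *: v - d *: u] = 0]) ->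
  regular_value w.
Proof.
move=> rb hyp; split=> // h; case: rb => M0 hM0.
pose M := `|M0| + 1.
have M1 : 0 < M by rewrite ltr_wpDl.
have hM f g : S f g -> `[f] <= M * `[g - w *: f].
  move=> /hM0 h1; apply: le_trans h1 _; rewrite ler_wpM2r ?nn //.
  by rewrite (le_trans (ler_norm _)) // lerDl.
(* The factor makes [M d n <= 1 / 2], enough to absorb the contribution of [v] in the bound on
   [u]. *)
pose d n : R := (2 * M)^-1 * n.+1%:R^-1.
have d0 n : 0 < d n by rewrite mulr_gt0 ?invr_gt0 ?mulr_gt0.
have dM n : M * d n <= 1 / 2.
  have h1 : (n.+1%:R^-1 : R) <= 1 by rewrite invf_le1 ?ler1n ?ltr0n.
  have -> : M * d n = n.+1%:R^-1 / 2.
    by rewrite /d; move: (_.+1%:R^-1) => t; field; rewrite gt_eqF.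
  by rewrite ler_pM2r.
have /choice[p hp] n : exists p : E * E * E * E, [/\ S p.1.1.1 p.1.2, S p.1.1.2 p.2,
     `[p.1.2 - w *: p.1.1.1 + d n *: p.1.1.2 - h] = 0 &
     `[p.2 - w *: p.1.1.2 - d n *: p.1.1.1] = 0].
  have [u [v [gu [gv H]]]] := hyp (d n) (lt0r_neq0 (d0 n)) h.
  by exists (u, v, gu, gv).
pose u n := (p n).1.1.1; pose v n := (p n).1.1.2.
pose gu n := (p n).1.2; pose gv n := (p n).2.
have Su n : S (u n) (gu n) by have [] := hp n.
have Sv n : S (v n) (gv n) by have [] := hp n.
have eu n : `[(gu n - w *: u n) - (h - d n *: v n)] = 0.
  have [_ _ h1 _] := hp n.
  by apply: inorm_ip_ext => y; have := ip_nulll sip y h1; rewrite !ipE; lra.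
have ev n : `[(gv n - w *: v n) - d n *: u n] = 0 by have [] := hp n.
have bv n : `[v n] <= M * d n * `[u n].
  apply: le_trans (hM _ _ (Sv n)) _; rewrite (inorm_congr sip (ev n)) inormZ //.
  by rewrite gtr0_norm // mulrA.
have bu n : `[u n] <= 2 * M * `[h].
  have := hM _ _ (Su n); rewrite (inorm_congr sip (eu n)).
  have := inormD sip h (- (d n *: v n)); rewrite inormN // inormZ // gtr0_norm //.
  move=> h1 h2.
  have h3 : `[u n] <= M * `[h] + M * d n * `[v n].
    by apply: le_trans h2 _; rewrite -mulrA -mulrDr ler_pM2l.
  have := dM n; have := bv n; have := nn (u n); have := nn (v n).
  have : 0 < M * d n by rewrite mulr_gt0.
  have : 0 <= M * `[h] by rewrite mulr_ge0 ?nn ?(ltW M1).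
  move: h3; nra.
pose C := M * `[h].
have C0 : 0 <= C by rewrite mulr_ge0 ?nn ?(ltW M1).
have bg n : `[(gu n - w *: u n) - h] <= C * d n.
  have -> : `[(gu n - w *: u n) - h] = `[d n *: v n].
    rewrite -[in RHS]inormN //; apply: (inorm_congr sip); apply: inorm_ip_ext => y.
    by have := ip_nulll sip y (eu n); rewrite !ipE; lra.
  rewrite inormZ // gtr0_norm // mulrC ler_pM2r //.
  apply: le_trans (bv n) _; apply: le_trans (ler_wpM2r (nn _) (dM n)) _.
  by rewrite /C; have := bu n; lra.
have hd e : 0 < e -> exists N, forall n, (N <= n)%N -> d n < e.
  move=> e0; have [|N hN] := @harmonic_lt (2 * M * e); first by rewrite !mulr_gt0.
  exists N => n /hN; rewrite /d => h1.
  by rewrite ltr_pdivrMl // mulr_gt0.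
have Cu : icauchy ip u.
  move=> e e0.
  have D0 : 0 < 2 * M * C + 1 by rewrite ltr_wpDl // !mulr_ge0 ?(ltW M1).
  have [N hN] := hd _ (divr_gt0 e0 D0); exists N => m n Nm Nn.
  apply: le_lt_trans (hM _ _ (SB (Su m) (Su n))) _.
  have -> : `[gu m - gu n - w *: (u m - u n)] =
      `[((gu m - w *: u m) - h) - ((gu n - w *: u n) - h)].
    by apply: (inorm_congr sip); apply: inorm_ip_ext => y; rewrite !ipE; ring.
  have h1 := inormD sip ((gu m - w *: u m) - h) (- ((gu n - w *: u n) - h)).
  rewrite inormN // in h1.
  have := hN m Nm; have := hN n Nn; rewrite !ltr_pdivlMr // => h2 h3.
  have h4 : `[(gu m - w *: u m) - h - ((gu n - w *: u n) - h)] <= C * d m + C * d n.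
    by apply: le_trans h1 _; rewrite lerD.
  apply: le_lt_trans (_ : M * (C * d m + C * d n) < e).
    by rewrite ler_pM2l.
  have := d0 m; have := d0 n; lra.
have [l hl] := comp Cu.
exists l, (w *: l + h); split; last by apply: inorm_ip_ext => y; rewrite !ipE; ring.
apply: (relation_closed Su hl) => e e0.
have D1 : 0 < 2 * (C + 1) by rewrite mulr_gt0 // ltr_wpDl.
have D2 : 0 < 2 * (`|w| + 1) by rewrite mulr_gt0 // ltr_wpDl.
have [N1 hN1] := hd _ (divr_gt0 e0 D1).
have [N2 hN2] := hl _ (divr_gt0 e0 D2).
exists (maxn N1 N2) => n; rewrite geq_max => /andP[/hN1 + /hN2].
rewrite !ltr_pdivlMr // => h1 h2.
have -> : `[gu n - (w *: l + h)] = `[((gu n - w *: u n) - h) + w *: (u n - l)].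
  by apply: (inorm_congr sip); apply: inorm_ip_ext => y; rewrite !ipE; ring.
apply: le_lt_trans (inormD sip _ _) _; rewrite inormZ //.
have := bg n; have := nn (u n - l); have := d0 n; lra.
Qed.

(** Unit eigenvectors for distinct eigenvalues lie at squared distance 2, so eigenvalues
    accumulating at [w] would yield a sequence without Cauchy subsequence. *)
Lemma compact_isolated w : exists2 e, 0 < e &
  forall w', 0 < `|w' - w| < e -> forall f, S f (w' *: f) -> `[f] = 0.
Proof.
apply: contrapT => /forall2NP nb.
have /choice[p hp] n : exists p : R * E, [/\ S p.2 (p.1 *: p.2), `[p.2] = 1 &
    0 < `|p.1 - w| < n.+1%:R^-1].
  have [|] := nb n.+1%:R^-1; first by rewrite invr_gt0.
  move=> /existsNP[w' /not_implyP[ww' /existsNP[f /not_implyP[Sf /eqP f0]]]].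
  exists (w', `[f]^-1 *: f); split => //=.
    by rewrite scalerA mulrC -scalerA; exact: SZ.
  have f0' : 0 < `[f] by rewrite lt_neqAle eq_sym f0 nn.
  by rewrite inormZ // gtr0_norm ?invr_gt0 // mulVf.
pose f n := (p n).2; pose v n := (p n).1.
have Sf n : S (f n) (v n *: f n) by have [] := hp n.
have f1 n : `[f n] = 1 by have [] := hp n.
have v0 n : 0 < `|v n - w| by have [_ _ /andP[]] := hp n.
have v1 n : `|v n - w| < n.+1%:R^-1 by have [_ _ /andP[]] := hp n.
have [||k hk Ck] := cptS (B := `|w| + 1) Sf.
- by move=> n; rewrite f1 lerDr.
- move=> n; rewrite inormZ // f1 mulr1.
  have := ler_normD (v n - w) w; rewrite subrK => h.
  have h1 : (n.+1%:R^-1 : R) <= 1 by rewrite invf_le1 ?ler1n ?ltr0n.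
  by have := lt_le_trans (v1 n) h1; clear h1; lra.
- have [N hN] := Ck _ ltr01.
(* Beyond [N2] the eigenvalues are strictly nearer to [w] than [v (k N)], hence different from
   it. *)
have [N2 hN2] := harmonic_lt (v0 (k N)).
pose n := maxn N N2.
have := hN N n (leqnn _) (leq_maxl _ _); rewrite /=.
have vn : v (k n) != v (k N).
  apply/eqP => h; have := hN2 (k n) (leq_trans (leq_maxr _ _) (hk n)).
  by rewrite -h ltNge ltW.
have orth : ip (f (k N)) (f (k n)) = 0.
  have := Ssym (Sf (k N)) (Sf (k n)); rewrite !ipE => /eqP.
  by rewrite -subr_eq0 -mulrBl mulf_eq0 subr_eq0 (negbTE vn) => /eqP.
rewrite -(ltr_pXn2r (n := 2)) ?nnegrE ?nn ?ler01 //.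
rewrite nsq !ipE (ipC (f (k n)) (f (k N))) orth -!nsq !f1; lra.
Qed.

End SymmetricRelation.

(** * Absolutely continuous functions and primitives *)

Section AbsolutelyContinuous.
Variable R : realType.
Local Notation mu := (@lebesgue_measure R).
Implicit Types (f g h : R -> R) (a b x y z : R).

Lemma ae_imp (P Q : R -> Prop) :
  (forall x, P x -> Q x) -> {ae mu, forall x, P x} -> {ae mu, forall x, Q x}.
Proof. by move=> PQ; have ? := ae_filter_ringOfSetsType mu; apply: filterS. Qed.

Lemma ae_imp2 (P Q T : R -> Prop) : (forall x, P x -> Q x -> T x) ->
  {ae mu, forall x, P x} -> {ae mu, forall x, Q x} -> {ae mu, forall x, T x}.
Proof. by move=> PQ; have ? := ae_filter_ringOfSetsType mu; apply: filterS2. Qed.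

(** Continuous induction along the supremum of the points where [Q] holds. The step jumps across
    [z], from a point on its left to one on its right. *)
Lemma interval_induction a b (Q : R -> Prop) : a <= b -> Q a ->
  (forall z, a <= z <= b -> exists2 d, 0 < d & forall x y,
     a <= x <= z -> z <= y <= b -> z - d < x -> y < z + d -> Q x -> Q y) -> Q b.
Proof.
move=> ab Qa step; pose A := [set x | a <= x <= b /\ Q x].
have Aa : A a by rewrite /A /= lexx ab.
have ubA : ubound A b by move=> x [/andP[]].
have supA : has_sup A by split; [exists a | exists b].
pose z := sup A.
have az : a <= z by apply: ub_le_sup => //; exists b.
have zb : z <= b by apply: ge_sup => //; exists a.
have [d d0 hd] : exists2 d, 0 < d & forall x y,
     a <= x <= z -> z <= y <= b -> z - d < x -> y < z + d -> Q x -> Q y.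
  by apply: step; rewrite az.
have [x [/andP[ax xb] Qx] zdx] := sup_adherent d0 supA; rewrite -/z in zdx.
have xz : x <= z by apply: ub_le_sup; [exists b | rewrite /A /= ax xb].
pose y := Num.min b (z + d / 2).
have Qy : Q y.
  apply: (hd x y) => //; first by rewrite ax.
    by rewrite le_min zb lerDl divr_ge0 ?(ltW d0) //= ge_min lexx.
  by rewrite /y gt_min ltrD2l; apply/orP; right; lra.
have [yb|yb] := eqVneq y b; first by rewrite -yb.
have yz : y = z + d / 2.
  by apply/eqP; move: yb; rewrite /y /Num.min; case: ifPn; rewrite ?eqxx.
have : y <= z.
  apply: ub_le_sup; first by exists b.
  split=> //; apply/andP; split; last by rewrite /y ge_min lexx.
  by rewrite yz; lra.
by rewrite yz; lra.
Qed.

Lemma ac_sub a b a' b' f : a <= a' -> b' <= b ->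
  abs_continuous a b f -> abs_continuous a' b' f.
Proof.
move=> aa bb acf e e0; have [d d0 hd] := acf e e0; exists d => // n s t hst.
apply: hd => i; have [h1 [h2 h3]] := hst i; split; first exact: le_trans h1.
by split => //; exact: le_trans bb.
Qed.

Lemma ac_modulus a b f e : abs_continuous a b f -> 0 < e ->
  exists2 d, 0 < d & forall x y, a <= x -> x <= y -> y <= b -> y - x < d ->
    `|f y - f x| < e.
Proof.
move=> acf e0; have [d d0 hd] := acf e e0; exists d => // x y ax xy yb yxd.
have := hd 1%N (fun=> x) (fun=> y); rewrite !big_ord1; apply => //.
by move=> i j _ _ _; rewrite (ord1 i) (ord1 j).
Qed.

Lemma ac_bounded a b f : a <= b -> abs_continuous a b f ->
  exists2 M, 0 < M & forall x, a <= x <= b -> `|f x| <= M.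
Proof.
move=> ab acf; have [d d0 hd] := ac_modulus acf ltr01.
apply: (interval_induction (a := a) (b := b)
  (Q := fun y => exists2 M, 0 < M & forall x, a <= x <= y -> `|f x| <= M)) => //.
  exists (`|f a| + 1); first by rewrite ltr_wpDl.
  by move=> x /le_anti <-; rewrite lerDl.
move=> z _; exists (d / 2); first by rewrite divr_gt0.
move=> x y /andP[ax xz] /andP[zy yb] zx yz [M M0 hM]; exists (M + 1).
  by rewrite addr_gt0.
move=> t /andP[at_ ty]; have [tx|xt] := leP t x.
  by rewrite (le_trans (hM t _)) ?at_ // lerDl.
have h1 : `|f t - f x| < 1 by apply: hd => //; [exact: ltW | lra | lra].
have h2 : `|f x| <= M by apply: hM; rewrite ax lexx.
have := ler_normD (f t - f x) (f x); rewrite subrK; lra.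
Qed.

Lemma ac_lipschitz a b f K :
  (forall x y, a <= x -> x <= y -> y <= b -> `|f y - f x| <= K * (y - x)) ->
  abs_continuous a b f.
Proof.
move=> lip e e0.
have K1 : 0 < `|K| + 1 by rewrite ltr_wpDl.
exists (e / (`|K| + 1)); first by rewrite divr_gt0.
move=> n s t hst _; rewrite ltr_pdivlMr // => hd.
apply: le_lt_trans hd; rewrite mulr_suml; apply: ler_sum => i _.
have [h1 [h2 h3]] := hst i; apply: le_trans (lip _ _ h1 h2 h3) _.
rewrite mulrC ler_wpM2l ?subr_ge0 // (le_trans (ler_norm _)) // lerDl //.
Qed.

(** Sums, multiples and products all come down to this domination of increments. *)
Lemma ac_comb a b f g h K L :
  abs_continuous a b f -> abs_continuous a b g -> 0 < K -> 0 < L ->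
  (forall x y, a <= x -> x <= y -> y <= b ->
    `|h y - h x| <= K * `|f y - f x| + L * `|g y - g x|) ->
  abs_continuous a b h.
Proof.
move=> acf acg K0 L0 hfg e e0.
have [d1 d10 h1] := acf (e / 2 / K) ltac:(by rewrite !divr_gt0).
have [d2 d20 h2] := acg (e / 2 / L) ltac:(by rewrite !divr_gt0).
exists (Num.min d1 d2); first by rewrite lt_min d10.
move=> n s t hst tI; rewrite lt_min => /andP[/(h1 _ _ _ hst tI) + /(h2 _ _ _ hst tI)].
rewrite !ltr_pdivlMr // => h3 h4.
apply: le_lt_trans (_ : \sum_(i < n) (K * `|f (t i) - f (s i)| + L * `|g (t i) - g (s i)|) < e).
  by apply: ler_sum => i _; have [? [? ?]] := hst i; exact: hfg.
rewrite big_split /= -!mulr_sumr; lra.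
Qed.

Lemma acD a b f g : abs_continuous a b f -> abs_continuous a b g ->
  abs_continuous a b (fun x => f x + g x).
Proof.
move=> acf acg; apply: (ac_comb acf acg ltr01 ltr01) => x y _ _ _.
by rewrite !mul1r opprD addrACA ler_normD.
Qed.

Lemma acZ a b f c : abs_continuous a b f -> abs_continuous a b (fun x => c * f x).
Proof.
move=> acf.
have c1 : 0 < `|c| + 1 by rewrite ltr_wpDl.
apply: (ac_comb acf acf c1 c1) => x y _ _ _.
rewrite -mulrBr normrM -mulrDl ler_wpM2r //; have := normr_ge0 c; lra.
Qed.

Lemma acB a b f g : abs_continuous a b f -> abs_continuous a b g ->
  abs_continuous a b (fun x => f x - g x).
Proof.
move=> acf acg; apply: (ac_comb acf acg ltr01 ltr01) => x y _ _ _.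
rewrite !mul1r; have -> : f y - g y - (f x - g x) = (f y - f x) - (g y - g x) by ring.
exact: ler_normB.
Qed.

Lemma acM a b f g : a <= b -> abs_continuous a b f -> abs_continuous a b g ->
  abs_continuous a b (fun x => f x * g x).
Proof.
move=> ab acf acg.
have [M M0 hM] := ac_bounded ab acf; have [N N0 hN] := ac_bounded ab acg.
apply: (ac_comb acf acg N0 M0) => x y ax xy yb.
have -> : f y * g y - f x * g x = (f y - f x) * g y + f x * (g y - g x) by ring.
apply: le_trans (ler_normD _ _) _; rewrite !normrM [N * _]mulrC.
apply: lerD; first by rewrite ler_wpM2l // hN // yb (le_trans ax).
by rewrite ler_wpM2r // hM // ax (le_trans xy).
Qed.

Lemma ac_cst a b c : abs_continuous a b (fun=> c).
Proof. by apply: (@ac_lipschitz _ _ _ 0) => x y _ _ _; rewrite subrr normr0 mul0r. Qed.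

Lemma ac_id a b : abs_continuous a b id.
Proof.
apply: (@ac_lipschitz _ _ _ 1) => x y _ xy _.
by rewrite mul1r ger0_norm // subr_ge0.
Qed.

(* Pieces of an interval chain lying in a small open neighbourhood of the
   exceptional null set are controlled by absolute continuity, the others by
   the sign of the derivative. *)
Lemma ac_nonincreasing a b f : a <= b -> abs_continuous a b f ->
  {ae mu, forall x, a < x < b -> exists2 v, is_derive x 1 f v & v <= 0} ->
  f b <= f a.
Proof.
move=> ab acf [A [mA A0 hA]].
suff main e : 0 < e -> f b - f a <= e * (b - a) + e.
  rewrite -subr_le0; apply/ler_addgt0Pl => e e0; rewrite addr0.
  have D0 : 0 < b - a + 1 by rewrite ltr_wpDl // subr_ge0.
  have := main _ (divr_gt0 e0 D0).
  by rewrite -[X in _ * _ + X]mulr1 -mulrDr divfK // gt_eqF.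
move=> e0; have [d d0 hd] := acf e e0.
(* The endpoints join the null set because the derivative is only known strictly inside. *)
pose N := A `|` [set a; b].
have mN : measurable N by do 2?[apply: measurableU => //]; exact: measurable_set1.
have m1 c : mu [set c] = 0%E by exact: lebesgue_measure_set1.
have N0 : mu N = 0%E.
  apply/eqP; rewrite -measure_le0; apply: le_trans (measureU2 mu mA _) _.
    by apply: measurableU; exact: measurable_set1.
  rewrite [X in (X + _)%E](_ : _ = 0%E) // add0e.
  apply: le_trans (measureU2 mu _ _) _; try exact: measurable_set1.
  by rewrite -[leRHS]adde0; apply: leeD; rewrite le_eqVlt; apply/orP; left; apply/eqP; exact: m1.
have [U [oU NU Ud]] : exists U, [/\ open U, N `<=` U & (mu (U `\` N) < d%:E)%E].
  apply: lebesgue_regularity_outer => //.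
  by apply: le_lt_trans (ltry 0); rewrite le_eqVlt; apply/orP; left; apply/eqP; exact: N0.
have mU : measurable U by exact: open_measurable.
have {}Ud : (mu U < d%:E)%E.
  apply: le_lt_trans Ud; rewrite -[in leLHS](setDUK NU) setUC.
  apply: le_trans (measureU2 mu _ _) _ => //; first exact: measurableD.
  rewrite -[leRHS]adde0; apply: leeD => //.
  by rewrite le_eqVlt; apply/orP; left; apply/eqP; exact: N0.
pose Q x := exists s : seq (R * R),
  [/\ all (fun p => (a <= p.1) && (p.1 <= p.2) && (p.2 <= x)) s,
      pairwise (fun p q => q.2 <= p.1) s,
      ((\sum_(p <- s) (p.2 - p.1))%:E <= mu (U `&` `]-oo, x]))%E &
      f x - f a <= e * (x - a) + \sum_(p <- s) `|f p.2 - f p.1|].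
have Qb : Q b.
  apply: (interval_induction ab).
    by exists [::]; split => //; rewrite !big_nil // !subrr mulr0 addr0.
  (* Near an exceptional point all of []x, y]] lies in [U] and becomes a new piece. *)
  move=> z /andP[az zb]; have [zN|zN] := pselect (N z).
    have [r r0 hr] : exists2 r, 0 < r & ball z r `<=` U.
      have : nbhs z U by apply: open_nbhs_nbhs; split => //; exact: NU.
      by move=> /nbhs_ballP[r r0 hr]; exists r.
    exists r => // x y /andP[ax xz] /andP[zy yb] zx yz [s [s1 s2 s3 s4]].
    exists ((x, y) :: s); split.
    - rewrite /= ax lexx (le_trans xz zy) /=; apply: sub_all s1 => p /andP[-> h] /=.
      by rewrite (le_trans h) // (le_trans xz).
    - rewrite /= s2 andbT; apply: sub_all s1 => p /andP[_ h] //.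
    - rewrite big_cons EFinD.
      have xyU : `]x, y] `<=` U.
        move=> t; rewrite /= in_itv /= => /andP[xt ty]; apply: hr.
        by rewrite /ball /= ltr_norml; apply/andP; split; lra.
      apply: (@le_trans _ _ (mu `]x, y] + mu (U `&` `]-oo, x]))%E).
        apply: leeD s3; rewrite lebesgue_measure_itv /= lte_fin.
        case: ltP => // yx; rewrite /= lee_fin; lra.
      rewrite -measureU //; last 2 first.
      + by apply: measurableI => //.
      + rewrite -subset0 => t [/= + [_ +]]; rewrite !in_itv /= => /andP[h1 _] h2.
        by move: h1; rewrite ltNge h2.
      apply: le_measure; rewrite ?inE.
      + by apply: measurableU => //; apply: measurableI.
      + by apply: measurableI.
      + move=> t /= [|[Ut]].
          by move=> h; split; [exact: xyU | move: h; rewrite /= !in_itv /= => /andP[]].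
        rewrite !in_itv /= => h; split => //; exact: le_trans (le_trans xz zy).
    - rewrite big_cons /=.
      have := ler_norm (f y - f x).
      have : e * (x - a) <= e * (y - a) by rewrite ler_pM2l // lerD2r (le_trans xz).
      lra.
  have zab : a < z < b.
    rewrite !lt_neqAle az zb !andbT; apply/andP; split; apply/eqP => h.
      by apply: zN; right; left.
    by apply: zN; right; right.
  have [v dv v0] : exists2 v, is_derive z 1 f v & v <= 0.
    apply: contrapT => h; apply: zN; left; apply: hA => /= h'; exact/h/h'.
  (* Near any other point no piece is added: [z] lies between [x] and [y], so differentiability at
     [z] bounds the increment over [[x, y]] by [e (y - x)]. *)
  have [r r0 hr] : exists2 r, 0 < r & forall y, `|y - z| < r ->
      `|f y - f z - v * (y - z)| <= e * `|y - z|.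
    have [/derivable1_diffP/diff_locally dz hv] := dv.
    have := (@ex_derive _ _ _ _ _ _ _ dv).
    rewrite /derivable => /cvg_ex[l hl].
    have lv : l = v.
      by rewrite -hv; apply/esym/cvg_lim.
    rewrite lv in hl.
    move/cvgrPdist_le : hl => /(_ _ e0); rewrite near_withinE => /nbhs_ballP[r r0 hr].
    exists r => // y yz; have [->|yz0] := eqVneq y z.
      by rewrite !subrr mulr0 subr0 normr0 mulr0.
    have := hr (y - z); rewrite /ball /= sub0r normrN => /(_ yz).
    rewrite subr_eq0 => /(_ yz0); rewrite /GRing.scale /= mulr1 subrK => h.
    have yz1 : 0 < `|y - z| by rewrite normr_gt0 subr_eq0.
    rewrite -ler_pdivrMr // -normfV -normrM -normrN (le_trans _ h) //.
    rewrite le_eqVlt; apply/orP; left; apply/eqP; congr `|_|; field.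
    by rewrite subr_eq0.
  exists r => // x y /andP[ax xz] /andP[zy yb] zx yz [s [s1 s2 s3 s4]].
  have xy : x <= y by exact: le_trans zy.
  exists s; split => //.
  - by apply: sub_all s1 => p /andP[-> h] /=; rewrite (le_trans h).
  - apply: le_trans s3 _; apply: le_measure; rewrite ?inE; try exact: measurableI.
    by apply: setIS => t /=; rewrite !in_itv /= => /le_trans; apply.
  - have h1 := hr x; rewrite ler0_norm ?subr_le0 // in h1.
    have {}h1 := h1 ltac:(lra).
    have h2 := hr y; rewrite ger0_norm ?subr_ge0 // in h2.
    have {}h2 := h2 ltac:(lra).
    move: h1 h2; rewrite !ler_norml => /andP[h1 _] /andP[_ h2].
    have : v * (y - x) <= 0 by rewrite mulr_le0_ge0 // subr_ge0.
    lra.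
have [s [s1 s2 s3 s4]] := Qb.
apply: le_trans s4 _; rewrite lerD2l ltW //.
rewrite (big_nth (0, 0)) big_mkord.
apply: (hd _ (fun i => (nth (0, 0) s i).1) (fun i => (nth (0, 0) s i).2)).
- by move=> i; have /allP/(_ _ (mem_nth (0,0) (ltn_ord i)))/andP[/andP[]] := s1.
- have tr (i j : 'I_(size s)) : (i < j)%N ->
    `](nth (0, 0) s i).1, (nth (0, 0) s i).2[ `&`
    `](nth (0, 0) s j).1, (nth (0, 0) s j).2[%classic = set0.
    move=> ij; rewrite -subset0 => t [/=]; rewrite !in_itv /= => /andP[h1 _] /andP[_ h2].
    have /(pairwiseP (0,0))/(_ i j (ltn_ord i) (ltn_ord j) ij) h3 := s2.
    by have := lt_trans h1 h2; rewrite ltNge h3.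
  apply/trivIsetP => i j _ _; rewrite neq_ltn => /orP[/tr//|/tr].
  by rewrite setIC.
- rewrite -lte_fin; apply: le_lt_trans Ud.
  rewrite -(big_mkord xpredT (fun i => (nth (0,0) s i).2 - (nth (0,0) s i).1)).
  rewrite -(big_nth (0,0) xpredT (fun p => p.2 - p.1)).
  by apply: le_trans s3 _; apply: le_measure; rewrite ?inE //; exact: measurableI.
Qed.

Definition locint f : Prop :=
  measurable_fun setT f /\ forall b, mu.-integrable `[- b, b] (EFin \o f).

Definition prim f x : R := \int[mu]_(t in `[0, x]) f t.

Lemma locint_itv f a b : locint f -> mu.-integrable `[a, b] (EFin \o f).
Proof.
move=> [_ hf]; apply: integrableS (hf (Num.max `|a| `|b|)) => //.
move=> x /=; rewrite !in_itv /= => /andP[ax xb]; apply/andP; split.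
  by apply: le_trans ax; rewrite lerNl le_max -normrN ler_norm.
by rewrite (le_trans xb) // le_max orbC ler_norm.
Qed.

Lemma locint_itvoc f a b : locint f -> mu.-integrable `]a, b] (EFin \o f).
Proof. by move=> lf; apply: integrableS (locint_itv a b lf) => //; exact: subset_itv_oc_cc. Qed.

Lemma locint_itvoo f a b : locint f -> mu.-integrable `]a, b[ (EFin \o f).
Proof. by move=> lf; apply: integrableS (locint_itv a b lf) => //; exact: subset_itv_oo_cc. Qed.

Lemma locint_locally f : locint f -> locally_integrable setT f.
Proof.
move=> [mf hf]; split => //; first exact: openT.
move=> K _ cK; have [M [_ hM]] := compact_bounded cK.
have /integrableP[_] := hf (`|M| + 1); apply: le_lt_trans.
apply: ge0_subset_integral => //=.
- exact: compact_measurable.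
- by do 2![apply: measurableT_comp => //]; exact: measurable_funTS.
- move=> x Kx; rewrite /= in_itv /= -ler_norml; apply: hM => //.
  by rewrite (le_lt_trans (ler_norm M)) // ltrDl.
Qed.

Lemma prim_derive f : locint f ->
  {ae mu, forall x, 0 < x -> is_derive x 1 (prim f) (f x)}.
Proof.
move=> lf; have := FTC1 (a := BLeft 0) (fun y => locint_itv 0 y lf) (locint_locally lf).
apply: ae_imp => x hx x0; have [|d1 d2] := hx; first by rewrite /= lte_fin.
split; first exact: d1.
by rewrite -derive1E; exact: d2.
Qed.

Lemma primB f x y : locint f -> 0 <= x -> x <= y ->
  prim f y - prim f x = \int[mu]_(t in `]x, y]) f t.
Proof. by move=> lf x0 xy; apply: Rintegral_itvB => //; exact: locint_itv. Qed.

Lemma prim0 f : prim f 0 = 0.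
Proof. by rewrite /prim set_itv1 Rintegral_set1. Qed.

(** Applied to the union of the intervals, absolute continuity of the integral of [|f|] over
    [[0, b]] bounds all increments at once. *)
Lemma prim_ac f b : locint f -> abs_continuous 0 b (prim f).
Proof.
move=> lf e e0; pose g := f \_ `[0, b].
have ig : mu.-integrable setT (EFin \o g).
  by rewrite -restrict_EFin; apply/(integrable_restrict _ _) => //; rewrite setTI; exact: locint_itv.
have [d [d0 hd]] := integral_normr_continuous ig e0.
exists d => // n s t hst tI hsum.
pose F (i : 'I_n) := `]s i, t i[%classic.
have mF i : measurable (F i) by exact: measurable_itv.
have muF i : mu (F i) = (t i - s i)%:E.
  rewrite /F lebesgue_measure_itv /= lte_fin.
  by have [_ [h _]] := hst i; case: ltgtP h => // -> _; rewrite subrr.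
pose D := \big[setU/set0]_(i < n) F i.
have mD : measurable D by exact: bigsetU_measurable.
have muD : (mu D < d%:E)%E.
  rewrite /D measure_bigsetU_ord // -lte_fin in hsum *.
  apply: le_lt_trans hsum; rewrite -sumEFin le_eqVlt; apply/orP; left; apply/eqP.
  by apply: eq_bigr => i _; exact: muF.
apply: le_lt_trans (hd D mD muD).
rewrite -lee_fin -sumEFin.
have intg A : measurable A -> mu.-integrable A (EFin \o (fun x => `|g x|)).
  by move=> mA; apply: integrableS (integrable_norm ig).
have RE A : measurable A -> ((\int[mu]_(x in A) `|g x|)%R)%:E = (\int[mu]_(x in A) `|g x|%:E)%E.
  by move=> mA; rewrite /Rintegral fineK //; apply: integrable_fin_num => //; exact: intg.
rewrite RE // /D ge0_integral_bigsetU //; last 3 first.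
- exact: index_enum_uniq.
- by move=> i j _ _; exact: tI.
- by apply: measurable_funTS; have /integrableP[] := integrable_norm ig.
apply: lee_sum => i _; rewrite -(RE _ (mF i)) lee_fin.
have [h1 [h2 h3]] := hst i.
rewrite primB //; apply: le_trans (le_normr_Rintegral _ (locint_itvoc _ _ lf)) _ => //.
rewrite -Rintegral_itv_bndo_bndc; last first.
  by have := integrable_norm (locint_itvoo (s i) (t i) lf).
rewrite le_eqVlt; apply/orP; left; apply/eqP; apply: eq_Rintegral => x.
rewrite inE /= in_itv /= => /andP[sx xt]; rewrite /g patchE mem_set //=.
by rewrite in_itv /= (le_trans h1 (ltW sx)) (le_trans (ltW xt)).
Qed.

(** [f - prim g] has derivative 0 almost everywhere, so it and its negative are both
    nonincreasing. *)
Lemma ac_ftc a b f g : 0 <= a -> a <= b -> abs_continuous a b f -> locint g ->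
  {ae mu, forall x, a < x < b -> is_derive x 1 f (g x)} ->
  f b - f a = prim g b - prim g a.
Proof.
move=> a0 ab acf lg df.
have acp : abs_continuous a b (prim g) by apply: ac_sub (prim_ac b lg).
have dp := prim_derive lg.
have h1 : f b - prim g b <= f a - prim g a.
  apply: (ac_nonincreasing (f := fun x => f x - prim g x)) => //; first exact: acB.
  apply: ae_imp2 df dp => x dx px xab; exists 0 => //.
  have d1 := dx xab; have d2 := px (le_lt_trans a0 (andP xab).1).
  by rewrite -(subrr (g x)); exact: is_deriveB.
have h2 : prim g b - f b <= prim g a - f a.
  apply: (ac_nonincreasing (f := fun x => prim g x - f x)) => //; first exact: acB.
  apply: ae_imp2 df dp => x dx px xab; exists 0 => //.
  have d1 := dx xab; have d2 := px (le_lt_trans a0 (andP xab).1).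
  by rewrite -(subrr (g x)); exact: is_deriveB.
lra.
Qed.

End AbsolutelyContinuous.

(** * Linear subsets as modules in their own right *)

Section SubLmod.
Variables (R : nzRingType) (V : lmodType R).

Definition linear_subset (P : set V) :=
  P 0 /\ forall c x y, P x -> P y -> P (c *: x + y).

Variables (P : set V) (linP : linear_subset P).

(** The closure proof is made an argument so that the module structure can be attached to the
    predicate itself. *)
Definition in_subset of linear_subset P : {pred V} := fun x => `[< P x >].

Lemma in_subset_submod : submod_closed (in_subset linP).
Proof.
case: (linP) => P0 Pl; split; first exact/asboolP.
by move=> c x y /asboolP Px /asboolP Py; apply/asboolP; exact: Pl.
Qed.

HB.instance Definition _ := GRing.isSubmodClosed.Build R V (in_subset linP) in_subset_submod.

Definition subset_lmod := {x | x \in in_subset linP}.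
HB.instance Definition _ := [isSub of subset_lmod for sval].
HB.instance Definition _ := [Choice of subset_lmod by <:].
HB.instance Definition _ := [SubChoice_isSubLmodule of subset_lmod by <:].

Lemma subset_lmodP (x : subset_lmod) : P (val x).
Proof. by case: x => x /= /asboolP. Qed.

Lemma subset_valD (x y : subset_lmod) : val (x + y) = val x + val y. Proof. by []. Qed.
Lemma subset_valZ c (x : subset_lmod) : val (c *: x) = c *: val x. Proof. by []. Qed.
Lemma subset_valB (x y : subset_lmod) : val (x - y) = val x - val y. Proof. by []. Qed.

Definition Subset_lmod x (Px : P x) : subset_lmod := exist _ x (asboolT Px).

End SubLmod.

Section SubInnerProduct.
Variables (R : realType) (V : lmodType R) (ip : V -> V -> R).
Variables (P : set V) (linP : linear_subset P).

Definition sub_ip (x y : subset_lmod linP) := ip (val x) (val y).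

Lemma sub_semi_inner : semi_inner ip -> semi_inner sub_ip.
Proof.
move=> sip; split=> [x y|x y z|c x z|x].
- exact: (ipC sip).
- exact: (ipDl sip).
- exact: (ipZl sip).
- exact: (ip_ge0 sip).
Qed.

Lemma sub_icomplete : icomplete ip ->
  (forall u l, (forall n, P (u n)) -> icvg ip u l -> P l) -> icomplete sub_ip.
Proof.
move=> comp clo u Cu; have [l hl] := comp (fun n => val (u n)) Cu.
have Pl : P l by apply: clo hl => n; exact: subset_lmodP.
by exists (Subset_lmod linP Pl).
Qed.

End SubInnerProduct.

(** * Integrals of functions equal almost everywhere to Borel ones *)

Section IntegralAe.
Import HBNNSimple.
Variable R : realType.
Local Notation mu := (@lebesgue_measure R).
Local Open Scope ereal_scope.

(** The integral is a supremum over simple functions. Those below [f] lie below [g] almost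
    everywhere; those below [g], once [g] is set to 0 on a measurable null set, lie below [f]
    everywhere. *)
Lemma ge0_integral_ae (f g : R -> \bar R) : (forall x, 0 <= f x) -> (forall x, 0 <= g x) ->
  measurable_fun setT g -> {ae mu, forall x, f x = g x} ->
  \int[mu]_x f x = \int[mu]_x g x.
Proof.
move=> f0 g0 mg fg; apply/eqP; rewrite eq_le; apply/andP; split.
  rewrite [leLHS]ge0_integralE // patch_setT.
  apply: ge_ereal_sup => _ [h /= hf <-]; rewrite -integralT_nnsfun.
  apply: ae_ge0_le_integral => //.
  - by move=> x _; rewrite lee_fin; exact: fun_ge0.
  - by apply/measurable_EFinP; exact: measurable_funTS.
  - by apply: ae_imp fg => x <- _; exact: hf.
have [N [mN N0 hN]] := fg.
pose g' := g \_ (~` N).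
have g'0 x : 0 <= g' x by rewrite /g' patchE; case: ifP.
have -> : \int[mu]_x g x = \int[mu]_x g' x.
  apply: ge0_ae_eq_integral => //.
  - by apply/(measurable_restrictT _ (measurableC mN)); exact: measurable_funTS.
  - exists N; split => // x; apply: contra_notP => Nx _.
    by rewrite /g' patchE mem_set.
rewrite !ge0_integralE // !patch_setT; apply: le_ereal_sup => _ [h /= hg' <-].
exists h => // x; apply: le_trans (hg' x) _; rewrite /g' patchE.
case: ifPn => [/set_mem Nx|_]; last exact: f0.
by rewrite le_eqVlt; apply/orP; left; apply/eqP/esym; apply: contrapT => h'; exact/Nx/hN.
Qed.

Lemma ge0_integral_ae_on (D : set R) (f g : R -> \bar R) : measurable D ->
  (forall x, D x -> 0 <= f x) -> (forall x, D x -> 0 <= g x) ->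
  measurable_fun D g -> {ae mu, forall x, D x -> f x = g x} ->
  \int[mu]_(x in D) f x = \int[mu]_(x in D) g x.
Proof.
move=> mD f0 g0 mg fg; rewrite integral_mkcond [RHS]integral_mkcond.
apply: ge0_integral_ae.
- by move=> x; rewrite patchE; case: ifPn => // /set_mem /f0.
- by move=> x; rewrite patchE; case: ifPn => // /set_mem /g0.
- exact/(measurable_restrictT _ mD).
- apply: ae_imp fg => x fg; rewrite !patchE; case: ifPn => // /set_mem; exact: fg.
Qed.

End IntegralAe.

(** * Square integrable functions on the half line *)

Section SquareIntegrable.
Variable R : realType.
Local Notation mu := (@lebesgue_measure R).
Local Notation D := (`]0, +oo[%classic : set R).
Implicit Types (f g : R -> R).

(** Integrability is asked on the whole line, which makes cut-offs easy to handle. The inner product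
    integrates over the half line only, so values elsewhere count as null. *)
Definition sqint f : Prop :=
  measurable_fun setT f /\ mu.-integrable setT (EFin \o (fun x => f x ^+ 2)).

Lemma sqint_mul f g : sqint f -> sqint g ->
  mu.-integrable setT (EFin \o (fun x => f x * g x)).
Proof.
move=> [mf if2] [mg ig2].
apply: (le_integrable measurableT _ _ (integrableD measurableT if2 ig2)).
  by apply/measurable_EFinP; exact: measurable_funM.
move=> x _; rewrite /= lee_fin [leRHS]ger0_norm ?addr_ge0 ?sqr_ge0 //.
rewrite ler_norml; have h1 := sqr_ge0 (f x - g x); have h2 := sqr_ge0 (f x + g x).
by move: h1 h2; rewrite sqrrB sqrrD; have := sqr_ge0 (f x); have := sqr_ge0 (g x) => *; apply/andP; split; lra.
Qed.

Lemma sqint_le f g : measurable_fun setT f -> sqint g ->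
  (forall x, `|f x| <= `|g x|) -> sqint f.
Proof.
move=> mf [mg ig2] fg; split => //.
apply: (le_integrable measurableT _ _ ig2).
  by apply/measurable_EFinP; exact: measurable_funX.
move=> x _; rewrite /= lee_fin !ger0_norm ?sqr_ge0 //.
rewrite -(real_normK (num_real (f x))) -(real_normK (num_real (g x))).
by rewrite ler_pXn2r ?nnegrE.
Qed.

Lemma sqint_linear : linear_subset (sqint : set (R -> R^o)).
Proof.
split.
  split; first exact: measurable_cst.
  rewrite (_ : _ \o _ = cst 0%E); first exact: integrable0.
  by apply/funext => x /=; rewrite expr0n.
move=> c f g [mf if2] [mg ig2]; split.
  by apply: measurable_funD => //; exact: measurable_funM.
have h1 := integrableZl measurableT (2 * c ^+ 2) if2.
have h2 := integrableZl measurableT 2 ig2.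
apply: (le_integrable measurableT _ _ (integrableD measurableT h1 h2)).
  apply/measurable_EFinP; apply: measurable_funX; apply: measurable_funD => //.
  exact: measurable_funM.
move=> x _; rewrite /= lee_fin.
have h0 : 0 <= 2 * c ^+ 2 * f x ^+ 2 + 2 * g x ^+ 2.
  by have := sqr_ge0 (c * f x); have := sqr_ge0 (g x); rewrite exprMn; lra.
rewrite [leRHS]ger0_norm // [leLHS]ger0_norm ?sqr_ge0 //.
rewrite -[(c *: f + g) x]/(c * f x + g x).
by have := sqr_ge0 (c * f x - g x); nra.
Qed.

Definition l2fun := subset_lmod sqint_linear.

Lemma l2valD (f g : l2fun) x : val (f + g) x = val f x + val g x.
Proof. by rewrite (subset_valD f g). Qed.
Lemma l2valZ c (f : l2fun) x : val (c *: f) x = c * val f x.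
Proof. by rewrite (subset_valZ c f). Qed.
Lemma l2valB (f g : l2fun) x : val (f - g) x = val f x - val g x.
Proof. by rewrite (subset_valB f g). Qed.

Lemma sqint_l2 (f : l2fun) : sqint (val f).
Proof. exact: (subset_lmodP f). Qed.

Lemma l2fun_integrable (f g : l2fun) (A : set R) : measurable A ->
  mu.-integrable A (EFin \o (fun x => val f x * val g x)).
Proof.
by move=> mA; apply: integrableS (sqint_mul (sqint_l2 f) (sqint_l2 g)).
Qed.

Lemma measurable_l2 (f : l2fun) (A : set R) : measurable_fun A (val f).
Proof. by apply: measurable_funTS; case: (sqint_l2 f). Qed.

End SquareIntegrable.

HB.lock Definition l2ip (R : realType) (f g : l2fun R) : R :=
  \int[@lebesgue_measure R]_(x in `]0, +oo[) (val f x * val g x).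
Canonical l2ip_unlockable := Unlockable l2ip.unlock.

Section L2InnerProduct.
Variable R : realType.
Local Notation mu := (@lebesgue_measure R).
Local Notation D := (`]0, +oo[%classic : set R).
Implicit Types f g : l2fun R.

Lemma l2ipE f g : l2ip f g = \int[mu]_(x in D) (val f x * val g x).
Proof. by rewrite unlock. Qed.

Lemma l2_semi_inner : semi_inner (@l2ip R).
Proof.
split=> [f g|f g h|c f h|f]; rewrite !l2ipE.
- by apply: eq_Rintegral => x _; rewrite mulrC.
- rewrite -RintegralD; try exact: l2fun_integrable; last exact: measurable_itv.
  by apply: eq_Rintegral => x _; rewrite l2valD mulrDl.
- rewrite -RintegralZl; try exact: l2fun_integrable; last exact: measurable_itv.
  by apply: eq_Rintegral => x _; rewrite l2valZ mulrA.
- by apply: Rintegral_ge0 => x _; rewrite -expr2 sqr_ge0.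
Qed.

Lemma l2ip_EFin f :
  (l2ip f f)%:E = (\int[mu]_(x in D) ((val f x) ^+ 2)%:E)%E.
Proof.
rewrite l2ipE /Rintegral fineK; first by apply: eq_integral => x _; rewrite expr2.
by apply: integrable_fin_num; [exact: measurable_itv | exact: l2fun_integrable].
Qed.

End L2InnerProduct.

(** * Completeness of the space of square integrable functions *)

Section RieszFischer.
Variable R : realType.
Local Notation mu := (@lebesgue_measure R).
Local Notation D := (`]0, +oo[%classic : set R).
Local Notation ip := (@l2ip R).
Let sip := @l2_semi_inner R.

(** Weighting the squared increments by [4 ^ j] gives increments of order [2 ^- j], hence an
    absolutely convergent telescoping series. *)
Let fast_cvg (y : nat -> R) (C : R) :
  (forall j, 4 ^+ j * (y j.+1 - y j) ^+ 2 <= C) -> cvgn y.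
Proof.
move=> hC.
have C0 : 0 <= C by apply: le_trans (hC 0%N); rewrite mul1r sqr_ge0.
have hd j : `|y j.+1 - y j| <= Num.sqrt C * (2^-1) ^+ j.
  rewrite -(ler_pXn2r (n := 2)) ?nnegrE ?mulr_ge0 ?sqrtr_ge0 ?exprn_ge0 ?invr_ge0 //.
  rewrite real_normK ?num_real // exprMn sqr_sqrtr //.
  have -> : ((2^-1 : R) ^+ j) ^+ 2 = (4 ^+ j)^-1.
    by rewrite -exprM mulnC exprM -exprVn; congr (_ ^+ _); field.
  by rewrite ler_pdivlMr ?exprn_gt0 // mulrC.
have -> : y = fun n => y 0%N + series (telescope y) n.
  by apply/funext => n; exact: eq_sum_telescope.
apply: is_cvgD; first exact: is_cvg_cst.
apply: normed_cvg; apply: (@series_le_cvg _ _ (geometric (Num.sqrt C) 2^-1)).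
- by move=> n; exact: normr_ge0.
- by move=> n; apply: mulr_ge0; rewrite ?sqrtr_ge0 ?exprn_ge0 ?invr_ge0 ?ler0n.
- by move=> n; exact: hd.
- apply: is_cvg_geometric_series; rewrite ger0_norm ?invr_ge0 //.
  by rewrite invf_lt1 ?ltr1n ?ltr0n.
Qed.

Lemma l2_complete : icomplete ip.
Proof.
move=> u Cu.
pose r j : R := (4 ^+ j)^-1.
have r0 j : 0 < r j by rewrite invr_gt0 exprn_gt0.
have /choice[N hN] j := Cu (r j) (r0 j).
(* A sum in place of a maximum: [k j] dominates every [N i] with [i <= j]. *)
pose k j := (\sum_(i < j.+1) N i)%N.
have kN i j : (i <= j)%N -> (N i <= k j)%N.
  move=> ij; rewrite /k (bigD1 (Ordinal (ij : (i < j.+1)%N))) //=; exact: leq_addr.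
pose v j := u (k j).
have hv i j : (i <= j)%N -> inorm ip (v j - v i) <= r i.
  by move=> ij; apply/ltW/hN; exact: kN.
have hv2 i j : (i <= j)%N -> (\int[mu]_(x in D) ((val (v j) x - val (v i) x) ^+ 2)%:E <= (r i ^+ 2)%:E)%E.
  move=> ij; rewrite (_ : (\int[mu]_(x in D) _)%E = (ip (v j - v i) (v j - v i))%:E); last first.
    by rewrite l2ip_EFin; apply: eq_integral => x _; rewrite l2valB.
  rewrite lee_fin -(inorm_sqr sip).
  by rewrite ler_pXn2r ?nnegrE ?inorm_ge0 ?(ltW (r0 i)) // hv.
have mD : measurable (D : set (measurableTypeR R)) by exact: measurable_itv.
have mv j i : measurable_fun setT (fun x => (val (v j) x - val (v i) x) ^+ 2).
  apply: measurable_funX; apply: measurable_funB; exact: measurable_l2.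
(* As consecutive [v j] are at distance at most [4 ^- j], the terms integrate to at most
   [4 ^ j * 16 ^- j]; so [S] is integrable, hence finite almost everywhere. *)
pose S (x : R) := (\sum_(0 <= j <oo) (4 ^+ j * (val (v j.+1) x - val (v j) x) ^+ 2)%:E)%E.
have t0 j x : (0 <= (4 ^+ j * (val (v j.+1) x - val (v j) x) ^+ 2)%:E)%E.
  by rewrite lee_fin mulr_ge0 ?sqr_ge0 ?exprn_ge0 ?ler0n.
have mt j : measurable_fun D (fun x => (4 ^+ j * (val (v j.+1) x - val (v j) x) ^+ 2)%:E).
  by apply/measurable_EFinP; apply: measurable_funM => //; apply: measurable_funTS; exact: mv.
have S2 : (\int[mu]_(x in D) S x <= 2%:E)%E.
  rewrite /S integral_nneseries //.
  apply: lime_le.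
    by apply: is_cvg_nneseries => n _ _; apply: integral_ge0 => x _; exact: t0.
  apply: nearW => n.
  apply: (@le_trans _ _ (\sum_(0 <= i < n) (2^-1 ^+ i)%:E)%E).
    apply: lee_sum => j _.
    under eq_integral => x _ do rewrite EFinM.
    rewrite ge0_integralZl_EFin ?exprn_ge0 //; first last.
    - by apply/measurable_EFinP; apply: measurable_funTS; exact: mv.
    - by move=> x _; rewrite lee_fin sqr_ge0.
    apply: le_trans (lee_wpmul2l _ (hv2 j j.+1 (leqnSn j))) _.
      by rewrite lee_fin exprn_ge0.
    rewrite -EFinM lee_fin /r expr2 mulrA divff ?expf_neq0 // mul1r.
    by rewrite exprVn lef_pV2 ?posrE ?exprn_gt0 // lerXn2r ?nnegrE // ler_nat.
  rewrite sumEFin lee_fin.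
  have -> : \sum_(0 <= i < n) (2^-1 : R) ^+ i = 2 - 2 * 2^-1 ^+ n.
    elim: n => [|n IH]; first by rewrite big_nil expr0 mulr1 subrr.
    rewrite big_nat_recr //= IH exprS; lra.
  by rewrite gerBl mulr_ge0 ?exprn_ge0 ?invr_ge0.
have mS : measurable_fun D S by apply: ge0_emeasurable_sum => [i x _ _|i _]; [exact: t0 | exact: mt].
have S0 x : (0 <= S x)%E by apply: nneseries_ge0 => j _ _; exact: t0.
have iS : mu.-integrable D S.
  apply/integrableP; split => //; under eq_integral => x _ do rewrite gee0_abs //.
  exact: le_lt_trans S2 (ltry _).
have [N0 [mN0 N00 hN0]] := integrable_ae mD iS.
pose G := D `\` N0.
have mG : measurable G by exact: measurableD.
have cvgG x : G x -> cvgn (fun j => val (v j) x).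
  move=> [Dx Nx]; have finS : S x \is a fin_num by apply: contrapT => h; apply/Nx/hN0 => /(_ Dx).
  apply: (@fast_cvg _ (fine (S x))) => j; rewrite -lee_fin fineK //.
  apply: le_trans (@nneseries_lim_ge _ _ xpredT 0%N j.+1 (fun n _ _ => t0 n x)).
  rewrite big_nat_recr //= leeDr // sume_ge0 // => *; exact: t0.
(* Cutting off the null set where [S] is infinite makes the sequence converge at every point, so
   that the limit is measurable. *)
pose w j := (val (v j)) \_ G.
have sw j : sqint (w j).
  apply: (@sqint_le _ _ (val (v j))); last 2 first.
  - exact: sqint_l2.
  - by move=> x; rewrite /w patchE; case: ifP; rewrite // normr0.
  - by apply/(measurable_restrictT _ mG); exact: measurable_l2.
have cw x : cvgn (fun j => w j x).
  have [Gx|Gx] := pselect (G x).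
    rewrite (_ : (fun j => w j x) = fun j => val (v j) x); first exact: cvgG.
    by apply/funext => j; rewrite /w patchE mem_set.
  rewrite (_ : (fun j => w j x) = fun=> 0); first exact: is_cvg_cst.
  by apply/funext => j; rewrite /w patchE memNset.
pose f x := limn (fun j => w j x).
have fw x : (fun j => w j x) @ \oo --> f x by exact: cw.
have mf : measurable_fun setT f.
  apply: (@measurable_fun_cvg _ _ _ _ w) => [m|x _]; last exact: fw.
  by case: (sw m).
have mw j : measurable_fun setT (w j) by case: (sw j).
have iw i j : (i <= j)%N -> (\int[mu]_x ((w j x - w i x) ^+ 2)%:E <= (r i ^+ 2)%:E)%E.
  move=> ij; apply: le_trans (hv2 _ _ ij).
  rewrite [leRHS]integral_mkcond; apply: ge0_le_integral => //.
  - by move=> x _; rewrite lee_fin sqr_ge0.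
  - by apply/measurable_EFinP; apply: measurable_funX; apply: measurable_funB; exact: mw.
  - by apply/(measurable_restrictT _ mD); apply/measurable_EFinP; apply: measurable_funTS; exact: mv.
  - move=> x _; rewrite /w !patchE; case: ifPn => [/set_mem [Dx _]|_].
      by rewrite mem_set.
    by rewrite subrr expr0n /=; case: ifP => // _; rewrite lee_fin sqr_ge0.
have mfw i : measurable_fun setT (fun x => f x - w i x).
  by apply: measurable_funB; [exact: mf | exact: mw].
(* Fatou's lemma passes the distance estimate to the pointwise limit. *)
have fat i : (\int[mu]_x ((f x - w i x) ^+ 2)%:E <= (r i ^+ 2)%:E)%E.
  have -> : (\int[mu]_x ((f x - w i x) ^+ 2)%:E =
     \int[mu]_x limn_einf (fun j => ((w j x - w i x) ^+ 2)%:E))%E.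
    apply: eq_integral => x _; apply/esym.
    suff /cvg_limn_einf_sup[-> _] : (fun j => ((w j x - w i x) ^+ 2)%:E) @ \oo --> ((f x - w i x) ^+ 2)%:E by [].
    apply/fine_cvgP; split; first exact: nearW.
    have h : (fun j => (w j x - w i x) ^+ 2) @ \oo --> (f x - w i x) ^+ 2.
      by rewrite expr2; under eq_fun do rewrite expr2; apply: cvgM;
        apply: cvgB; [exact: fw | exact: cvg_cst | exact: fw | exact: cvg_cst].
    exact: h.
  apply: le_trans (fatou _ _ _ _) _ => //.
  - by move=> j; apply/measurable_EFinP; apply: measurable_funX; apply: measurable_funB; exact: mw.
  - by move=> j x _; rewrite lee_fin sqr_ge0.
  rewrite limn_einf_lim; apply: lime_le; first exact: is_cvg_einfs.
  apply: nearW => n; apply: le_trans (iw i (maxn i n) (leq_maxl _ _)).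
  by apply: ereal_inf_lbound; exists (maxn i n) => //=; exact: leq_maxr.
have sfw i : sqint (fun x => f x - w i x).
  split; first exact: mfw.
  apply/integrableP; split.
    by apply/measurable_EFinP; apply: measurable_funX; exact: mfw.
  under eq_integral => x _ do rewrite /= ger0_norm ?sqr_ge0 //.
  exact: le_lt_trans (fat i) (ltry _).
have sf : sqint f.
  have -> : f = (1 *: (fun x => f x - w 0%N x : R^o) + w 0%N) :> (R -> R^o).
    by apply/funext => x; rewrite -[RHS]/(1 * (f x - w 0%N x) + w 0%N x) mul1r subrK.
  exact: (@sqint_linear R).2.
pose l : l2fun R := Subset_lmod (@sqint_linear R) sf.
have lv i : inorm ip (l - v i) <= r i.
  rewrite -(ler_pXn2r (n := 2)) ?nnegrE ?inorm_ge0 ?(ltW (r0 i)) // (inorm_sqr sip).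
  rewrite -lee_fin l2ip_EFin; under eq_integral => x _ do rewrite l2valB; apply: le_trans (fat i).
  apply: (@le_trans _ _ (\int[mu]_(x in D) ((f x - w i x) ^+ 2)%:E)%E); last first.
    apply: ge0_subset_integral => //.
    - by apply/measurable_EFinP; apply: measurable_funX; exact: mfw.
    - by move=> x _; rewrite lee_fin sqr_ge0.
  rewrite le_eqVlt; apply/orP; left; apply/eqP.
  apply: ge0_ae_eq_integral; first exact: mD.
  - by apply/measurable_EFinP; apply: measurable_funX; apply: measurable_funB; exact: measurable_l2.
  - by apply/measurable_EFinP; apply: measurable_funX; apply: measurable_funTS; exact: mfw.
  - by move=> x _; rewrite lee_fin sqr_ge0.
  - by move=> x _; rewrite lee_fin sqr_ge0.
  exists N0; split => // x /= /not_implyP[Dx h]; apply: contrapT => Nx; apply: h.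
  by rewrite /w patchE mem_set.
exists l => e e0.
have e2 : 0 < e / 2 by rewrite divr_gt0.
have [N1 hN1] := Cu _ e2.
have [j jN hj] : exists2 j, (N1 <= j)%N & r j < e / 2.
  have [N2 _ hN2] := near_infty_natSinv_lt (PosNum e2).
  exists (maxn N1 N2); first exact: leq_maxl.
  have := hN2 _ (leq_maxr N1 N2); apply: le_lt_trans.
  rewrite /r lef_pV2 ?posrE ?exprn_gt0 // -natrX ler_nat.
  by rewrite (leq_trans _ (ltn_expl _ (isT : (1 < 4)%N))).
pose i := maxn j (k j).
exists (maxn N1 (N j)) => n; rewrite geq_max => /andP[n1 n2].
have h1 := lv j; have h2 : inorm ip (u n - v j) < r j by apply: hN => //; exact: kN.
rewrite (inormB sip) in h1.
apply: le_lt_trans (inorm_dist sip (v j) _ _) _.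
rewrite [ltRHS]splitr; apply: ltrD; first exact: lt_trans hj.
exact: le_lt_trans hj.
Qed.

End RieszFischer.

(** * Sampling integrable functions, and Cauchy-Schwarz for primitives *)

Section HalfLine.
Variable R : realType.
Local Notation mu := (@lebesgue_measure R).
Local Notation D := (`]0, +oo[%classic : set R).
Local Notation ip := (@l2ip R).
Let sip := @l2_semi_inner R.
Implicit Types (f g : R -> R) (F G : l2fun R).

Lemma integrable_cst_on (I : set (measurableTypeR R)) (k : R) :
  measurable I -> (mu I < +oo)%E -> mu.-integrable I (EFin \o cst k).
Proof.
move=> mI Ioo; apply: measurable_bounded_integrable => //.
by exists `|k|; split; [exact: num_real | move=> M kM x _; exact: ltW].
Qed.

Lemma Rintegral_cst_on (I : set (measurableTypeR R)) (k r : R) :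
  measurable I -> mu I = r%:E -> \int[mu]_(x in I) k = k * r.
Proof.
move=> mI muI; transitivity (k * fine (mu I)); first exact: Rintegral_cst.
by rewrite muI.
Qed.

Lemma half_line_split T : 0 <= T -> D = `]0, T] `|` `]T, +oo[.
Proof.
move=> T0; rewrite -itv_bndbnd_setU ?bnd_simp //.
Qed.

Lemma Rintegral_split g T : mu.-integrable setT (EFin \o g) -> 0 <= T ->
  \int[mu]_(x in D) g x = \int[mu]_(x in `]0, T]) g x + \int[mu]_(x in `]T, +oo[) g x.
Proof.
move=> ig T0; rewrite (half_line_split T0) Rintegral_setU //.
- rewrite -half_line_split //; exact: integrableS ig.
- rewrite disj_set2E; apply/eqP; rewrite -subset0 => x [/=]; rewrite !in_itv /= andbT.
  by move=> /andP[_ h1] h2; move: h1; rewrite leNgt h2.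
Qed.

Lemma Rintegral_subset_ge0 g (A B : set R) : measurable A -> measurable B -> A `<=` B ->
  mu.-integrable setT (EFin \o g) -> (forall x, 0 <= g x) ->
  \int[mu]_(x in A) g x <= \int[mu]_(x in B) g x.
Proof.
move=> mA mB AB ig g0; rewrite /Rintegral fine_le ?integrable_fin_num //; try exact: integrableS ig.
apply: ge0_subset_integral => //.
  by apply: measurable_funTS; case/integrableP : ig.
by move=> x _; rewrite lee_fin.
Qed.

Lemma half_line_tail g : mu.-integrable setT (EFin \o g) -> (forall x, 0 <= g x) ->
  forall e, 0 < e -> exists2 T, 0 < T & \int[mu]_(x in `]T, +oo[) g x < e.
Proof.
move=> ig g0 e e0.
pose A (n : nat) : set R := `]0, n%:R]%classic.
have UA : \bigcup_n A n = D.
  apply/seteqP; split => x.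
    by move=> [n _]; rewrite /A /= !in_itv /= andbT => /andP[].
  rewrite /= in_itv /= andbT => x0; exists (Num.truncn x).+1 => //.
  by rewrite /A /= in_itv /= x0 ltW // truncnS_gt.
have mA n : measurable (A n : set (measurableTypeR R)) by exact: measurable_itv.
have mg B : measurable_fun (B : set (measurableTypeR R)) (EFin \o g).
  by apply: measurable_funTS; case/integrableP : ig.
have iA n : mu.-integrable (A n) (EFin \o g) by exact: integrableS ig.
have iD : mu.-integrable D (EFin \o g) by exact: integrableS ig.
have ndA : nondecreasing_seq A.
  move=> m n mn; apply/subsetPset => x; rewrite /A /= !in_itv /= => /andP[-> h] /=.
  by rewrite (le_trans h) // ler_nat.
have cv : (\int[mu]_(x in A i) (g x)%:E)%E @[i --> \oo] --> (\int[mu]_(x in \bigcup_i A i) (g x)%:E)%E.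
  apply: ge0_nondecreasing_set_cvg_integral => [|i|i|i x _].
  - exact: ndA.
  - exact: mA.
  - exact: mg.
  - by rewrite lee_fin.
rewrite UA in cv.
have {}cv : (fun n => \int[mu]_(x in A n) g x) @ \oo --> \int[mu]_(x in D) g x.
  apply: fine_cvg; rewrite /Rintegral fineK //; exact: integrable_fin_num.
move/cvgrPdist_lt : cv => /(_ e e0)[N _ /(_ N.+1 (leqnSn N))] /=.
rewrite (Rintegral_split ig (ler0n R N.+1)) addrC addKr => h.
exists N.+1%:R => //; exact: le_lt_trans (ler_norm _) h.
Qed.

(** A function is at most its mean somewhere on a set of positive measure; otherwise [g] minus its
    mean would be positive almost everywhere with integral 0. *)
Lemma interval_sample g (Q : R -> Prop) p q : 0 <= p -> p < q ->
  mu.-integrable setT (EFin \o g) -> (forall x, 0 <= g x) -> {ae mu, forall x, 0 < x -> Q x} ->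
  exists x, [/\ p < x < q, Q x & g x * (q - p) <= \int[mu]_(x in `]p, q[) g x].
Proof.
move=> p0 pq ig g0 aeQ; apply: contrapT => h.
pose I : set R := `]p, q[%classic.
pose k := \int[mu]_(x in I) g x.
have mI : measurable (I : set (measurableTypeR R)) by exact: measurable_itv.
have igI : mu.-integrable I (EFin \o g) by exact: integrableS ig.
have muI : mu I = (q - p)%:E by rewrite lebesgue_measure_itv /= lte_fin pq.
have qp : 0 < q - p by rewrite subr_gt0.
have ik : mu.-integrable I (EFin \o cst (k / (q - p))).
  by apply: integrable_cst_on; rewrite ?muI ?ltry.
have idiff : mu.-integrable I (EFin \o (fun x => g x - k / (q - p))).
  exact: (integrableB mI igI ik).
have h0 : \int[mu]_(x in I) (g x - k / (q - p)) = 0.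
  rewrite RintegralB // (Rintegral_cst_on _ mI muI) divfK ?gt_eqF // /k subrr //.
have : (\int[mu]_(x in I) `|(g x - k / (q - p))%:E| = 0)%E.
  rewrite (_ : (\int[mu]_(x in I) `|(g x - k / (q - p))%:E| = \int[mu]_(x in I) (g x - k / (q - p))%:E)%E).
    transitivity ((\int[mu]_(x in I) (g x - k / (q - p)))%R%:E); last by rewrite h0.
    by rewrite /Rintegral fineK //; exact: integrable_fin_num.
  apply: ae_eq_integral => //.
  - by apply: measurableT_comp => //; case/integrableP : idiff.
  - by case/integrableP : idiff.
  apply: ae_imp aeQ => x Qx; rewrite /I /= in_itv /= => /andP[px xq].
  have gx : k < g x * (q - p).
    rewrite ltNge; apply/negP => h'; apply: h; exists x; rewrite px xq; split => //.
    by apply: Qx; exact: le_lt_trans px.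
  by rewrite gtr0_norm // subr_gt0 ltr_pdivrMr.
move/ae_eq_integral_abs => /(_ mI); case.
  by case/integrableP : idiff.
move=> N [mN N0 hN]; have [N' [mN' N'0 hN']] := aeQ.
suff : (mu I <= 0)%E by rewrite muI lee_fin leNgt qp.
apply: (@le_trans _ _ (mu (N `|` N'))).
  apply: le_measure; rewrite ?inE //; first exact: measurableU.
  move=> x Ix; apply: contrapT => /not_orP[Nx N'x].
  have Qx : Q x.
    apply: contrapT => nQ; apply/N'x/hN' => /(_ _)hh; apply: nQ; apply: hh.
    by move: Ix; rewrite /I /= in_itv /= => /andP[px _]; exact: le_lt_trans px.
  have gx : g x - k / (q - p) = 0.
    have : (g x - k / (q - p))%:E = 0%E.
      by apply: contrapT => h'; apply/Nx/hN => /(_ Ix).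
    by case.
  apply: h; exists x; split => //.
  by rewrite (_ : g x = k / (q - p)) ?divfK ?gt_eqF //; apply/eqP; rewrite -subr_eq0 gx.
apply: le_trans (measureU2 mu mN mN') _.
by rewrite -[leRHS]adde0; apply: leeD; rewrite le_eqVlt; apply/orP; left; apply/eqP.
Qed.

(** On [[p, 2p]] one has [x <= 2 (2p - p)], so at a sample point [x g x] is at most twice the
    integral of [g] over that interval, a small tail. This disposes of boundary terms of size
    [x F^2] at infinity. *)
Lemma far_sample g (Q : R -> Prop) : mu.-integrable setT (EFin \o g) ->
  (forall x, 0 <= g x) -> {ae mu, forall x, 0 < x -> Q x} ->
  forall e X, 0 < e -> exists x, [/\ X <= x, 0 < x, Q x & x * g x < e].
Proof.
move=> ig g0 aeQ e X e0.
have e2 : 0 < e / 2 by rewrite divr_gt0.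
have [T T0 hT] := half_line_tail ig g0 e2.
pose p := Num.max T X.
have p0 : 0 < p by rewrite lt_max T0.
have [|x [/andP[px xq] Qx hx]] := @interval_sample g Q p (2 * p) (ltW p0) _ ig g0 aeQ.
  by rewrite ltr_pMl // ltr1n.
exists x; split => //.
- by apply: ltW; apply: le_lt_trans px; rewrite le_max lexx orbT.
- exact: lt_trans px.
apply: (@le_lt_trans _ _ (2 * (g x * (2 * p - p)))).
  have := ler_wpM2r (g0 x) (ltW xq); lra.
rewrite -ltr_pdivlMl // [ltRHS]mulrC; apply: le_lt_trans hT; apply: le_trans hx _.
apply: Rintegral_subset_ge0 => // y; rewrite /= !in_itv /= andbT => /andP[py _].
by apply: le_lt_trans py; rewrite le_max lexx.
Qed.

Lemma locint_sqint f : sqint f -> locint f.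
Proof.
move=> sf; have [mf if2] := sf; split => // b.
have i1 : mu.-integrable `[- b, b] (EFin \o (cst 1 : R -> R)).
  apply: integrable_cst_on => //.
  by rewrite /= lebesgue_measure_itv /=; case: ifP => // _; rewrite -EFinD ltry.
have i2 : mu.-integrable `[- b, b] (EFin \o (fun x => f x ^+ 2)) by exact: integrableS if2.
apply: (le_integrable _ _ _ (integrableD _ i1 i2)) => //.
  by apply/measurable_EFinP; exact: measurable_funTS.
move=> x _; rewrite /= lee_fin [leRHS]ger0_norm ?addr_ge0 ?sqr_ge0 //.
rewrite ler_norml; have h1 := sqr_ge0 (f x - 1); have h2 := sqr_ge0 (f x + 1).
by move: h1 h2; rewrite sqrrB sqrrD => *; apply/andP; split; have := sqr_ge0 (f x); lra.
Qed.

Lemma locint_integrable f : mu.-integrable setT (EFin \o f) -> locint f.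
Proof.
move=> i_f; split; first by case/integrableP: i_f => /measurable_EFinP.
by move=> b; exact: integrableS i_f.
Qed.

Lemma primZD f g k x : locint f -> locint g ->
  prim (fun t => k * f t + g t) x = k * prim f x + prim g x.
Proof.
move=> lf lg; rewrite /prim RintegralD //; last 2 first.
- exact: (integrableZl _ k (locint_itv 0 x lf)).
- exact: locint_itv.
by rewrite RintegralZl //; exact: locint_itv.
Qed.

Variable m : R -> R.
Hypotheses (mm : measurable_fun setT m) (m1 : forall x, `|m x| <= 1).

Lemma sqint_bmul f : sqint f -> sqint (fun x => m x * f x).
Proof.
move=> sf; apply: (sqint_le _ sf).
  by apply: measurable_funM => //; case: sf.
by move=> x; rewrite normrM ler_piMl.
Qed.

Lemma locint_bmul F : locint (fun x => m x * val F x).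
Proof. apply: locint_sqint; apply: sqint_bmul; exact: sqint_l2. Qed.

(* Cauchy-Schwarz against the truncated multiplier. *)
Lemma prim_holder F x y : 0 <= x -> x <= y ->
  (prim (fun t => m t * val F t) y - prim (fun t => m t * val F t) x) ^+ 2 <= (y - x) * ip F F.
Proof.
move=> x0 xy; rewrite primB //; last exact: locint_bmul.
pose I : set R := `]x, y]%classic.
have mI : measurable (I : set (measurableTypeR R)) by exact: measurable_itv.
have muI : mu I = (y - x)%:E.
  by rewrite /I lebesgue_measure_itv /= lte_fin; case: ltgtP xy => // ->; rewrite subrr.
have s1 : sqint (\1_I : R -> R).
  split => //; rewrite (_ : _ \o _ = EFin \o \1_I); last first.
    by apply/funext => t /=; rewrite indicE; case: (_ \in _); rewrite ?expr1n ?expr0n.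
  exact: (integrable_indic_itv x y false false).
have sI : sqint (m \_ I).
  apply: (sqint_le _ s1); first by apply/(measurable_restrictT _ mI); exact: measurable_funTS.
  by move=> t; rewrite patchE indicE; case: ifP => _; rewrite ?normr0 // normr1.
pose K : l2fun R := Subset_lmod (@sqint_linear R) sI.
have mD : measurable (D : set (measurableTypeR R)) by exact: measurable_itv.
have ID : I `<=` D.
  by move=> t; rewrite /I /= !in_itv /= andbT => /andP[h _]; exact: le_lt_trans h.
have -> : \int[mu]_(t in `]x, y]) (m t * val F t) = ip K F.
  rewrite Rintegral_mkcond l2ipE [RHS]Rintegral_mkcond; apply: eq_Rintegral => t _.
  rewrite !patchE /= patchE; case: ifPn => [tI|tI].
    by rewrite mem_set //; apply: ID; exact: set_mem.
  by rewrite mul0r; case: ifP.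
apply: le_trans (ip_cauchy_sqr sip K F) _; apply: ler_wpM2r; first exact: (ip_ge0 sip).
have -> : y - x = \int[mu]_(t in I) 1.
  by rewrite (Rintegral_cst_on _ mI muI) mul1r.
rewrite [leRHS]Rintegral_mkcond l2ipE Rintegral_mkcond; apply: le_Rintegral => //.
- rewrite (_ : EFin \o _ = (EFin \o (fun t => val K t * val K t)) \_ D).
    by apply/(integrable_mkcond _ mD); exact: l2fun_integrable.
  by apply/funext => t; rewrite /= !patchE; case: ifP.
- rewrite (_ : EFin \o _ = (EFin \o cst 1) \_ I); last first.
    by apply/funext => t; rewrite /= !patchE; case: ifP.
  apply/(integrable_mkcond _ mI); apply: integrable_cst_on => //.
  by rewrite muI ltry.
- move=> t _; rewrite !patchE /= patchE; case: ifPn => [tD|tD].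
    case: ifPn => // _; last by rewrite mul0r.
    have := m1 t; rewrite ler_norml => /andP[h1 h2]; nra.
  by case: ifP.
Qed.

End HalfLine.

(** * Solutions in integral form and symmetry of the relation *)

Section Solutions.
Variable R : realType.
Local Notation mu := (@lebesgue_measure R).
Local Notation D := (`]0, +oo[%classic : set R).
Local Notation ip := (@l2ip R).
Local Notation "`[ x ]" := (inorm ip x) (format "`[ x ]").
Let sip := @l2_semi_inner R.
Implicit Types (F G : l2fun R) (a x y : R).

Lemma l2_null F : `[F] = 0 <-> {ae mu, forall x, 0 < x -> val F x = 0}.
Proof.
have mD : measurable (D : set (measurableTypeR R)) by exact: measurable_itv.
have mF : measurable_fun D (fun x => ((val F x) ^+ 2)%:E).
  by apply/measurable_EFinP; apply: measurable_funX; exact: measurable_l2.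
have E1 : (\int[mu]_(x in D) `|((val F x) ^+ 2)%:E| = (ip F F)%:E)%E.
  by rewrite l2ip_EFin; apply: eq_integral => x _; rewrite gee0_abs // lee_fin sqr_ge0.
have [H1 H2] := ae_eq_integral_abs mu mD mF.
rewrite E1 in H1 H2; split => [F0|F0].
  have {}F0 : ip F F = 0 by rewrite -inorm_sqr // F0 expr0n.
  have := H1 (congr1 EFin F0); apply: ae_imp => x h x0.
  have := h _; rewrite /= in_itv /= andbT => /(_ x0) [] /eqP.
  by rewrite sqrf_eq0 => /eqP.
have ip00 : ip F F = 0; last by rewrite /inorm ip00 sqrtr0.
suff [] : (ip F F)%:E = 0%E by [].
apply: H2; apply: ae_imp F0 => x h; rewrite /= in_itv /= andbT => /h ->.
by rewrite expr0n.
Qed.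

Variables (c s : R -> R) (l : R).
Hypotheses (mc : measurable_fun setT c) (ms : measurable_fun setT s).
Hypotheses (c1 : forall x, `|c x| <= 1) (s1 : forall x, `|s x| <= 1).
Hypothesis cs1 : forall x, 0 < x -> c x ^+ 2 + s x ^+ 2 = 1.

(** Coordinates along [e_l] and [J e_l] of the solution of [J f' = - H g] with [f 0 = (a, 0)]; the
    boundary condition leaves the single parameter [a]. The functions [c] and [s] stand for the
    cosine and sine of [phi - l]. *)
Definition sol_al a G x := a * cos l - prim (fun t => s t * val G t) x.
Definition sol_be a G x := - (a * sin l) + prim (fun t => c t * val G t) x.
Definition sol a G x := sol_al a G x * c x + sol_be a G x * s x.
Definition solves a F G := {ae mu, forall x, 0 < x -> val F x = sol a G x}.

Let lsG G : locint (fun t => s t * val G t). Proof. exact: locint_bmul. Qed.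
Let lcG G : locint (fun t => c t * val G t). Proof. exact: locint_bmul. Qed.

Lemma sol_alD k a a' G G' x :
  sol_al (k * a + a') (k *: G + G') x = k * sol_al a G x + sol_al a' G' x.
Proof.
rewrite /sol_al (_ : (fun t => _) = fun t => k * (s t * val G t) + s t * val G' t).
  by rewrite primZD //; ring.
by apply/funext => t; rewrite l2valD l2valZ; ring.
Qed.

Lemma sol_beD k a a' G G' x :
  sol_be (k * a + a') (k *: G + G') x = k * sol_be a G x + sol_be a' G' x.
Proof.
rewrite /sol_be (_ : (fun t => _) = fun t => k * (c t * val G t) + c t * val G' t).
  by rewrite primZD //; ring.
by apply/funext => t; rewrite l2valD l2valZ; ring.
Qed.

Lemma sol_al0 a G : sol_al a G 0 = a * cos l.
Proof. by rewrite /sol_al prim0 subr0. Qed.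
Lemma sol_be0 a G : sol_be a G 0 = - (a * sin l).
Proof. by rewrite /sol_be prim0 addr0. Qed.

Lemma solD k a a' G G' x :
  sol (k * a + a') (k *: G + G') x = k * sol a G x + sol a' G' x.
Proof. by rewrite /sol sol_alD sol_beD; ring. Qed.

Lemma solves_lin k a a' F F' G G' : solves a F G -> solves a' F' G' ->
  solves (k * a + a') (k *: F + F') (k *: G + G').
Proof.
apply: ae_imp2 => x h h' x0; rewrite l2valD l2valZ solD h // h' //.
Qed.

Lemma solvesB a a' F F' G G' : solves a F G -> solves a' F' G' ->
  solves (a - a') (F - F') (G - G').
Proof.
move=> h h'; have := solves_lin (-1) h' h.
by rewrite !scaleN1r mulN1r ![- _ + _]addrC.
Qed.

(** Pythagoras after a rotation: [sol] is the coordinate seen by [H], the second square is that of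
    the coordinate [H] does not see. *)
Lemma sol_sqr a G x : 0 < x -> sol a G x ^+ 2 +
  (sol_be a G x * c x - sol_al a G x * s x) ^+ 2 = sol_al a G x ^+ 2 + sol_be a G x ^+ 2.
Proof.
move=> x0; rewrite /sol -[RHS]mulr1 -(cs1 x0); ring.
Qed.

Lemma sol_sqr_le a G x : 0 < x ->
  sol a G x ^+ 2 <= sol_al a G x ^+ 2 + sol_be a G x ^+ 2.
Proof. by move=> x0; rewrite -(sol_sqr a G x0) lerDl sqr_ge0. Qed.

Let ip0 G : 0 <= ip G G. Proof. exact: (ip_ge0 sip). Qed.

Lemma sol_al_holder a G x y : 0 <= x -> x <= y ->
  (sol_al a G y - sol_al a G x) ^+ 2 <= (y - x) * ip G G.
Proof.
move=> x0 xy; apply: le_trans (prim_holder ms s1 G x0 xy).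
by rewrite /sol_al le_eqVlt; apply/orP; left; apply/eqP; ring.
Qed.

Lemma sol_be_holder a G x y : 0 <= x -> x <= y ->
  (sol_be a G y - sol_be a G x) ^+ 2 <= (y - x) * ip G G.
Proof.
move=> x0 xy; apply: le_trans (prim_holder mc c1 G x0 xy).
by rewrite /sol_be le_eqVlt; apply/orP; left; apply/eqP; ring.
Qed.

Let trig_le1 (f : R) : `|f| <= 1 -> forall a, (a * f) ^+ 2 <= a ^+ 2.
Proof.
move=> h a; rewrite exprMn ler_piMr ?sqr_ge0 //.
by rewrite -(real_normK (num_real f)) expr_le1.
Qed.

(** Cauchy-Schwarz lets solutions grow at most like the square root of [x], the rate that
    [far_sample] can compensate. *)
Lemma sol_al_bound a G x : 0 <= x -> sol_al a G x ^+ 2 <= 2 * a ^+ 2 + 2 * x * ip G G.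
Proof.
move=> x0; have := sol_al_holder a G (lexx 0) x0; rewrite sol_al0 subr0.
have := trig_le1 (cos_max l) a.
set A := sol_al a G x; set B := a * cos l.
have := sqr_ge0 (A - 2 * B); nra.
Qed.

Lemma sol_be_bound a G x : 0 <= x -> sol_be a G x ^+ 2 <= 2 * a ^+ 2 + 2 * x * ip G G.
Proof.
move=> x0; have := sol_be_holder a G (lexx 0) x0; rewrite sol_be0 subr0.
have := trig_le1 (sin_max l) a.
set A := sol_be a G x; set B := a * sin l.
have := sqr_ge0 (A + 2 * B); nra.
Qed.

(** By linearity the difference is a solution with [a = 0] and null right-hand side, and the growth
    bound forces it to be 0. *)
Lemma sol_null G G' a x : `[G' - G] = 0 -> 0 <= x ->
  sol_al a G' x = sol_al a G x /\ sol_be a G' x = sol_be a G x.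
Proof.
move=> h x0; have ip00 : ip (G' - G) (G' - G) = 0 by rewrite -inorm_sqr // h expr0n.
have e1 := sol_al_bound 0 (G' - G) x0; have e2 := sol_be_bound 0 (G' - G) x0.
have d1 := sol_alD (-1) a a G G' x; have d2 := sol_beD (-1) a a G G' x.
rewrite scaleN1r mulN1r addNr addrC in d1; rewrite scaleN1r mulN1r addNr addrC in d2.
rewrite ip00 mulr0 addr0 expr0n mulr0 /= in e1 e2.
have {}e1 : sol_al 0 (G' - G) x = 0 by apply/eqP; rewrite -sqrf_eq0 eq_le e1 sqr_ge0.
have {}e2 : sol_be 0 (G' - G) x = 0 by apply/eqP; rewrite -sqrf_eq0 eq_le e2 sqr_ge0.
by split; lra.
Qed.

Lemma solves_null a F G F' G' : solves a F G -> `[F' - F] = 0 -> `[G' - G] = 0 ->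
  solves a F' G'.
Proof.
move=> h /l2_null h1 h2; apply: ae_imp2 h h1 => x h h1 x0.
have := h1 x0; rewrite l2valB h // => /eqP; rewrite subr_eq0 => /eqP ->.
by have [e1 e2] := sol_null a h2 (ltW x0); rewrite /sol e1 e2.
Qed.

Lemma sol_al_ac a G b : abs_continuous 0 b (sol_al a G).
Proof. by apply: acB; [exact: ac_cst | exact: prim_ac]. Qed.

Lemma sol_be_ac a G b : abs_continuous 0 b (sol_be a G).
Proof. by apply: acD; [exact: ac_cst | exact: prim_ac]. Qed.

Lemma sol_al_derive a G :
  {ae mu, forall x, 0 < x -> is_derive x 1 (sol_al a G) (- (s x * val G x))}.
Proof.
have := prim_derive (lsG G); apply: ae_imp => x h x0; have {}h := h x0.
rewrite -[- _]add0r /sol_al.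
exact: (is_deriveB (is_derive_cst _ x 1) h).
Qed.

Lemma sol_be_derive a G :
  {ae mu, forall x, 0 < x -> is_derive x 1 (sol_be a G) (c x * val G x)}.
Proof.
have := prim_derive (lcG G); apply: ae_imp => x h x0; have {}h := h x0.
rewrite -[_ * _]add0r /sol_be.
exact: (is_deriveD (is_derive_cst _ x 1) h).
Qed.

(** The determinant of the two solutions has the integrand as derivative, and it starts at 0 because
    both initial vectors are multiples of [(1, 0)]. *)
Lemma wronskian a1 a2 F1 F2 G1 G2 X : solves a1 F1 G1 -> solves a2 F2 G2 -> 0 <= X ->
  prim (fun t => val F1 t * val G2 t - val G1 t * val F2 t) X =
  sol_al a1 G1 X * sol_be a2 G2 X - sol_al a2 G2 X * sol_be a1 G1 X.
Proof.
move=> h1 h2 X0.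
have lg : locint (fun t => val F1 t * val G2 t - val G1 t * val F2 t).
  apply: locint_integrable.
  exact: (integrableB measurableT (sqint_mul (sqint_l2 F1) (sqint_l2 G2))
    (sqint_mul (sqint_l2 G1) (sqint_l2 F2))).
pose W x := sol_al a1 G1 x * sol_be a2 G2 x - sol_al a2 G2 x * sol_be a1 G1 x.
have acW : abs_continuous 0 X W.
  by apply: acB; apply: acM => //; try exact: sol_al_ac; exact: sol_be_ac.
have := ac_ftc (lexx 0) X0 acW lg.
rewrite /W !sol_al0 !sol_be0 prim0 subr0.
have -> : a1 * cos l * - (a2 * sin l) - a2 * cos l * - (a1 * sin l) = 0 by ring.
rewrite subr0 => <- //.
have D12 := ae_imp2 (fun x p q => conj p q) h1 h2.
have E1 := ae_imp2 (fun x p q => conj p q) (sol_al_derive a1 G1) (sol_be_derive a1 G1).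
have E2 := ae_imp2 (fun x p q => conj p q) (sol_al_derive a2 G2) (sol_be_derive a2 G2).
apply: ae_imp2 (ae_imp2 (fun x p q => conj p q) E1 E2) D12 => x [[p1 p2] [p3 p4]] [q1 q2].
move=> /andP[x0 _]; have {}p1 := p1 x0; have {}p2 := p2 x0; have {}p3 := p3 x0; have {}p4 := p4 x0.
have dW := is_deriveB (is_deriveM p1 p4) (is_deriveM p3 p2).
by apply: (is_derive_eq dW); rewrite q1 // q2 // /sol /GRing.scale /=; ring.
Qed.

(** In the rotated basis the determinant at [X] is [F1 E2 - F2 E1] with the unseen coordinates [E].
    These satisfy [E^2 = O(X)], while [X (F1^2 + F2^2)] tends to 0 along suitable far points. *)
Lemma solves_sym a1 a2 F1 F2 G1 G2 : solves a1 F1 G1 -> solves a2 F2 G2 ->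
  ip F1 G2 = ip G1 F2.
Proof.
move=> h1 h2; pose g t := val F1 t * val G2 t - val G1 t * val F2 t.
have mD : measurable (D : set (measurableTypeR R)) by exact: measurable_itv.
have ig : mu.-integrable setT (EFin \o g).
  exact: (integrableB measurableT (sqint_mul (sqint_l2 F1) (sqint_l2 G2))
    (sqint_mul (sqint_l2 G1) (sqint_l2 F2))).
have ign : mu.-integrable setT (EFin \o (fun x => `|g x|)) by exact: (integrable_norm ig).
have i1 := l2fun_integrable F1 G2 mD; have i2 := l2fun_integrable G1 F2 mD.
have ipg : ip F1 G2 - ip G1 F2 = \int[mu]_(x in D) g x by rewrite !l2ipE -RintegralB.
apply/eqP; rewrite -subr_eq0 -normr_le0; apply/ler_addgt0Pl => e e0; rewrite addr0 ipg.
have e2 : 0 < e / 2 by rewrite divr_gt0.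
have [T T0 hT] := half_line_tail ign (fun x => normr_ge0 _) e2.
pose N1 := 2 * a1 ^+ 2 + 2 * ip G1 G1; pose N2 := 2 * a2 ^+ 2 + 2 * ip G2 G2.
have N10 : 0 <= N1 by rewrite /N1; have := sqr_ge0 a1; have := ip0 G1; lra.
have N20 : 0 <= N2 by rewrite /N2; have := sqr_ge0 a2; have := ip0 G2; lra.
pose K := 4 * (N1 + N2) + 1.
have K0 : 0 < K by rewrite /K; lra.
pose q x := val F1 x ^+ 2 + val F2 x ^+ 2.
have iq : mu.-integrable setT (EFin \o q).
  exact: (integrableD measurableT (sqint_l2 F1).2 (sqint_l2 F2).2).
have q0 x : 0 <= q x by rewrite addr_ge0 ?sqr_ge0.
have d0 : 0 < (e / 2) ^+ 2 / K by rewrite divr_gt0 ?exprn_gt0.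
(* Asking also for [X >= 1] lets [a ^+ 2] be absorbed into [X * a ^+ 2]. *)
have [X [TX X0 [f1 f2] hX]] := far_sample iq q0
  (ae_imp2 (fun x p q (x0 : 0 < x) => conj (p x0) (q x0)) h1 h2) (Num.max T 1) d0.
have {TX} [TX X1] : T <= X /\ 1 <= X by move: TX; rewrite ge_max => /andP[].
rewrite (Rintegral_split ig (ltW X0)).
apply: le_trans (ler_normD _ _) _; rewrite [leRHS]splitr; apply: lerD; last first.
  apply: le_trans (le_normr_Rintegral _ _) _ => //; first exact: integrableS ig.
  apply: ltW; apply: le_lt_trans hT; apply: Rintegral_subset_ge0 => // x.
  by rewrite /= !in_itv /= !andbT; exact: le_lt_trans.
rewrite -primB ?(ltW X0) // ?prim0 ?subr0; last exact: locint_integrable.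
rewrite (wronskian h1 h2 (ltW X0)).
rewrite -(ler_pXn2r (n := 2)) ?nnegrE ?(ltW e2) // real_normK ?num_real //.
move: hX; rewrite ltr_pdivlMr // => hX.
apply: le_trans (ltW hX).
have u1 := sol_sqr a1 G1 X0; have u2 := sol_sqr a2 G2 X0.
rewrite -f1 in u1; rewrite -f2 in u2; rewrite /q.
have b1 : sol_al a1 G1 X ^+ 2 + sol_be a1 G1 X ^+ 2 <= 2 * X * N1.
  have := sol_al_bound a1 G1 (ltW X0); have := sol_be_bound a1 G1 (ltW X0).
  have : a1 ^+ 2 <= X * a1 ^+ 2 by rewrite ler_peMl ?sqr_ge0.
  rewrite /N1; lra.
have b2 : sol_al a2 G2 X ^+ 2 + sol_be a2 G2 X ^+ 2 <= 2 * X * N2.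
  have := sol_al_bound a2 G2 (ltW X0); have := sol_be_bound a2 G2 (ltW X0).
  have : a2 ^+ 2 <= X * a2 ^+ 2 by rewrite ler_peMl ?sqr_ge0.
  rewrite /N2; lra.
set A1 := sol_al a1 G1 X in b1 u1 f1 *; set B1 := sol_be a1 G1 X in b1 u1 f1 *.
set A2 := sol_al a2 G2 X in b2 u2 f2 *; set B2 := sol_be a2 G2 X in b2 u2 f2 *.
set E1 := B1 * c X - A1 * s X in u1; set E2 := B2 * c X - A2 * s X in u2.
have -> : A1 * B2 - A2 * B1 = val F1 X * E2 - val F2 X * E1.
  by rewrite f1 f2 /sol -/A1 -/A2 -/B1 -/B2 -[LHS]mulr1 -(cs1 X0) /E1 /E2; ring.
set x1 := val F1 X in u1 *; set x2 := val F2 X in u2 *.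
have h3 : E1 ^+ 2 <= 2 * X * N1 by have := sqr_ge0 x1; lra.
have h4 : E2 ^+ 2 <= 2 * X * N2 by have := sqr_ge0 x2; lra.
apply: (@le_trans _ _ (2 * (x1 ^+ 2 * E2 ^+ 2 + x2 ^+ 2 * E1 ^+ 2))).
  have := sqr_ge0 (x1 * E2 + x2 * E1); rewrite sqrrB sqrrD !exprMn; lra.
have h5 := ler_wpM2l (sqr_ge0 x1) h4; have h6 := ler_wpM2l (sqr_ge0 x2) h3.
have h9 : 0 <= X * x1 ^+ 2 by exact: mulr_ge0 (ltW X0) (sqr_ge0 _).
have h10 : 0 <= X * x2 ^+ 2 by exact: mulr_ge0 (ltW X0) (sqr_ge0 _).
have h7 := mulr_ge0 h9 N10; have h8 := mulr_ge0 h10 N20.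
have h11 := mulr_ge0 h9 N20; have h12 := mulr_ge0 h10 N10.
rewrite /K; lra.
Qed.

End Solutions.

(** The left side is the derivative of the monotone quantity [Phi] of [solves_tail], with [A = al],
    [w = be / x], [t = s x] and [g = G]. Each mixed term is split so that the three negative squares
    absorb it. *)
Lemma sum_of_squares_sign (R : realType) (A w g c t eta : R) :
  t ^+ 2 <= eta ^+ 2 -> c ^+ 2 <= 1 ->
  (A * c + w * t) ^+ 2 - 4 * A ^+ 2 + 8 * A * t * g + eta ^+ 2 * (8 * w * c * g)
    - 4 * (eta ^+ 2 * w ^+ 2) - 16 * (eta ^+ 2 * g ^+ 2) <= 0.
Proof.
move=> te c1; have t1 : (A * c) ^+ 2 <= A ^+ 2 by rewrite exprMn ler_piMr ?sqr_ge0.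
have t2 : (w * t) ^+ 2 <= eta ^+ 2 * w ^+ 2 by rewrite exprMn mulrC ler_wpM2r ?sqr_ge0.
have t3 : (t * g) ^+ 2 <= eta ^+ 2 * g ^+ 2 by rewrite exprMn ler_wpM2r ?sqr_ge0.
have t4 : (c * g) ^+ 2 <= g ^+ 2 by rewrite exprMn ler_piMl ?sqr_ge0.
have k1 : (A * c + w * t) ^+ 2 <= 2 * A ^+ 2 + 2 * (eta ^+ 2 * w ^+ 2).
  by have := sqr_ge0 (A * c - w * t); rewrite sqrrB sqrrD; lra.
have k2 : 8 * A * t * g <= 2 * A ^+ 2 + 8 * (eta ^+ 2 * g ^+ 2).
  by have := sqr_ge0 (A - 2 * (t * g)); rewrite sqrrB; lra.
have k3 : 8 * w * c * g <= 2 * w ^+ 2 + 8 * g ^+ 2.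
  by have := sqr_ge0 (w - 2 * (c * g)); rewrite sqrrB; lra.
have k4 := ler_wpM2l (sqr_ge0 eta) k3; lra.
Qed.

(** * Tail estimate, uniqueness, and control of the initial value *)

Section SolutionEstimates.
Variable R : realType.
Local Notation mu := (@lebesgue_measure R).
Local Notation D := (`]0, +oo[%classic : set R).
Local Notation ip := (@l2ip R).
Local Notation "`[ x ]" := (inorm ip x) (format "`[ x ]").
Let sip := @l2_semi_inner R.
Implicit Types (F G : l2fun R) (a x y : R).

Variables (c s : R -> R) (l : R).
Hypotheses (mc : measurable_fun setT c) (ms : measurable_fun setT s).
Hypotheses (c1 : forall x, `|c x| <= 1) (s1 : forall x, `|s x| <= 1).
Hypothesis cs1 : forall x, 0 < x -> c x ^+ 2 + s x ^+ 2 = 1.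

Local Notation al := (sol_al s l).
Local Notation be := (sol_be c l).
Local Notation solves := (solves c s l).
Let ip0 G : 0 <= ip G G. Proof. exact: (ip_ge0 sip). Qed.
Let lsq G : locint (fun t => val G t ^+ 2).
Proof. by apply: locint_integrable; case: (sqint_l2 G). Qed.

Let prim_sq_le F x : 0 <= x -> prim (fun t => val F t ^+ 2) x <= ip F F.
Proof.
move=> x0; have ig := (sqint_l2 F).2.
rewrite -[prim _ x]subr0 -(prim0 (fun t => val F t ^+ 2)) primB // l2ipE.
rewrite (_ : \int[mu]_(t in D) _ = \int[mu]_(t in D) (val F t ^+ 2)); last first.
  by apply: eq_Rintegral => t _; rewrite expr2.
apply: Rintegral_subset_ge0 => //; last by move=> t; exact: sqr_ge0.
by move=> t /=; rewrite !in_itv /= andbT => /andP[].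
Qed.

Let ip_split F x : 0 <= x ->
  ip F F = prim (fun t => val F t ^+ 2) x + \int[mu]_(t in `]x, +oo[) (val F t ^+ 2).
Proof.
move=> x0; have ig := (sqint_l2 F).2.
rewrite -[prim _ x]subr0 -(prim0 (fun t => val F t ^+ 2)) primB // l2ipE.
by rewrite -(Rintegral_split ig x0); apply: eq_Rintegral => t _; rewrite expr2.
Qed.

(* Phi = int F^2 - 4 x al^2 + 4 eta^2 be^2 / x - 16 eta^2 int G^2 is
   nonincreasing beyond T; the boundary term x al^2 is small along a sequence
   since F is square integrable. *)
Lemma solves_tail a F G T eta : solves a F G -> 1 <= T -> 0 <= eta ->
  (forall x, T <= x -> `|s x| * x <= eta) ->
  (forall x, T <= x -> 1 / 2 <= c x ^+ 2) ->
  \int[mu]_(t in `]T, +oo[) (val F t ^+ 2) <= 56 * eta ^+ 2 * (a ^+ 2 + ip G G).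
Proof.
move=> sFG T1 eta0 hs hc; have T0 : 0 < T by exact: lt_le_trans T1.
have ig := (sqint_l2 F).2.
apply/ler_addgt0Pl => e e0.
have e2 : 0 < e / 2 by rewrite divr_gt0.
(* The sampled term [X F^2] enters with the factor 16, so this costs at most [e / 2]. *)
have e32 : 0 < e / 32 by rewrite divr_gt0.
have [T' T'0 hT'] := half_line_tail ig (fun x => sqr_ge0 _) e2.
have [X [TX X0 FX hX]] := far_sample ig (fun x => sqr_ge0 _) sFG (Num.max T T') e32.
have {TX} [TX T'X] : T <= X /\ T' <= X by move: TX; rewrite ge_max => /andP[].
pose pF := prim (fun t => val F t ^+ 2); pose pG := prim (fun t => val G t ^+ 2).
pose A x := al a G x; pose B x := be a G x.
pose Phi x := pF x - 4 * (x * (A x * A x)) + 4 * eta ^+ 2 * ((B x * B x) * x^-1) - 16 * eta ^+ 2 * pG x.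
have main X' : T <= X' -> Phi X' <= Phi T.
  move=> TX'.
  have acA : abs_continuous T X' A by apply: ac_sub (sol_al_ac l ms s1 a G X') => //; exact: ltW.
  have acB' : abs_continuous T X' B by apply: ac_sub (sol_be_ac l mc c1 a G X') => //; exact: ltW.
  have acpF : abs_continuous T X' pF by apply: ac_sub (prim_ac X' (lsq F)) => //; exact: ltW.
  have acpG : abs_continuous T X' pG by apply: ac_sub (prim_ac X' (lsq G)) => //; exact: ltW.
  have acV : abs_continuous T X' (fun x : R => x^-1).
    apply: (@ac_lipschitz _ _ _ _ 1) => x y Tx xy yX; rewrite mul1r.
    have x1 : 1 <= x by exact: le_trans Tx.
    have y1 : 1 <= y by exact: le_trans xy.
    have x0 : 0 < x by exact: lt_le_trans x1.
    have y0 : 0 < y by exact: lt_le_trans y1.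
    have -> : y^-1 - x^-1 = - ((y - x) * (x^-1 * y^-1)) by field; rewrite !gt_eqF.
    have xy0 : 0 <= x^-1 * y^-1 by rewrite mulr_ge0 ?invr_ge0 ?ltW.
    have yx0 : 0 <= y - x by rewrite subr_ge0.
    rewrite normrN (ger0_norm (mulr_ge0 yx0 xy0)); apply: ler_piMr => //.
    by rewrite mulr_ile1 ?invr_ge0 ?(ltW x0) ?(ltW y0) ?invf_le1.
  apply: (@ac_nonincreasing _ T X' Phi) => //.
    apply: acB; last exact: acZ.
    apply: acD; last by apply: acZ; apply: acM => //; exact: acM.
    apply: acB => //; apply: acZ; apply: acM => //; [exact: ac_id | exact: acM].
  have E1 := ae_imp2 (fun x p q => conj p q) (sol_al_derive l ms s1 a G) (sol_be_derive l mc c1 a G).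
  have E2 := ae_imp2 (fun x p q => conj p q) (prim_derive (lsq F)) (prim_derive (lsq G)).
  have E3 := ae_imp2 (fun x p q => conj p q) E1 E2.
  apply: ae_imp2 sFG E3 => x q [[p1 p2] [p3 p4]] /andP[Tx xX'].
  have x0 : 0 < x by exact: lt_trans Tx.
  have {}p1 := p1 x0; have {}p2 := p2 x0; have {}p3 := p3 x0; have {}p4 := p4 x0; have {}q := q x0.
  rewrite -/A -/B -/pF -/pG in p1 p2 p3 p4.
  have xn0 : x != 0 by rewrite gt_eqF.
  have dV := is_deriveV xn0 (is_derive_id x 1).
  have d1 := is_deriveM (is_derive_id x 1) (is_deriveM p1 p1).
  have d2 := is_deriveM (is_deriveM p2 p2) dV.
  have dPhi := is_deriveB (is_deriveD (is_deriveB p3 (is_deriveZ 4 d1)) (is_deriveZ (4 * eta ^+ 2) d2)) (is_deriveZ (16 * eta ^+ 2) p4).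
  eexists; first exact: dPhi.
  rewrite /GRing.scale /= q /sol -[(al a G * al a G) x]/(A x * A x) -[(be a G * be a G) x]/(B x * B x) -/(A x) -/(B x).
  set g := val G x; set Ax := A x; set Bx := B x; set sx := s x; set cx := c x.
  have sx1 : (sx * x) ^+ 2 <= eta ^+ 2.
    by rewrite -(real_normK (num_real (sx * x))) normrM (gtr0_norm x0) ler_pXn2r ?nnegrE ?mulr_ge0 ?(ltW x0) // hs // ltW.
  have cx1 : cx ^+ 2 <= 1 by rewrite -(real_normK (num_real cx)) expr_le1 //; exact: c1.
  set w := Bx * x^-1.
  have -> : Bx = w * x by rewrite /w mulfVK.
  rewrite [X in X <= 0](_ : _ = (Ax * cx + w * (sx * x)) ^+ 2 - 4 * Ax ^+ 2 + 8 * Ax * (sx * x) * g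
     + eta ^+ 2 * (8 * w * cx * g) - 4 * (eta ^+ 2 * w ^+ 2) - 16 * (eta ^+ 2 * g ^+ 2)); last by field.
  exact: sum_of_squares_sign.
have hPhi := main X TX.
have split1 : \int[mu]_(t in `]T, +oo[) (val F t ^+ 2) =
    (pF X - pF T) + \int[mu]_(t in `]X, +oo[) (val F t ^+ 2).
  have := ip_split F (ltW T0); have := ip_split F (ltW X0); rewrite -/pF; lra.
have tailX : \int[mu]_(t in `]X, +oo[) (val F t ^+ 2) < e / 2.
  apply: le_lt_trans hT'; apply: Rintegral_subset_ge0 => //; last by move=> t; exact: sqr_ge0.
  by move=> t; rewrite /= !in_itv /= !andbT; exact: le_lt_trans.
have G1 : pG X - pG T <= ip G G.
  have := prim_sq_le G (ltW X0); have : 0 <= pG T.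
    by apply: Rintegral_ge0 => t _; exact: sqr_ge0.
  rewrite -/pG; lra.
have bT : B T * B T * T^-1 <= 2 * a ^+ 2 + 2 * ip G G.
  rewrite ler_pdivrMr // -expr2.
  have := sol_be_bound l mc c1 a G (ltW T0); rewrite -/(B T).
  have : a ^+ 2 <= a ^+ 2 * T by rewrite ler_peMr ?sqr_ge0.
  lra.
have bX : B X * B X * X^-1 <= 2 * a ^+ 2 + 2 * ip G G.
  rewrite ler_pdivrMr // -expr2.
  have := sol_be_bound l mc c1 a G (ltW X0); rewrite -/(B X).
  have : a ^+ 2 <= a ^+ 2 * X by rewrite ler_peMr ?sqr_ge0 // (le_trans T1).
  lra.
set wX := B X * B X * X^-1 in bX.
have wX0 : 0 <= wX by rewrite mulr_ge0 ?invr_ge0 ?(ltW X0) // -expr2 sqr_ge0.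
(* At the sample point [al] is recovered from [F = al c + be s], because [c^2 >= 1 / 2] and [s X] is
   at most [eta / X]. *)
have b3 : X * (A X * A X) <= 4 * (X * val F X ^+ 2) + 4 * (eta ^+ 2 * wX).
  have h1 : 1 / 2 <= c X ^+ 2 by exact: hc.
  have h2 : (s X * X) ^+ 2 <= eta ^+ 2.
    rewrite -(real_normK (num_real (s X * X))) normrM (gtr0_norm X0).
    by rewrite ler_pXn2r ?nnegrE ?mulr_ge0 ?(ltW X0) // hs.
  have h3 : X * (B X * s X) ^+ 2 <= eta ^+ 2 * wX.
    have -> : X * (B X * s X) ^+ 2 = (s X * X) ^+ 2 * wX by rewrite /wX; field; rewrite gt_eqF.
    by rewrite ler_wpM2r.
  have h4 : (A X * A X) <= 2 * (A X * c X) ^+ 2.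
    rewrite exprMn -expr2; have := ler_wpM2l (sqr_ge0 (A X)) h1; lra.
  have h5 : (A X * c X) ^+ 2 <= 2 * val F X ^+ 2 + 2 * (B X * s X) ^+ 2.
    have := sqr_ge0 (A X * c X + 2 * (B X * s X)); rewrite FX /sol -/(A X) -/(B X).
    rewrite !sqrrD; lra.
  have h6 : A X * A X <= 4 * val F X ^+ 2 + 4 * (B X * s X) ^+ 2 by lra.
  have := ler_wpM2l (ltW X0) h6; lra.
(* The constant 56 is [16 + 8 + 32]: from the integral of [G^2], from [4 be^2 / T], and from
   [16 be^2 / X] as left by [b3]; both quotients [be^2 / x] are at most [2 (a^2 + |G|^2)]. *)
have eta2 := sqr_ge0 eta.
have c2 := ler_wpM2l eta2 bT; have c3 := ler_wpM2l eta2 G1; have c4 := ler_wpM2l eta2 bX.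
have AT : 0 <= T * (A T * A T) by rewrite mulr_ge0 ?(ltW T0) // -expr2 sqr_ge0.
have c5 : 0 <= eta ^+ 2 * wX by rewrite mulr_ge0.
have c6 : 0 <= eta ^+ 2 * a ^+ 2 by rewrite mulr_ge0 ?sqr_ge0.
have c7 : 0 <= eta ^+ 2 * ip G G by rewrite mulr_ge0.
rewrite split1; move: hPhi; rewrite /Phi -/wX; move: c2 c3 c4 c5 c6 c7 AT b3 tailX hX.
move: (B T * B T * T^-1) (T * _) (X * (A X * A X)) (X * (val F X ^+ 2)) (\int[mu]_(t in `]X, +oo[) _).
clear bX wX0; move: wX (ip G G) (pG X) (pG T) (pF X) (pF T) => *; lra.
Qed.

(* al^2 + be^2 satisfies a Gronwall inequality when G = z F. *)
Lemma eigen_unique z F : solves 0 F (z *: F) -> `[F] = 0.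
Proof.
move=> h; apply/l2_null; pose G := z *: F; rewrite -/G in h.
have GF t : val G t = z * val F t by exact: l2valZ.
clearbody G.
pose A x := al 0 G x; pose B x := be 0 G x.
(* The rate comes from [2 z u v <= z^2 u^2 + v^2], where [u] and [v] are the seen and unseen
   coordinates, both with square at most [al^2 + be^2]. *)
pose k := 1 + z ^+ 2; have k0 : 0 < k by rewrite ltr_wpDr ?sqr_ge0.
pose M x := (A x * A x + B x * B x) * expR (- (k * x)).
suff M0 x : 0 < x -> M x <= 0.
  apply: ae_imp h => x q x0; rewrite q //.
  have := M0 x x0; rewrite /M pmulr_lle0 ?expR_gt0 // -!expr2 => h1.
  have := sol_sqr_le l cs1 0 G x0; rewrite -/(A x) -/(B x) => h2.
  by apply/eqP; rewrite -sqrf_eq0 eq_le sqr_ge0 andbT (le_trans h2).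
move=> x0; apply: (@le_trans _ _ (M 0)); last first.
  by rewrite /M /A /B sol_al0 sol_be0 !mul0r oppr0 !mul0r addr0 mul0r.
have acA := sol_al_ac l ms s1 0 G x; have acB' := sol_be_ac l mc c1 0 G x.
have ace : abs_continuous 0 x (fun y => expR (- (k * y))).
  apply: (@ac_lipschitz _ _ _ _ k) => y t y0 yt _.
  have e1 : expR (- (k * t)) <= expR (- (k * y)) by rewrite ler_expR lerN2 ler_pM2l.
  rewrite ler0_norm ?subr_le0 // opprB.
  have e2 : expR (- (k * t)) = expR (- (k * y)) * expR (- (k * (t - y))).
    by rewrite -expRD; congr expR; ring.
  have e3 : expR (- (k * y)) <= 1 by rewrite -expR0 ler_expR oppr_le0 mulr_ge0 // ltW.
  have e4 := expR_ge1Dx (- (k * (t - y))).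
  have e5 := expR_gt0 (- (k * y)).
  have e6 : 0 <= k * (t - y) by rewrite mulr_ge0 ?subr_ge0 // ltW.
  rewrite e2; nra.
apply: (@ac_nonincreasing _ 0 x M); first exact: ltW.
  apply: acM => //; first exact: ltW.
  by apply: acD; apply: acM => //; exact: ltW.
have E1 := ae_imp2 (fun x p q => conj p q) (sol_al_derive l ms s1 0 G) (sol_be_derive l mc c1 0 G).
apply: ae_imp2 h E1 => y q [p1 p2] /andP[y0 _].
have {}p1 := p1 y0; have {}p2 := p2 y0; have {}q := q y0; rewrite -/A -/B in p1 p2.
have dk : is_derive y 1 (fun y => - (k * y)) (- (k * 1)).
  exact: is_deriveN (is_deriveZ k (is_derive_id y 1)).
have de : is_derive y 1 (fun y => expR (- (k * y))) (expR (- (k * y)) * (- (k * 1))).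
  exact: (@is_derive1_comp _ expR (fun y => - (k * y)) y _ _ (is_derive_expR _) dk).
have dM := is_deriveM (is_deriveD (is_deriveM p1 p1) (is_deriveM p2 p2)) de.
eexists; first exact: dM.
rewrite /GRing.scale /=.
rewrite -[(A * A + B * B) y]/(A y * A y + B y * B y) -/(A y) -/(B y).
have Gy : val G y = z * (A y * c y + B y * s y) by rewrite GF q.
rewrite Gy; set u := A y * c y + B y * s y.
have u2 : u ^+ 2 <= A y ^+ 2 + B y ^+ 2 by exact: (sol_sqr_le l cs1 0 G y0).
have e5 := expR_gt0 (- (k * y)); set ex := expR (- (k * y)) in e5 *.
rewrite [X in X <= 0](_ : _ = ex * (2 * (z * u) * (B y * c y - A y * s y) - k * (A y ^+ 2 + B y ^+ 2))); last by ring.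
rewrite pmulr_rle0 //.
have v2 : (B y * c y - A y * s y) ^+ 2 <= A y ^+ 2 + B y ^+ 2.
  by have := sol_sqr l cs1 0 G y0; have := sqr_ge0 u; rewrite /u /A /B /sol; lra.
have zu : (z * u) ^+ 2 <= z ^+ 2 * (A y ^+ 2 + B y ^+ 2) by rewrite exprMn ler_wpM2l ?sqr_ge0.
have := sqr_ge0 (z * u - (B y * c y - A y * s y)); rewrite sqrrB /k; lra.
Qed.

(** When [c] and [s] come from [phi - l], the coefficient [cos l * c x - sin l * s x] is
    [cos (phi x)], and [F = a cos phi + P c + Q s] with [P], [Q] the increments of [al], [be] from
    0. Where the cosine stays away from 0, one sample of [F] therefore bounds [a]. *)
Lemma initial_bound p q k : 0 <= p -> p < q -> 0 < k ->
  (forall x, p < x < q -> k <= (cos l * c x - sin l * s x) ^+ 2) ->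
  exists2 C, 0 < C & forall a F G, solves a F G -> a ^+ 2 <= C * (ip F F + ip G G).
Proof.
move=> p0 pq k0 hk; have qp : 0 < q - p by rewrite subr_gt0.
have q0 : 0 < q by exact: le_lt_trans pq.
exists ((2 / (q - p) + 4 * q) / k).
  by rewrite divr_gt0 // addr_gt0 ?divr_gt0 ?mulr_gt0.
move=> a F G h.
have [x [/andP[px xq] Fx hx]] := interval_sample p0 pq (sqint_l2 F).2 (fun x => sqr_ge0 _) h.
have x0 : 0 < x by exact: le_lt_trans px.
have hF : val F x ^+ 2 <= ip F F / (q - p).
  rewrite ler_pdivlMr //; apply: le_trans hx _.
  rewrite l2ipE (_ : \int[mu]_(t in D) _ = \int[mu]_(t in D) (val F t ^+ 2)); last first.
    by apply: eq_Rintegral => t _; rewrite expr2.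
  apply: Rintegral_subset_ge0 => //; [|exact: (sqint_l2 F).2|by move=> t; exact: sqr_ge0].
  by move=> t /=; rewrite !in_itv /= andbT => /andP[pt _]; exact: le_lt_trans pt.
have hP := sol_al_holder l ms s1 a G (lexx 0) (ltW x0).
have hQ := sol_be_holder l mc c1 a G (lexx 0) (ltW x0).
rewrite sol_al0 subr0 in hP; rewrite sol_be0 subr0 in hQ.
set P := al a G x - a * cos l in hP; set Q := be a G x - - (a * sin l) in hQ.
have e1 : val F x = a * (cos l * c x - sin l * s x) + (P * c x + Q * s x).
  by rewrite Fx /sol /P /Q; ring.
have PQ : (P * c x + Q * s x) ^+ 2 <= P ^+ 2 + Q ^+ 2.
  rewrite -[leRHS]mulr1 -(cs1 x0).
  have := sqr_ge0 (P * s x - Q * c x); rewrite sqrrB sqrrD !exprMn; lra.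
have xN : x * ip G G <= q * ip G G by rewrite ler_wpM2r // ltW.
rewrite mulrAC ler_pdivlMr //.
apply: (@le_trans _ _ ((a * (cos l * c x - sin l * s x)) ^+ 2)).
  by rewrite exprMn ler_wpM2l ?sqr_ge0 // hk // px.
have h5 : (a * (cos l * c x - sin l * s x)) ^+ 2 <= 2 * val F x ^+ 2 + 2 * (P * c x + Q * s x) ^+ 2.
  have := sqr_ge0 (a * (cos l * c x - sin l * s x) + 2 * (P * c x + Q * s x)).
  rewrite e1 !sqrrD; lra.
have h6 : 0 <= 2 / (q - p) * ip G G by rewrite mulr_ge0 // divr_ge0 // ltW.
have h7 : 0 <= q * ip F F by rewrite mulr_ge0 // ltW.
have h8 : 2 * val F x ^+ 2 <= 2 / (q - p) * ip F F by rewrite mulrAC -mulrA ler_pM2l.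
rewrite mulrDl mulrDr -!mulrA !mulrDr !mulrA; lra.
Qed.

End SolutionEstimates.

(** * Compactness of solutions bounded in the graph norm *)

Section Compactness.
Variable R : realType.
Local Notation mu := (@lebesgue_measure R).
Local Notation D := (`]0, +oo[%classic : set R).
Local Notation ip := (@l2ip R).
Local Notation "`[ x ]" := (inorm ip x) (format "`[ x ]").
Let sip := @l2_semi_inner R.
Implicit Types (a x y : R).

(** Pigeonhole: finitely many intervals cover [[-M, M]] and an ultrafilter selects one. A single
    ultrafilter serves all grid points at once, which replaces repeated extraction of
    subsequences. *)
Lemma ultra_bounded (U : set_system nat) (u : nat -> R) M d : UltraFilter U ->
  (forall n, `|u n| <= M) -> 0 < d -> exists L, U [set n | `|u n - L| < d].
Proof.
move=> UU uM d0; apply: contrapT => /forallNP h.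
pose K := (Num.truncn (2 * M / d)).+1.
pose L (i : nat) := - M + i%:R * d.
have hc : \forall n \near U, forall i : 'I_K, ~ `|u n - L i| < d.
  apply: filter_forall => i.
  by case: (in_ultra_setVsetC [set n | `|u n - L i| < d] UU) => [/h []|hh]; exact: hh.
have [n hn] := filter_ex hc.
have M0 : 0 <= M by apply: le_trans (uM 0%N).
have := uM n; rewrite ler_norml => /andP[h1 h2].
have q0 : 0 <= (u n + M) / d by rewrite divr_ge0 ?(ltW d0) //; lra.
have /andP[t1 t2] := truncn_itv q0.
have iK : (Num.truncn ((u n + M) / d) < K)%N.
  rewrite ltnS; apply: le_truncn; rewrite ler_pM2r ?invr_gt0 //; lra.
apply: (hn (Ordinal iK)); rewrite /L /=.
move: t1 t2; rewrite ler_pdivlMr // ltr_pdivrMr //.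
set j := Num.truncn _; have -> : j.+1%:R = j%:R + 1 :> R by rewrite natr1.
rewrite mulrDl mul1r => t1 t2.
by rewrite ger0_norm; lra.
Qed.

Variables (c s : R -> R) (l : R).
Hypotheses (mc : measurable_fun setT c) (ms : measurable_fun setT s).
Hypotheses (c1 : forall x, `|c x| <= 1) (s1 : forall x, `|s x| <= 1).
Hypothesis cs1 : forall x, 0 < x -> c x ^+ 2 + s x ^+ 2 = 1.

Local Notation al := (sol_al s l).
Local Notation be := (sol_be c l).
Local Notation solves := (solves c s l).
Let ip0 (G : l2fun R) : 0 <= ip G G. Proof. exact: (ip_ge0 sip). Qed.

Lemma solves_head a (F G : l2fun R) X C : solves a F G -> 0 <= X ->
  (forall x, 0 < x -> x < X -> al a G x ^+ 2 + be a G x ^+ 2 <= C) ->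
  \int[mu]_(t in `]0, X]) (val F t ^+ 2) <= C * X.
Proof.
move=> h X0 hC.
have lF : locint (fun t => val F t ^+ 2) by apply: locint_integrable; case: (sqint_l2 F).
rewrite -primB // prim0 subr0.
pose Phi x := prim (fun t => val F t ^+ 2) x - C * x.
have : Phi X <= Phi 0; last by rewrite /Phi prim0 mulr0 subr0; lra.
apply: (@ac_nonincreasing _ 0 X Phi) => //.
  by apply: acB; [exact: prim_ac | apply: acZ; exact: ac_id].
apply: ae_imp2 h (prim_derive lF) => x q p /andP[x0 xX].
have {}p := p x0; have dPhi := is_deriveB p (is_deriveZ C (is_derive_id x 1)).
eexists; first exact: dPhi.
rewrite /GRing.scale /= mulr1 subr_le0 q //.
exact: le_trans (sol_sqr_le l cs1 a G x0) (hC _ x0 xX).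
Qed.

Hypothesis vanish : forall eta, 0 < eta -> exists2 T, 1 <= T &
  forall x, T <= x -> `|s x| * x <= eta /\ 1 / 2 <= c x ^+ 2.

(** The part beyond [T] is uniformly small by [solves_tail]. On [[0, T]] the functions [al] and [be]
    are uniformly equicontinuous, so comparing them on a finite grid is enough. *)
Lemma solves_compact (a : nat -> R) (F G : nat -> l2fun R) A B :
  (forall n, solves (a n) (F n) (G n)) -> (forall n, a n ^+ 2 <= A) ->
  (forall n, ip (G n) (G n) <= B) ->
  exists2 k : nat -> nat, (forall n, (n <= k n)%N) & icauchy ip (F \o k).
Proof.
move=> h aA GB.
have A0 : 0 <= A by apply: le_trans (aA 0%N); exact: sqr_ge0.
have B0 : 0 <= B by exact: le_trans (GB 0%N).
have [U [UU Uoo]] := @ultraFilterLemma nat \oo _.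
have GBd m n : ip (G m - G n) (G m - G n) <= 4 * B.
  have := ip0 (G m + G n); have := GB m; have := GB n.
  rewrite !(ipDl sip) !(ipDr sip) !(ipNl sip) !(ipNr sip) (ipC sip (G n) (G m)); lra.
have aAd m n : (a m - a n) ^+ 2 <= 4 * A.
  have := sqr_ge0 (a m + a n); have := aA m; have := aA n; rewrite sqrrB sqrrD; lra.
have hd m n : solves (a m - a n) (F m - F n) (G m - G n) by exact: solvesB.
have main e : 0 < e -> exists2 W, U W & forall m n, W m -> W n -> ip (F m - F n) (F m - F n) <= e.
  move=> e0.
  (* Differences of members have data bounded by [4 A] and [4 B]; this choice makes their tail bound
     [56 * eta2 * (4 A + 4 B)] at most [e / 2]. *)
  pose eta2 := e / (2 * 56 * (4 * A + 4 * B + 1)).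
  have eta20 : 0 < eta2 by rewrite divr_gt0 // !mulr_gt0 //; lra.
  have [T T1 hT] := vanish (eta := Num.sqrt eta2) ltac:(by rewrite sqrtr_gt0).
  have T0 : 0 < T by exact: lt_le_trans T1.
  pose d := Num.min 1 (e / (64 * T)).
  have d0 : 0 < d by rewrite lt_min ltr01 divr_gt0 ?mulr_gt0.
  have d1 : d ^+ 2 * (64 * T) <= e.
    rewrite -ler_pdivlMr ?mulr_gt0 //; apply: le_trans (_ : d <= _); last by rewrite ge_min lexx orbT.
    by rewrite expr2 ler_piMr ?(ltW d0) // ge_min lexx.
  pose K := (Num.truncn (64 * T * T * (B + 1) / e)).+1.
  have K0 : 0 < K%:R :> R by rewrite ltr0n.
  pose st := T / K%:R.
  have st0 : 0 < st by rewrite divr_gt0.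
  have stB : st * B * (64 * T) <= e.
    have KT : 64 * T * T * (B + 1) / e < K%:R by exact: truncnS_gt.
    move: KT; rewrite ltr_pdivrMr // => KT.
    have -> : st * B * (64 * T) = 64 * T * T * B / K%:R by rewrite /st; field; rewrite gt_eqF.
    rewrite ler_pdivrMr //; have : 0 <= T * T by rewrite mulr_ge0 ?ltW.
    move: KT; lra.
  have Mb n x : 0 <= x -> x <= T -> al (a n) (G n) x ^+ 2 <= 2 * A + 2 * T * B /\
      be (a n) (G n) x ^+ 2 <= 2 * A + 2 * T * B.
    move=> x0 xT.
    have h1 := sol_al_bound l ms s1 (a n) (G n) x0; have h2 := sol_be_bound l mc c1 (a n) (G n) x0.
    have h3 : x * ip (G n) (G n) <= T * B by rewrite ler_pM.
    have := aA n; split; lra.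
  pose Mx := 2 * A + 2 * T * B + 1.
  have absM y : y ^+ 2 <= 2 * A + 2 * T * B -> `|y| <= Mx.
    move=> hy; have TB : 0 <= T * B by rewrite mulr_ge0 // ltW.
    have := sqr_ge0 (`|y| - 1); rewrite sqrrB real_normK ?num_real // /Mx.
    have := normr_ge0 y; lra.
  have grid (i : 'I_K.+1) : 0 <= i%:R * st <= T.
    rewrite mulr_ge0 ?(ltW st0) //= /st mulrA ler_pdivrMr // mulrC ler_pM2l // ler_nat.
    by rewrite -ltnS.
  have hal i : exists La, U [set n | `|al (a n) (G n) ((i : 'I_K.+1)%:R * st) - La| < d / 2].
    have /andP[g0 gT] := grid i.
    apply: (ultra_bounded (M := Mx)) => //; last by rewrite divr_gt0.
    by move=> n; apply: absM; have [] := Mb n _ g0 gT.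
  have hbe i : exists Lb, U [set n | `|be (a n) (G n) ((i : 'I_K.+1)%:R * st) - Lb| < d / 2].
    have /andP[g0 gT] := grid i.
    apply: (ultra_bounded (M := Mx)) => //; last by rewrite divr_gt0.
    by move=> n; apply: absM; have [] := Mb n _ g0 gT.
  have [La hLa] := choice hal; have [Lb hLb] := choice hbe.
  exists ([set n | forall i : 'I_K.+1, `|al (a n) (G n) (i%:R * st) - La i| < d / 2] `&`
          [set n | forall i : 'I_K.+1, `|be (a n) (G n) (i%:R * st) - Lb i| < d / 2]).
    by apply: filterI; apply: filter_forall.
  move=> m n [ma mb] [na nb].
  have iF := (sqint_l2 (F m - F n)).2.
  rewrite l2ipE (_ : \int[mu]_(t in D) _ = \int[mu]_(t in D) (val (F m - F n) t ^+ 2)); last first.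
    by apply: eq_Rintegral => t _; rewrite expr2.
  rewrite (Rintegral_split iF (ltW T0)) [leRHS]splitr; apply: lerD; last first.
    apply: le_trans (solves_tail mc ms c1 s1 (hd m n) T1 (sqrtr_ge0 eta2) _ _) _.
    - by move=> x /hT[].
    - by move=> x /hT[].
    rewrite sqr_sqrtr ?(ltW eta20) //.
    have h1 : (a m - a n) ^+ 2 + ip (G m - G n) (G m - G n) <= 4 * A + 4 * B + 1.
      have := aAd m n; have := GBd m n; lra.
    have AB0 : 0 < 4 * A + 4 * B + 1 by lra.
    have h2 := ler_wpM2l (ltW eta20) h1.
    have h3 : eta2 * (4 * A + 4 * B + 1) = e / (2 * 56) by rewrite /eta2; field; rewrite gt_eqF.
    rewrite h3 in h2; rewrite -mulrA; lra.
  (* Grid error plus Cauchy-Schwarz error between grid points, for [al] and [be] together; the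
     choices of [d] and [K] give [C * T <= e / 2]. *)
  pose C := 16 * (d ^+ 2 + st * B).
  apply: (@le_trans _ _ (C * T)); last by rewrite /C; lra.
  apply: (solves_head (hd m n) (ltW T0)) => x x0 xT.
  have q0 : 0 <= x / st by rewrite divr_ge0 ?ltW.
  have /andP[t1 t2] := truncn_itv q0.
  set i := Num.truncn (x / st) in t1 t2.
  have iK : (i < K.+1)%N.
    rewrite ltnS -(ler_nat R); apply: le_trans t1 _.
    by rewrite ler_pdivrMr // /st mulrC divfK ?gt_eqF // ltW.
  move: t1 t2; rewrite ler_pdivlMr // ltr_pdivrMr //.
  have -> : i.+1%:R = i%:R + 1 :> R by rewrite natr1.
  rewrite mulrDl mul1r => t1 t2.
  have i0 : 0 <= i%:R * st by rewrite mulr_ge0 // ltW.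
  have key (f1 f2 : R) La' : `|f1 - La'| < d / 2 -> `|f2 - La'| < d / 2 -> (f1 - f2) ^+ 2 <= d ^+ 2.
    rewrite !ltr_norml => /andP[? ?] /andP[? ?].
    rewrite -(real_normK (num_real (f1 - f2))) ler_pXn2r ?nnegrE ?(ltW d0) //.
    by rewrite ler_norml; apply/andP; split; lra.
  have ka := key _ _ _ (ma (Ordinal iK)) (na (Ordinal iK)).
  have kb := key _ _ _ (mb (Ordinal iK)) (nb (Ordinal iK)).
  rewrite /= in ka kb.
  have ala y : al (a m - a n) (G m - G n) y = al (a m) (G m) y - al (a n) (G n) y.
    have := sol_alD l ms s1 (-1) (a n) (a m) (G n) (G m) y.
    by rewrite !scaleN1r mulN1r ![- _ + _]addrC mulN1r => ->; rewrite addrC.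
  have bea y : be (a m - a n) (G m - G n) y = be (a m) (G m) y - be (a n) (G n) y.
    have := sol_beD l mc c1 (-1) (a n) (a m) (G n) (G m) y.
    by rewrite !scaleN1r mulN1r ![- _ + _]addrC mulN1r => ->; rewrite addrC.
  rewrite -ala in ka; rewrite -bea in kb.
  have ha := sol_al_holder l ms s1 (a m - a n) (G m - G n) i0 t1.
  have hb := sol_be_holder l mc c1 (a m - a n) (G m - G n) i0 t1.
  have hst : (x - i%:R * st) * ip (G m - G n) (G m - G n) <= st * (4 * B).
    by apply: ler_pM => //; [rewrite subr_ge0 | lra].
  have sqs (f1 f2 : R) : f1 ^+ 2 <= 2 * f2 ^+ 2 + 2 * (f1 - f2) ^+ 2.
    by have := sqr_ge0 (f1 - 2 * f2); lra.
  set p := al _ _ x in ha *; set q := be _ _ x in hb *.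
  set p' := al _ _ _ in ha ka; set q' := be _ _ _ in hb kb.
  have hp := sqs p p'; have hq := sqs q q'.
  have := sqr_ge0 d; rewrite /C; lra.
have d0 (j : nat) : 0 < j.+1%:R^-1 :> R by rewrite invr_gt0.
have /choice[W hW] j : exists W, U W /\ forall m n, W m -> W n -> ip (F m - F n) (F m - F n) <= j.+1%:R^-1.
  by have [W UW hW] := main _ (d0 j); exists W.
(* [k j] lies in each of [W 0] up to [W j], so [W N] contains every [k j] with [j >= N]. *)
have /choice[k hk] j : exists n, (j <= n)%N /\ forall i : 'I_j.+1, W i n.
  have U1 : U [set n | (j <= n)%N] by apply: Uoo; exists j.
  have U2 : \forall n \near U, forall i : 'I_j.+1, W i n.
    by apply: filter_forall => i; have [] := hW i.
  by have [n [n1 n2]] := filter_ex (filterI U1 U2); exists n.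
exists k => [n|e e0]; first by have [] := hk n.
have [N _ hN] := near_infty_natSinv_lt (PosNum (exprn_gt0 2 e0)).
exists N => m n Nm Nn /=.
rewrite -(ltr_pXn2r (n := 2)) ?nnegrE ?inorm_ge0 ?(ltW e0) // (inorm_sqr sip).
apply: le_lt_trans (hN N (leqnn N)); have [_ hWN] := hW N.
have Wk j : (N <= j)%N -> W N (k j).
  by move=> Nj; have [_ /(_ (Ordinal (Nj : (N < j.+1)%N)))] := hk j.
exact: hWN (Wk _ Nm) (Wk _ Nn).
Qed.

End Compactness.

(** * Test functions living far away *)

Section TestFunctions.
Variable R : realType.
Local Notation mu := (@lebesgue_measure R).
Local Notation D := (`]0, +oo[%classic : set R).
Local Notation ip := (@l2ip R).
Local Notation "`[ x ]" := (inorm ip x) (format "`[ x ]").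
Let sip := @l2_semi_inner R.
Implicit Types (a x y p q : R).

Lemma sqint_indic p q : sqint (\1_(`]p, q]) : R -> R).
Proof.
split; first by apply: measurable_indic; exact: measurable_itv.
rewrite (_ : _ \o _ = EFin \o \1_(`]p, q])); first exact: (integrable_indic_itv p q false false).
by apply/funext => t /=; rewrite indicE; case: (_ \in _); rewrite ?expr1n ?expr0n.
Qed.

Definition l2indic p q : l2fun R := Subset_lmod (@sqint_linear R) (sqint_indic p q).

Lemma l2indic_ip p q : 0 <= p -> p <= q -> ip (l2indic p q) (l2indic p q) = q - p.
Proof.
move=> p0 pq; rewrite l2ipE /=.
have mI : measurable (`]p, q]%classic : set (measurableTypeR R)) by exact: measurable_itv.
have muI : mu (`]p, q]%classic : set R) = (q - p)%:E.
  by rewrite lebesgue_measure_itv /= lte_fin; case: ltgtP pq => // ->; rewrite subrr.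
rewrite -[RHS]mul1r -(Rintegral_cst_on 1 mI muI) [LHS]Rintegral_mkcond [RHS]Rintegral_mkcond.
apply: eq_Rintegral => t _; rewrite !patchE indicE.
case: ifPn => tD; case: ifPn => // tI; rewrite ?mulr1 ?mulr0 //.
exfalso; move/negP: tD; apply; move: tI; rewrite !inE /= !in_itv /= andbT.
by move=> /andP[pt _]; exact: le_lt_trans pt.
Qed.

Definition clamp p q x := Num.min q (Num.max p x).

Lemma prim_l2indic (m : R -> R) p q x : locint m -> 0 <= p -> p <= q -> 0 <= x ->
  prim (fun t => m t * val (l2indic p q) t) x = prim m (clamp p q x) - prim m p.
Proof.
move=> lm p0 pq x0; rewrite /prim /=.
have pc : p <= clamp p q x by rewrite le_min pq le_max lexx.
rewrite -/(prim m (clamp p q x)) -/(prim m p) primB // [LHS]Rintegral_mkcond [RHS]Rintegral_mkcond.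
apply: eq_Rintegral => t _; rewrite !patchE indicE !mem_setE !in_itv /= /clamp le_min le_max.
have pt0 : (point : R) = 0 by [].
case: (ltP p t) => [pt|tp] /=; last by rewrite mulr0 pt0 if_same.
have t0 : 0 <= t by exact: ltW (le_lt_trans p0 pt).
rewrite t0 pt0 /= andbC.
by case: (t <= x) => /=; case: (t <= q); rewrite ?mulr1 ?mulr0.
Qed.

Lemma prim_neg (m : R -> R) x : x <= 0 -> prim m x = 0.
Proof.
rewrite le_eqVlt => /predU1P[->|x0]; first exact: prim0.
by rewrite /prim set_itv_ge ?Rintegral_set0 // bnd_simp -ltNge.
Qed.

Lemma prim_continuous (m : R -> R) : locint m -> continuous (prim m).
Proof.
move=> lm x; apply/cvgrPdist_lt => e e0.
have [d d0 hd] := ac_modulus (prim_ac (`|x| + 1) lm) e0.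
have pmax y : prim m y = prim m (Num.max 0 y).
  by case: (leP 0 y) => // y0; rewrite prim0 prim_neg // ltW.
near=> y; rewrite (pmax x) (pmax y).
have yx : `|x - y| < d by near: y; apply: cvgr_dist_lt.
have y1 : `|x - y| < 1 by near: y; apply: cvgr_dist_lt.
have xM : Num.max 0 x <= `|x| + 1.
  by rewrite ge_max addr_ge0 //= (le_trans (ler_norm x)) // lerDl.
have yM : Num.max 0 y <= `|x| + 1.
  rewrite ge_max addr_ge0 //=; have := ler_norm (y - x); rewrite distrC; have := ler_norm x; lra.
have dmax : `|Num.max 0 x - Num.max 0 y| <= `|x - y|.
  have := ler_norm (x - y); have := ler_norm (y - x); rewrite (distrC y x) => h1 h2.
  rewrite ler_norml; case: (leP 0 x) => hx; case: (leP 0 y) => hy; apply/andP; split; lra.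
case: (leP (Num.max 0 x) (Num.max 0 y)) => hxy.
  rewrite distrC; apply: hd => //; first by rewrite le_max lexx.
  by apply: le_lt_trans yx; apply: le_trans dmax; rewrite distrC ler_norm.
apply: hd => //; [by rewrite le_max lexx | exact: ltW |].
by apply: le_lt_trans yx; apply: le_trans dmax; rewrite ler_norm.
Unshelve. all: by end_near. Qed.

Variables (c s : R -> R) (l : R).
Hypotheses (mc : measurable_fun setT c) (ms : measurable_fun setT s).
Hypotheses (c1 : forall x, `|c x| <= 1) (s1 : forall x, `|s x| <= 1).
Hypothesis cs1 : forall x, 0 < x -> c x ^+ 2 + s x ^+ 2 = 1.

Local Notation al := (sol_al s l 0).
Local Notation be := (sol_be c l 0).
Let solv := (solves c s l).
Let ip0 (G : l2fun R) : 0 <= ip G G. Proof. exact: (ip_ge0 sip). Qed.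

Let lbd (m : R -> R) : measurable_fun setT m -> (forall x, `|m x| <= 1) -> locint m.
Proof.
move=> mm m1; split => // b; apply: measurable_bounded_integrable.
- exact: measurable_itv.
- by rewrite /= lebesgue_measure_itv /=; case: ifP => // _; rewrite -EFinD ltry.
- exact: measurable_funTS.
- by exists 1; split; [exact: num_real | move=> M M1 x _; exact: le_trans (m1 x) (ltW M1)].
Qed.
Let lc : locint c. Proof. exact: lbd. Qed.
Let ls : locint s. Proof. exact: lbd. Qed.

Lemma compact_sol_sqint (G : l2fun R) Q : 0 <= Q -> sqint ((sol c s l 0 G) \_ (`]0, Q])).
Proof.
move=> Q0.
have mI : measurable (`]0, Q]%classic : set (measurableTypeR R)) by exact: measurable_itv.
have msol : measurable_fun setT (sol c s l 0 G).
  apply: measurable_funD; apply: measurable_funM => //.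
    apply: measurable_funB => //; apply: continuous_measurable_fun.
    by apply: prim_continuous; exact: locint_bmul.
  apply: measurable_funD => //; apply: continuous_measurable_fun.
  by apply: prim_continuous; exact: locint_bmul.
pose C := 4 * Q * ip G G.
have C0 : 0 <= C by rewrite !mulr_ge0.
pose f : l2fun R := Num.sqrt C *: l2indic 0 Q.
apply: (@sqint_le _ _ (val f)); last 2 first.
- exact: sqint_l2.
- move=> x; rewrite /f l2valZ /= indicE patchE mem_setE.
  case: ifPn => xI; last by rewrite normr0.
  rewrite mulr1 (ger0_norm (sqrtr_ge0 _)) -(ler_pXn2r (n := 2)) ?nnegrE ?sqrtr_ge0 //.
  rewrite sqr_sqrtr // real_normK ?num_real //.
  move: xI; rewrite in_itv /= => /andP[x0 xQ].
  apply: le_trans (sol_sqr_le l cs1 0 G x0) _.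
  have h1 := sol_al_bound l ms s1 0 G (ltW x0); have h2 := sol_be_bound l mc c1 0 G (ltW x0).
  have h3 : x * ip G G <= Q * ip G G by rewrite ler_wpM2r.
  rewrite expr0n /= in h1 h2; rewrite /C; lra.
- by apply/(measurable_restrictT _ mI); exact: measurable_funTS.
Qed.

(* The coefficient makes [be] vanish to the right of both intervals. *)
Definition gadget p q p' q' : l2fun R :=
  l2indic p q - ((prim c q - prim c p) / (prim c q' - prim c p')) *: l2indic p' q'.

(** With [be] back at 0, the gadget leaves [al] at minus this value. It has to be cancelled by
    another gadget, since far away [e_l] is nearly the direction seen by [H]. *)
Definition gadget_mass p q p' q' := (prim s q - prim s p) -
  (prim c q - prim c p) / (prim c q' - prim c p') * (prim s q' - prim s p').

Section Gadget.
Variables p q p' q' : R.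
Hypotheses (p0 : 0 <= p) (pq : p <= q) (qp' : q <= p') (pq' : p' <= q').
Let p'0 : 0 <= p'. Proof. exact: le_trans (le_trans p0 pq) qp'. Qed.
Let k := (prim c q - prim c p) / (prim c q' - prim c p').
Let g := gadget p q p' q'.

Lemma gadget_al x : 0 <= x -> al g x = - ((prim s (clamp p q x) - prim s p) -
  k * (prim s (clamp p' q' x) - prim s p')).
Proof.
move=> x0; have e : g = (- k) *: l2indic p' q' + l2indic p q.
  by rewrite /g /gadget scaleNr addrC.
have := sol_alD l ms s1 (- k) 0 0 (l2indic p' q') (l2indic p q) x.
rewrite -e mulr0 addr0 => ->.
by rewrite /sol_al !mul0r !sub0r !prim_l2indic //; ring.
Qed.

Lemma gadget_be x : 0 <= x -> be g x = (prim c (clamp p q x) - prim c p) -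
  k * (prim c (clamp p' q' x) - prim c p').
Proof.
move=> x0; have e : g = (- k) *: l2indic p' q' + l2indic p q.
  by rewrite /g /gadget scaleNr addrC.
have := sol_beD l mc c1 (- k) 0 0 (l2indic p' q') (l2indic p q) x.
rewrite -e mulr0 addr0 => ->.
by rewrite /sol_be !mul0r !oppr0 !add0r !prim_l2indic //; ring.
Qed.

Let clampl u v x : u <= v -> x <= u -> clamp u v x = u.
Proof. by move=> uv xu; rewrite /clamp max_l // min_r. Qed.
Let clampr u v x : u <= v -> v <= x -> clamp u v x = v.
Proof. by move=> uv vx; rewrite /clamp max_r ?min_l // (le_trans uv). Qed.

Lemma gadget_before x : 0 <= x -> x <= p -> al g x = 0 /\ be g x = 0.
Proof.
move=> x0 xp; have xp' : x <= p' by rewrite (le_trans xp) // (le_trans pq).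
by rewrite gadget_al // gadget_be // !clampl // !subrr mulr0 subrr oppr0.
Qed.

Lemma gadget_between x : q <= x -> x <= p' ->
  al g x = - (prim s q - prim s p) /\ be g x = prim c q - prim c p.
Proof.
move=> qx xp'; have x0 : 0 <= x by rewrite (le_trans p0) // (le_trans pq).
by rewrite gadget_al // gadget_be // (clampr pq qx) (clampl pq' xp') !subrr mulr0 !subr0.
Qed.

Lemma gadget_after x : prim c q' - prim c p' != 0 -> q' <= x ->
  al g x = - gadget_mass p q p' q' /\ be g x = 0.
Proof.
move=> nz q'x; have qx : q <= x by rewrite (le_trans qp') // (le_trans pq').
have x0 : 0 <= x by rewrite (le_trans p0) // (le_trans pq).
rewrite gadget_al // gadget_be // (clampr pq qx) (clampr pq' q'x); split => //.
by rewrite /k divfK // subrr.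
Qed.

Lemma gadget_ip : ip g g <= 2 * (q - p) + 2 * (k ^+ 2 * (q' - p')).
Proof.
have h1 := l2indic_ip p0 pq; have h2 := l2indic_ip p'0 pq'.
have := ip0 (l2indic p q + k *: l2indic p' q').
rewrite /g /gadget -/k !(ipDl sip) !(ipDr sip) !(ipNl sip) !(ipNr sip) !(ipZl sip) !(ipZr sip) h1 h2.
set z1 := ip _ _; set z2 := ip _ _; lra.
Qed.

End Gadget.

Let prim_ge_cst (m : R -> R) (u v k : R) : locint m -> 0 <= u -> u <= v ->
  (forall t : R, u < t -> t <= v -> k <= m t) -> k * (v - u) <= prim m v - prim m u.
Proof.
move=> lm u0 uv hk; rewrite primB //.
have mI : measurable (`]u, v]%classic : set (measurableTypeR R)) by exact: measurable_itv.
have muI : mu (`]u, v]%classic : set R) = (v - u)%:E.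
  by rewrite lebesgue_measure_itv /= lte_fin; case: ltgtP uv => // ->; rewrite subrr.
rewrite -(Rintegral_cst_on k mI muI); apply: le_Rintegral => //.
- by apply: integrable_cst_on; rewrite // muI ltry.
- exact: locint_itvoc.
- by move=> t; rewrite /= in_itv /= => /andP[ut tv]; exact: hk.
Qed.

Let prim_le_cst (m : R -> R) (u v k : R) : locint m -> 0 <= u -> u <= v ->
  (forall t : R, u < t -> t <= v -> m t <= k) -> prim m v - prim m u <= k * (v - u).
Proof.
move=> lm u0 uv hk; rewrite primB //.
have mI : measurable (`]u, v]%classic : set (measurableTypeR R)) by exact: measurable_itv.
have muI : mu (`]u, v]%classic : set R) = (v - u)%:E.
  by rewrite lebesgue_measure_itv /= lte_fin; case: ltgtP uv => // ->; rewrite subrr.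
rewrite -(Rintegral_cst_on k mI muI); apply: le_Rintegral => //.
- exact: locint_itvoc.
- by apply: integrable_cst_on; rewrite // muI ltry.
- by move=> t; rewrite /= in_itv /= => /andP[ut tv]; exact: hk.
Qed.

Let ip_lower (F : l2fun R) (u v k : R) : 0 <= u -> u <= v ->
  (forall x, u < x -> x <= v -> k <= val F x ^+ 2) -> k * (v - u) <= ip F F.
Proof.
move=> u0 uv hk; have lF : locint (fun t => val F t ^+ 2).
  by apply: locint_integrable; case: (sqint_l2 F).
apply: le_trans (prim_ge_cst lF u0 uv hk) _; rewrite primB // l2ipE.
rewrite (_ : \int[mu]_(t in D) _ = \int[mu]_(t in D) (val F t ^+ 2)); last first.
  by apply: eq_Rintegral => t _; rewrite expr2.
apply: Rintegral_subset_ge0 => //; [|exact: (sqint_l2 F).2|by move=> t; exact: sqr_ge0].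
by move=> t /=; rewrite !in_itv /= andbT => /andP[ut _]; exact: le_lt_trans ut.
Qed.

Variables (E eta : R).
Hypotheses (E_gt0 : 0 < E) (eta_gt0 : 0 < eta).
Hypothesis cs_pos : forall x, E <= x -> 1 / 2 <= c x /\ 0 < s x.
Hypothesis cs_mono : forall x y, E <= x -> x <= y -> s y <= s x /\ c x <= c y.
Hypothesis s_small : forall e Y : R, 0 < e -> exists2 X : R, Y <= X & s X <= e.
Hypothesis s_large : forall Y, exists2 X : R, Y <= X & eta <= X * s X.

Let c_le1 x : c x <= 1. Proof. exact: le_trans (ler_norm _) (c1 x). Qed.

(** The far interval is put where [s] is at most [s E1 / 8]. The ratio of the integrals of [c] being
    at most 2, the subtracted term is at most a quarter of [s E1], and the mass stays positive. *)
Lemma base_gadget : exists E0 s0 (g0 : l2fun R), [/\ E <= E0, 0 < s0 &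
  forall x, E0 <= x -> al g0 x = - s0 /\ be g0 x = 0].
Proof.
have Epos : 0 < E := E_gt0.
have [E1 E1E] : exists E1, E1 = E + 1 by exists (E + 1).
have sE1 : 0 < s E1 by have [] := @cs_pos E1 ltac:(lra).
have s8 : 0 < s E1 / 8 by rewrite divr_gt0.
have [Y EY sY] := s_small E1 s8.
have [Y1 Y1E] : exists Y1, Y1 = Y + 1 by exists (Y + 1).
have [h1 h2 h4] : [/\ 0 <= E, E <= E1 & Y <= Y1] by split; lra.
have Y0 : 0 <= Y by lra.
have eE : E1 - E = 1 by rewrite E1E addrC addKr.
have eY : Y1 - Y = 1 by rewrite Y1E addrC addKr.
have cE1 : prim c E1 - prim c E <= 1.
  by have := prim_le_cst lc h1 h2 (fun t _ _ => c_le1 t); rewrite eE mulr1.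
have cE2 : 0 <= prim c E1 - prim c E.
  have := @prim_ge_cst c E E1 0 lc h1 h2 _; rewrite mul0r; apply=> t Et _.
  by have [h _] := cs_pos (ltW Et); apply: le_trans h; rewrite divr_ge0.
have cY : 1 / 2 <= prim c Y1 - prim c Y.
  have := @prim_ge_cst c Y Y1 (1 / 2) lc Y0 h4 _; rewrite eY mulr1; apply=> t Yt _.
  by have [] := @cs_pos t (ltW (le_lt_trans (le_trans h2 EY) Yt)).
have a1 : s E1 <= prim s E1 - prim s E.
  have := @prim_ge_cst s E E1 (s E1) ls h1 h2 _; rewrite eE mulr1.
  by apply=> t Et tE; have [] := cs_mono (ltW Et) tE.
have a2 : prim s Y1 - prim s Y <= s Y.
  have := @prim_le_cst s Y Y1 (s Y) ls Y0 h4 _; rewrite eY mulr1.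
  by apply=> t Et tE; have [] := cs_mono (le_trans h2 EY) (ltW Et).
exists Y1, (gadget_mass E E1 Y Y1), (gadget E E1 Y Y1); split; first by lra.
- rewrite /gadget_mass; move: cE1 cE2 cY a1 a2.
  move: (prim c E1 - _) (prim c Y1 - _) (prim s E1 - _) (prim s Y1 - _) => u v w z u1 u0 v1 ws zs.
  have v0 : 0 < v by apply: lt_le_trans v1; rewrite divr_gt0.
  have k2 : u / v <= 2 by rewrite ler_pdivrMr //; lra.
  have k0 : 0 <= u / v by rewrite divr_ge0 // ltW.
  have := ler_wpM2l k0 (le_trans zs sY); have := ler_wpM2r (ltW s8) k2; lra.
- move=> x Yx; apply: gadget_after => //; rewrite gt_eqF //.
  by apply: lt_le_trans cY; rewrite divr_gt0.
Qed.

(** Between its two intervals the corrected solution equals [k (s x * C - c x * S)], with [C] and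
    [S] the integrals of [c] and [s] over the far interval. Since [s] is there at most half of
    [s X], this is at least [k X s(X) / 4], and [k >= 1 / 8] gives [eta / 32]. *)
Lemma high_gadget p q X : q = 2 * p -> X = 4 * p -> E <= p -> eta <= X * s X ->
  exists Q sg (g : l2fun R), [/\ X <= Q, ip g g <= X,
    forall x, 0 <= x -> x <= p -> al g x = 0 /\ be g x = 0,
    forall x, q < x -> x <= X -> eta / 32 <= sg * c x + sol c s l 0 g x &
    forall x, Q <= x -> al g x = - sg /\ be g x = 0].
Proof.
move=> qE XE Ep sX; have Epos : 0 < E := E_gt0.
have [p0 pq qX] : [/\ 0 <= p, p <= q & q <= X] by split; lra.
have EX : E <= X by lra.
have X_gt0 : 0 < X by lra.
have sX0 : 0 < s X / 2 by rewrite divr_gt0 //; have [] := cs_pos EX.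
have [Y XY sY] := s_small X sX0.
have qY : q <= Y by exact: le_trans XY.
(* The far interval has length [X = 4 p] against [p] for the near one. As [c] lies between [1 / 2]
   and 1, the ratio [k] lies between [1 / 8] and [1 / 2]. *)
have [Q QE] : exists Q, Q = Y + X by exists (Y + X).
have YQ : Y <= Q by lra.
have Y_ge0 : 0 <= Y by lra.
have eq : q - p = p by rewrite qE mulrDl mul1r addrK.
have eQ : Q - Y = X by rewrite QE addrC addKr.
have EY := le_trans EX XY.
have cpq1 : prim c q - prim c p <= p.
  by have := prim_le_cst lc p0 pq (fun t _ _ => c_le1 t); rewrite eq mul1r.
have cpq2 : 1 / 2 * p <= prim c q - prim c p.
  have := @prim_ge_cst c p q (1 / 2) lc p0 pq _; rewrite eq.
  by apply=> t pt _; have [] := cs_pos (le_trans Ep (ltW pt)).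
have cY1 : prim c Q - prim c Y <= X.
  by have := prim_le_cst lc Y_ge0 YQ (fun t _ _ => c_le1 t); rewrite eQ mul1r.
have cY2 : 1 / 2 * X <= prim c Q - prim c Y.
  have := @prim_ge_cst c Y Q (1 / 2) lc Y_ge0 YQ _; rewrite eQ.
  by apply=> t pt _; have [] := cs_pos (le_trans EY (ltW pt)).
have cYp : 0 < prim c Q - prim c Y by apply: lt_le_trans cY2; rewrite mulr_gt0 ?divr_gt0.
have [k kE] : exists k, k = (prim c q - prim c p) / (prim c Q - prim c Y) by eexists.
have k1 : 1 / 8 <= k.
  rewrite kE ler_pdivlMr //; move: cpq2 cY1.
  move: (prim c q - _) (prim c Q - _) => u v; lra.
have k2 : k <= 1 / 2.
  rewrite kE ler_pdivrMr //; move: cpq1 cY2.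
  move: (prim c q - _) (prim c Q - _) => u v; lra.
have nz : prim c Q - prim c Y != 0 by rewrite gt_eqF.
exists Q, (gadget_mass p q Y Q), (gadget p q Y Q); split.
- by rewrite QE lerDr.
(* The bound [X] splits as [2 (q - p) = X / 2] and [2 k^2 X <= X / 2]. *)
- have t1 := gadget_ip p0 pq qY YQ; rewrite -kE eq eQ in t1.
  have k0 : 0 <= k by apply: le_trans k1; rewrite divr_ge0.
  have t4 : k ^+ 2 <= 1 / 4 by have := ler_pM k0 k0 k2 k2; rewrite -expr2; lra.
  have := ler_wpM2r (ltW X_gt0) t4; lra.
- by move=> x x0 xp; exact: gadget_before.
- move=> x qx xX; have x0 : 0 < x by rewrite (le_lt_trans p0) // (le_lt_trans pq).
  have Ex : E <= x by rewrite (le_trans Ep) // (le_trans pq) // ltW.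
  have [a2 b2] := gadget_between p0 pq qY YQ (ltW qx) (le_trans xX XY).
  have CYb : c x * X <= prim c Q - prim c Y.
    have := @prim_ge_cst c Y Q (c x) lc Y_ge0 YQ _; rewrite eQ; apply=> t Yt _.
    by have [] := cs_mono Ex (ltW (le_lt_trans (le_trans xX XY) Yt)).
  have SYb : prim s Q - prim s Y <= s Y * X.
    have := @prim_le_cst s Y Q (s Y) ls Y_ge0 YQ _; rewrite eQ.
    by apply=> t Yt _; have [] := cs_mono EY (ltW Yt).
  rewrite /sol a2 b2 /gadget_mass -kE -[prim c q - prim c p](divfK nz) -kE.
  have [sx1 _] := cs_mono Ex xX; have [cx1 _] := cs_pos Ex.
  move: CYb SYb; move: (prim s q - prim s p) (prim c Q - prim c Y) (prim s Q - prim s Y) => w C S CYb SYb.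
  rewrite (_ : _ + _ = k * (s x * C - c x * S)); last by ring.
  have [_ sx0] := cs_pos Ex.
  have f1 : s x * (c x * X) <= s x * C by rewrite ler_pM2l.
  have cx0 : 0 < c x by apply: lt_le_trans cx1; rewrite divr_gt0.
  have f2 : c x * S <= c x * (s Y * X) by rewrite ler_pM2l.
  have f4 : 0 <= c x * X * (s x - s Y - s X / 2).
    rewrite mulr_ge0 ?mulr_ge0 ?(ltW cx0) ?(ltW X_gt0) //; move: sx1 sY; lra.
  have XsX : 0 <= X * s X by exact: le_trans (ltW eta_gt0) sX.
  have f6 := ler_wpM2r XsX cx1.
  have f5 : X * s X / 4 <= s x * C - c x * S by move: f1 f2 f4 f6; lra.
  have f7 : 0 <= s x * C - c x * S by move: f5 XsX; lra.
  have := ler_wpM2r f7 k1; move: f5 sX; lra.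
- by move=> x Qx; exact: gadget_after.
Qed.

(** [G] is the far gadget minus the multiple [r] of the base gadget that makes [al] vanish beyond
    [Q]. Then [F] is [sg c] between [E0] and [p], and at least [eta / 32] on []q, X]], so [|F|^2]
    dominates multiples of both [sg^2 (p - E0)] and [X]. The first makes [F] relatively small on
    []0, p]], and both together bound [|G|^2]. *)
Lemma test_functions : exists2 K : R, 0 < K & forall M d : R, 0 < d ->
  exists F G : l2fun R, [/\ solv 0 F G, ip F F = 1, ip G G <= K &
    forall x, 0 < x -> x <= M -> val F x ^+ 2 <= d].
Proof.
have Epos : 0 < E := E_gt0.
have [E0 [s0 [g0 [EE0 s0_gt0 g0E]]]] := base_gadget.
have E0_gt0 : 0 < E0 by exact: lt_le_trans EE0.
have s02 : 0 < s0 ^+ 2 by rewrite exprn_gt0.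
have [I0 I0E] : exists I0, I0 = ip g0 g0 by eexists.
have I0_ge0 : 0 <= I0 by rewrite I0E.
have [e e_gt0 etaE] : exists2 e : R, 0 < e & e = eta / 32 by exists (eta / 32); rewrite ?divr_gt0.
have e2 : 0 < e ^+ 2 by rewrite exprn_gt0.
have [K1 K1E] : exists K1, K1 = 4 * E0 * I0 by eexists.
have K1_ge0 : 0 <= K1 by rewrite K1E !mulr_ge0 // ltW.
have [K2 K2E] : exists K2, K2 = K1 / s0 ^+ 2 + 1 by eexists.
have K2_ge1 : 1 <= K2 by rewrite K2E lerDr divr_ge0 // ltW.
have K2_gt0 : 0 < K2 by apply: lt_le_trans K2_ge1.
exists (4 / e ^+ 2 + 2 * I0 / s0 ^+ 2).
  by rewrite ltr_wpDr ?divr_gt0 // divr_ge0 ?mulr_ge0 // ltW.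
move=> M d d0.
have Kd : 0 <= 4 * K2 / d by rewrite divr_ge0 ?mulr_ge0 ?(ltW K2_gt0) ?(ltW d0).
(* [p = X / 4] is then at least [M], and [p - E0] at least 4 and [4 K2 / d]: the 4 yields
   [sg^2 <= |F|^2], the other [F^2 <= d |F|^2] on []0, p]]. *)
have [X XX0 sX] := s_large (4 * (E0 + 4 + Num.max M 0 + 4 * K2 / d)).
have [Mm M0] : M <= Num.max M 0 /\ 0 <= Num.max M 0 by rewrite !le_max !lexx orbT.
have [p pE] : exists p, p = X / 4 by eexists.
have [q qE] : exists q, q = 2 * p by eexists.
have [p4 pM pK] : [/\ 4 <= p - E0, M <= p & 4 * K2 / d <= p - E0].
  by move: XX0 Mm M0 Kd E0_gt0; rewrite pE; move: (4 * K2 / d) (Num.max M 0) => u v; split; lra.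
have XE : X = 4 * p by rewrite pE mulrC divfK.
have EE0p : E0 <= p by move: p4; lra.
have [Q [sg [g [XQ ipg gp gq gQ]]]] := high_gadget qE XE (le_trans EE0 EE0p) sX.
have p_gt0 : 0 < p by exact: lt_le_trans EE0p.
have pX : p <= X by rewrite XE; move: p_gt0; lra.
have [r rE] : exists r, r = sg / s0 by eexists.
have rs0 : r * s0 = sg by rewrite rE divfK // gt_eqF.
have [G GE] : exists G, G = (- r) *: g0 + g by eexists.
have alG x : al G x = al g x - r * al g0 x.
  have := sol_alD l ms s1 (- r) 0 0 g0 g x.
  by rewrite -GE mulr0 addr0 => ->; rewrite mulNr addrC.
have beG x : be G x = be g x - r * be g0 x.
  have := sol_beD l mc c1 (- r) 0 0 g0 g x.
  by rewrite -GE mulr0 addr0 => ->; rewrite mulNr addrC.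
have solG x : E0 <= x -> sol c s l 0 G x = sg * c x + sol c s l 0 g x.
  by move=> Ex; have [u v] := g0E _ Ex; rewrite /sol alG beG u v -rs0; ring.
have Q0 : 0 <= Q by exact: le_trans (ltW p_gt0) (le_trans pX XQ).
pose F : l2fun R := Subset_lmod (@sqint_linear R) (compact_sol_sqint G Q0).
have FE x : 0 < x -> val F x = sol c s l 0 G x.
  move=> x0; rewrite /F /= patchE mem_setE in_itv /= x0 /=.
  case: ifPn => //; rewrite -ltNge => /ltW xQ.
  have [a2 b2] := gQ _ xQ.
  by rewrite solG ?(le_trans EE0p) ?(le_trans pX) ?(le_trans XQ) // /sol a2 b2 mulNr mul0r addr0 subrr.
have sFG : solv 0 F G by apply: ae_imp (prim_derive lc) => x _; exact: FE.
clearbody F.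
have Fmid x : E0 < x -> x <= p -> val F x = sg * c x.
  move=> Ex xp; have x0 : 0 < x by exact: lt_trans Ex.
  have [a2 b2] := gp _ (ltW x0) xp.
  by rewrite FE // solG ?ltW // /sol a2 b2 !mul0r !addr0.
have Flow x : 0 < x -> x <= p -> val F x ^+ 2 <= sg ^+ 2 * K2.
  move=> x0 xp; have [xE|Ex] := leP x E0; last first.
    rewrite Fmid // exprMn ler_wpM2l ?sqr_ge0 //; apply: le_trans K2_ge1.
    by rewrite -(real_normK (num_real (c x))) expr_le1.
  have [a2 b2] := gp _ (ltW x0) xp.
  have -> : val F x = - r * sol c s l 0 g0 x.
    by rewrite FE // /sol alG beG a2 b2; ring.
  have e1 : sol c s l 0 g0 x ^+ 2 <= K1.
    apply: le_trans (sol_sqr_le l cs1 0 g0 x0) _.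
    have t1 := sol_al_bound l ms s1 0 g0 (ltW x0); have t2 := sol_be_bound l mc c1 0 g0 (ltW x0).
    have t3 : x * I0 <= E0 * I0 by rewrite ler_wpM2r.
    rewrite expr0n /= -I0E in t1 t2; rewrite K1E; move: t1 t2 t3; lra.
  have -> : sg ^+ 2 * K2 = r ^+ 2 * K1 + sg ^+ 2.
    by rewrite K2E rE; field; rewrite gt_eqF.
  rewrite exprMn sqrrN; have := ler_wpM2l (sqr_ge0 r) e1; have := sqr_ge0 sg; lra.
have ipF1 : sg ^+ 2 / 4 * (p - E0) <= ip F F.
  apply: ip_lower; [exact: ltW | exact: EE0p |] => x Ex xp; rewrite Fmid // exprMn.
  have [c2 _] := cs_pos (le_trans EE0 (ltW Ex)).
  have c3 : 1 / 4 <= c x ^+ 2.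
    by have h : 0 <= 1 / 2 :> R by []; have := ler_pM h h c2 c2; rewrite -expr2; lra.
  have := ler_wpM2l (sqr_ge0 sg) c3; lra.
have ipF2 : e ^+ 2 * (X - q) <= ip F F.
  have [q0 qX pq] : [/\ 0 <= q, q <= X & p <= q].
    by rewrite XE qE; move: p_gt0; split; lra.
  apply: ip_lower => // x qx xX; have px := le_lt_trans pq qx.
  have h := gq x qx xX; rewrite -etaE -solG -?FE ?(lt_trans p_gt0) // in h; last first.
    by rewrite (le_trans EE0p) // ltW.
  by rewrite ler_pXn2r ?nnegrE ?(ltW e_gt0) // (le_trans (ltW e_gt0)).
have [I IE] : exists I, I = ip F F by eexists.
rewrite -IE in ipF1 ipF2.
have I_gt0 : 0 < I.
  by apply: lt_le_trans ipF2; rewrite mulr_gt0 // XE qE; move: p_gt0; lra.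
have sgI : sg ^+ 2 <= I.
  by have := ler_wpM2l (sqr_ge0 sg) p4; move: ipF1; lra.
have XI : X <= 2 / e ^+ 2 * I.
  rewrite mulrAC ler_pdivlMr //; move: ipF2; rewrite XE qE; lra.
have ipG : ip G G <= (4 / e ^+ 2 + 2 * I0 / s0 ^+ 2) * I.
  have t2 := ip0 (g + r *: g0).
  have t3 : ip G G <= 2 * ip g g + 2 * (r ^+ 2 * I0).
    move: t2; rewrite GE I0E !(ipDl sip) !(ipDr sip) !(ipZl sip) !(ipZr sip).
    by move: (ip g g) (ip g g0) (ip g0 g) (ip g0 g0)=> z1 z2 z3 z4; lra.
  have t6 : r ^+ 2 * I0 <= I0 / s0 ^+ 2 * I.
    have -> : r ^+ 2 * I0 = I0 / s0 ^+ 2 * sg ^+ 2 by rewrite rE; field; rewrite gt_eqF.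
    by rewrite ler_wpM2l // divr_ge0 // ltW.
  have -> : (4 / e ^+ 2 + 2 * I0 / s0 ^+ 2) * I = 2 * (2 / e ^+ 2 * I) + 2 * (I0 / s0 ^+ 2 * I).
    by field; rewrite !gt_eqF.
  apply: le_trans t3 _; rewrite -!mulrDr ler_pM2l //; apply: lerD t6.
  exact: le_trans ipg XI.
pose n := (Num.sqrt I)^-1.
have n2 : n ^+ 2 = I^-1 by rewrite exprVn sqr_sqrtr // ltW.
exists (n *: F), (n *: G); split.
- have := solves_lin mc ms c1 s1 n sFG (solvesB mc ms c1 s1 sFG sFG).
  by rewrite !subrr !addr0 mulr0.
- by rewrite (ipZl sip) (ipZr sip) mulrA -expr2 n2 -IE mulVf // gt_eqF.
- by rewrite (ipZl sip) (ipZr sip) mulrA -expr2 n2 ler_pdivrMl // mulrC.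
- move=> x x0 xM; rewrite l2valZ exprMn n2 ler_pdivrMl //.
  apply: le_trans (Flow x x0 (le_trans xM pM)) _.
  have h4 : 0 < 4 :> R by [].
  have u1 : sg ^+ 2 * (4 * K2) <= sg ^+ 2 * (d * (p - E0)).
    by rewrite ler_wpM2l ?sqr_ge0 // mulrC [d * _]mulrC -ler_pdivrMr // mulrC.
  have u2 := ler_wpM2l (ltW d0) ipF1.
  rewrite -(ler_pM2l h4) (_ : 4 * (sg ^+ 2 * K2) = sg ^+ 2 * (4 * K2)); last by ring.
  apply: le_trans u1 _; rewrite (_ : sg ^+ 2 * _ = 4 * (d * (sg ^+ 2 / 4 * (p - E0)))); last by field.
  by rewrite ler_pM2l // [I * d]mulrC.
Qed.

End TestFunctions.

(** * Functions escaping to infinity converge weakly to 0 *)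

Section WeakNull.
Variable R : realType.
Local Notation mu := (@lebesgue_measure R).
Local Notation D := (`]0, +oo[%classic : set R).
Local Notation ip := (@l2ip R).
Local Notation "`[ x ]" := (inorm ip x) (format "`[ x ]").
Let sip := @l2_semi_inner R.
Implicit Types (F G : l2fun R) (T x : R).

Lemma sqint_trunc T F : sqint (fun x => \1_(`]0, T]) x * val F x).
Proof.
apply: sqint_bmul (sqint_l2 F).
  by apply: measurable_indic; exact: measurable_itv.
by move=> x; rewrite indicE; case: (_ \in _); rewrite ?normr1 ?normr0.
Qed.

Definition l2trunc T F : l2fun R := Subset_lmod (@sqint_linear R) (sqint_trunc T F).

Lemma l2trunc_ip T F G : ip (l2trunc T F) G = ip F (l2trunc T G).
Proof. by rewrite !l2ipE; apply: eq_Rintegral => x _ /=; ring. Qed.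

Lemma l2trunc_small T F d : 0 <= T -> (forall x, 0 < x -> x <= T -> val F x ^+ 2 <= d) ->
  ip (l2trunc T F) (l2trunc T F) <= d * T.
Proof.
move=> T0 hF; have iF := (sqint_l2 F).2.
have mI : measurable (`]0, T]%classic : set (measurableTypeR R)) by exact: measurable_itv.
have muI : mu (`]0, T]%classic : set R) = T%:E.
  by rewrite lebesgue_measure_itv /= lte_fin; case: ltP T0 => [_ _|h1 h2]; rewrite ?sube0 // (le_anti (introT andP (conj h1 h2))).
rewrite -(Rintegral_cst_on d mI muI) l2ipE.
rewrite (_ : \int[mu]_(x in D) _ = \int[mu]_(x in `]0, T]) (val F x ^+ 2)).
  apply: le_Rintegral => //; first exact: integrableS iF.
    by apply: integrable_cst_on; rewrite // muI ltry.
  by move=> x; rewrite /= in_itv /= => /andP[x0 xT]; exact: hF.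
rewrite [LHS]Rintegral_mkcond [RHS]Rintegral_mkcond; apply: eq_Rintegral => x _.
rewrite !patchE /= indicE !mem_setE !in_itv /= andbT.
by case: (ltP 0 x) => //= _; case: (x <= T); rewrite ?mul1r ?mul0r ?expr2.
Qed.

Lemma l2trunc_approx F e : 0 < e -> exists2 T, 0 < T & `[F - l2trunc T F] < e.
Proof.
move=> e0; have e2 : 0 < e ^+ 2 by rewrite exprn_gt0.
have [T T0 hT] := half_line_tail (sqint_l2 F).2 (fun x => sqr_ge0 _) e2.
exists T => //; rewrite -(ltr_pXn2r (n := 2)) ?nnegrE ?inorm_ge0 ?(ltW e0) // (inorm_sqr sip).
apply: le_lt_trans hT; rewrite l2ipE [leLHS]Rintegral_mkcond [leRHS]Rintegral_mkcond.
rewrite le_eqVlt; apply/orP; left; apply/eqP; apply: eq_Rintegral => x _.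
rewrite !patchE l2valB /= indicE !mem_setE !in_itv /= !andbT.
case: (ltP 0 x) => x0 /=; last by rewrite ltNge (le_trans x0 (ltW T0)).
by case: (leP x T) => _ /=; rewrite ?mul1r ?mul0r ?subrr ?mulr0 // subr0 expr2.
Qed.

(** The fixed [k] is cut at some [T]: beyond it [k] is small, before it the [F n] are. *)
Lemma concentrating_weakly_null (F : nat -> l2fun R) :
  (forall n, ip (F n) (F n) = 1) ->
  (forall n x, 0 < x -> x <= n%:R -> val (F n) x ^+ 2 <= n.+1%:R^-1 ^+ 2) ->
  weakly_null ip F.
Proof.
move=> F1 hF k e e0; have e2 : 0 < e / 2 by rewrite divr_gt0.
have [T T0 hT] := l2trunc_approx k e2.
have C0 : 0 < (T + 1) * (`[k] + 1) by rewrite mulr_gt0 // ltr_wpDl ?inorm_ge0 ?(ltW T0).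
have d0 : 0 < e / 2 / ((T + 1) * (`[k] + 1)) by rewrite divr_gt0.
have [N1 _ hN1] := near_infty_natSinv_lt (PosNum d0).
exists (maxn N1 (Num.truncn T).+1) => n; rewrite geq_max => /andP[n1 n2].
have Tn : T <= n%:R.
  by apply: le_trans (ltW (truncnS_gt _)) _; rewrite ler_nat.
have n0 : 0 < n.+1%:R^-1 :> R by [].
have small : `[l2trunc T (F n)] <= n.+1%:R^-1 * (T + 1).
  have T1 : 0 <= T + 1 by rewrite addr_ge0 // ltW.
  rewrite -(ler_pXn2r (n := 2)) ?nnegrE ?inorm_ge0 ?mulr_ge0 ?(ltW n0) // (inorm_sqr sip).
  have := @l2trunc_small T (F n) (n.+1%:R^-1 ^+ 2) (ltW T0).
  have hT' x : 0 < x -> x <= T -> val (F n) x ^+ 2 <= n.+1%:R^-1 ^+ 2.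
    by move=> x0 xT; apply: hF => //; exact: le_trans xT Tn.
  move=> /(_ hT') h; apply: le_trans h _.
  rewrite exprMn ler_wpM2l ?sqr_ge0 // sqrrD expr1n mulr1.
  by have := sqr_ge0 T; move: T0; lra.
rewrite (_ : ip (F n) k = ip (l2trunc T (F n)) k + ip (F n) (k - l2trunc T k)); last first.
  by rewrite l2trunc_ip (ipDr sip) (ipNr sip) addrC subrK.
apply: le_lt_trans (ler_normD _ _) _.
have b1 := ip_cauchy sip (l2trunc T (F n)) k.
have b2 := ip_cauchy sip (F n) (k - l2trunc T k).
have e4 : `[F n] = 1 by rewrite /inorm F1 sqrtr1.
rewrite e4 mul1r in b2.
have := hN1 n n1; rewrite /= ltr_pdivlMr // mulrA => b3.
have b4 := ler_wpM2r (inorm_ge0 ip k) small.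
have b5 : 0 <= n.+1%:R^-1 * (T + 1) by rewrite mulr_ge0 ?(ltW n0) ?addr_ge0 // ltW.
move: b1 b3 b4 b5; move: (_ * (T + 1)) => u b1 b3 b4 b5; rewrite mulrDr mulr1 in b3.
rewrite (splitr e) ltr_leD //; last exact: le_trans b2 (ltW hT).
by apply: le_lt_trans b1 _; apply: le_lt_trans b4 _; apply: le_lt_trans b3; rewrite lerDl.
Qed.

End WeakNull.

(** * The operator on real coordinate functions *)

Section RealModel.
Variable R : realType.
Local Notation mu := (@lebesgue_measure R).
Local Notation D := (`]0, +oo[%classic : set R).
Local Notation ip := (@l2ip R).
Local Notation "`[ x ]" := (inorm ip x) (format "`[ x ]").
Let sip := @l2_semi_inner R.
Implicit Types (F G : l2fun R) (a x y w : R).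

Variables (c s : R -> R) (l : R).

Definition rel F G := exists a, solves c s l a F G.

Definition dom_closure F :=
  forall e, 0 < e -> exists2 F', (exists G, rel F' G) & `[F - F'] < e.

Hypotheses (mc : measurable_fun setT c) (ms : measurable_fun setT s).
Hypotheses (c1 : forall x, `|c x| <= 1) (s1 : forall x, `|s x| <= 1).
Hypothesis cs1 : forall x, 0 < x -> c x ^+ 2 + s x ^+ 2 = 1.

Lemma rel_lin k F G F' G' : rel F G -> rel F' G' -> rel (k *: F + F') (k *: G + G').
Proof. by move=> [a h] [a' h']; exists (k * a + a'); exact: solves_lin. Qed.

Lemma rel_null F G F' G' : rel F G -> `[F' - F] = 0 -> `[G' - G] = 0 -> rel F' G'.
Proof. by move=> [a h] hF hG; exists a; exact: solves_null h hF hG. Qed.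

Lemma rel_dom F G : rel F G -> dom_closure F.
Proof. by move=> h e e0; exists F; [exists G | rewrite subrr inorm0]. Qed.

Lemma rel0 : rel 0 0.
Proof.
exists 0; have ? := ae_filter_ringOfSetsType mu; apply: nearW => x x0.
have := sol_alD l ms s1 (-1) 0 0 0 0 x; have := sol_beD l mc c1 (-1) 0 0 0 0 x.
by rewrite scaler0 addr0 mulr0 addr0 !mulN1r !addNr /sol => -> ->; rewrite !mul0r addr0.
Qed.

Lemma dom_closure_linear : linear_subset dom_closure.
Proof.
split=> [|k F G KF KG e e0]; first exact: rel_dom rel0.
have k0 : 0 < `|k| + 1 by rewrite ltr_wpDl.
have e2 : 0 < e / 2 by rewrite divr_gt0.
have [F' [F2 hF] dF] := KF (e / 2 / (`|k| + 1)) ltac:(by rewrite divr_gt0).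
have [G' [G2 hG] dG] := KG (e / 2) e2.
exists (k *: F' + G'); first by exists (k *: F2 + G2); exact: rel_lin.
have -> : k *: F + G - (k *: F' + G') = k *: (F - F') + (G - G').
  by rewrite scalerBr opprD addrACA.
apply: le_lt_trans (inormD sip _ _) _; rewrite (inormZ sip).
have h : (`|k| + 1) * `[F - F'] < e / 2 by rewrite mulrC -ltr_pdivlMr.
by have := inorm_ge0 ip (F - F'); lra.
Qed.

Lemma dom_closure_closed u (f : l2fun R) :
  (forall n, dom_closure (u n)) -> icvg ip u f -> dom_closure f.
Proof.
move=> Ku uf e e0; have e2 : 0 < e / 2 by rewrite divr_gt0.
have [N hN] := uf _ e2; have [F' hF dF] := Ku N _ e2; exists F' => //.
apply: le_lt_trans (inorm_dist sip (u N) _ _) _.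
have := hN N (leqnn N); rewrite (inormB sip); lra.
Qed.

Definition domT := subset_lmod dom_closure_linear.
Definition dom_ip : domT -> domT -> R :=
  @sub_ip R (l2fun R) ip dom_closure dom_closure_linear.
(** Asking both components to lie in the closure of the domain removes the multi-valued part. *)
Definition op (f g : domT) := rel (val f) (val g).

Lemma dom_normE (f : domT) : inorm dom_ip f = `[val f].
Proof. by rewrite /inorm. Qed.

Lemma dom_semi_inner : semi_inner dom_ip. Proof. exact: sub_semi_inner. Qed.

Lemma dom_complete : icomplete dom_ip.
Proof. exact: (sub_icomplete (@l2_complete R) dom_closure_closed). Qed.

Lemma op_symmetric : symmetric_relation dom_ip op.
Proof.
split.
- by move=> k f g f' g' h h'; exact: rel_lin h h'.
- by move=> f g f' g'; rewrite !dom_normE !subset_valB => h hf hg; exact: rel_null h hf hg.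
- by move=> f g f' g' [a h] [a' h']; exact: (solves_sym mc ms c1 s1 cs1 h h').
Qed.

(** Initial values are scalars, so a combination of two eigenfunctions starts with [a = 0] and
    vanishes by [eigen_unique]. *)
Lemma op_simple w : exists b : domT, op b (w *: b) /\
  forall f : domT, op f (w *: f) -> exists k, inorm dom_ip (f - k *: b) = 0.
Proof.
have [[b hb nb]|nob] := pselect (exists2 b : domT, op b (w *: b) & inorm dom_ip b != 0); last first.
  have op0 : op 0 (w *: 0) by rewrite scaler0; exact: rel0.
  exists 0; split=> // f hf; exists 0; rewrite scale0r subr0.
  by apply: contrapT => /eqP nf; apply: nob; exists f.
exists b; split=> // f hf; case: (hb) (hf) => ab hab [af haf].
have ab0 : ab != 0.
  apply/eqP => ab0; move/eqP: nb; apply; move: hab; rewrite ab0 dom_normE subset_valZ.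
  by move: (val b) => B hB; exact: (eigen_unique mc ms c1 s1 cs1 hB).
exists (af / ab); have := solves_lin mc ms c1 s1 (- (af / ab)) hab haf.
rewrite mulNr divfK // addNr => h.
rewrite dom_normE subset_valB subset_valZ; rewrite !subset_valZ in h.
move: (val b) (val f) h => B F h; apply: (eigen_unique mc ms c1 s1 cs1 (z := w)).
have -> : F - (af / ab) *: B = - (af / ab) *: B + F by rewrite addrC scaleNr.
rewrite (_ : w *: _ = - (af / ab) *: (w *: B) + w *: F); first exact: h.
by rewrite scalerDr !scalerA mulrC.
Qed.

(** Compactness requires bounded initial values. The graph norm bounds them unless [H] is almost
    everywhere the projection onto the second axis; the second alternative covers that degenerate
    case. *)
Lemma op_compact : (forall eta, 0 < eta -> exists2 T, 1 <= T &
    forall x, T <= x -> `|s x| * x <= eta /\ 1 / 2 <= c x ^+ 2) ->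
  (exists2 C, 0 < C & forall a F G, solves c s l a F G -> a ^+ 2 <= C * (ip F F + ip G G)) \/
  (forall F G, rel F G -> `[F] = 0) -> compact_relation dom_ip op.
Proof.
move=> vanish [[C C0 hC]|triv] f g B fg fB gB; last first.
  exists id => [//|e e0]; exists 0%N => m n _ _.
  apply: le_lt_trans (inormD dom_semi_inner _ _) _; rewrite (inormN dom_semi_inner).
  have z k : inorm dom_ip (f k) = 0 by rewrite dom_normE; exact: (triv _ _ (fg k)).
  by rewrite !z addr0.
have /choice[a ha] n : exists a, solves c s l a (val (f n)) (val (g n)) by exact: fg.
have B0 : 0 <= B by apply: le_trans (fB 0%N); exact: inorm_ge0.
have sq (h : domT) : inorm dom_ip h <= B -> ip (val h) (val h) <= B ^+ 2.
  by rewrite dom_normE => hB; rewrite -(inorm_sqr sip) ler_pXn2r ?nnegrE ?inorm_ge0.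
have aA n : a n ^+ 2 <= C * (B ^+ 2 + B ^+ 2).
  apply: le_trans (hC _ _ _ (ha n)) _; rewrite ler_pM2l //.
  by apply: lerD; exact: sq.
have [k hk ck] := solves_compact mc ms c1 s1 cs1 vanish ha aA (fun n => sq _ (gB n)).
exists k; first exact: hk.
move=> e e0; have [N hN] := ck e e0; exists N => m n Nm Nn.
by rewrite dom_normE subset_valB; exact: hN.
Qed.

Hypothesis reg1 : regular_value dom_ip op (-1).

Theorem isolated_no_test_functions :
  (forall w, regular_value dom_ip op w \/
     exists2 e, 0 < e & forall w', 0 < `|w' - w| < e -> regular_value dom_ip op w') ->
  ~ exists2 K, 0 < K & forall M d, 0 < d ->
    exists F G, [/\ solves c s l 0 F G, ip F F = 1, ip G G <= K &
      forall x, 0 < x -> x <= M -> val F x ^+ 2 <= d].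
Proof.
move=> iso [K K0 hK].
have /choice[p hp] n : exists p : l2fun R * l2fun R, [/\ solves c s l 0 p.1 p.2, ip p.1 p.1 = 1,
    ip p.2 p.2 <= K & forall x, 0 < x -> x <= n%:R -> val p.1 x ^+ 2 <= n.+1%:R^-1 ^+ 2].
  by have [F [G h]] := hK n%:R (n.+1%:R^-1 ^+ 2) ltac:(by rewrite exprn_gt0); exists (F, G).
have KF n : dom_closure (p n).1 by case: (hp n) => h _ _ _; apply: (@rel_dom _ (p n).2); exists 0.
pose F n : domT := Subset_lmod dom_closure_linear (KF n).
have wF : weakly_null dom_ip F.
  have h : weakly_null ip (fun n => (p n).1).
    by apply: concentrating_weakly_null => n; have [] := hp n.
  by move=> k e e0; exact: (h (val k) e e0).
have F1 n : inorm dom_ip (F n) <= 1.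
  by have [_ h _ _] := hp n; rewrite /inorm /dom_ip /sub_ip /= h sqrtr1.
have /choice[f hf] n : exists f : domT, op f (F n - f).
  have [f [g [hfg h]]] := reg1.2 (F n); exists f.
  have [_ nl _] := op_symmetric; apply: nl hfg _ _; first by rewrite subrr (inorm0 dom_semi_inner).
  by rewrite -(inormN dom_semi_inner) -h; congr (inorm _ _); rewrite scaleN1r !opprB opprK addrA.
have strong := isolated_simple_weak_to_strong dom_semi_inner dom_complete op_symmetric reg1.
have {}strong := strong ltac:(move=> w; case: (iso w) => h; [by left | right; split=> //;
  by have [b [_ hb]] := op_simple w; exists b]) F f wF ltac:(by exists 1) hf.
(* [C] exceeds [1 + sqrt K], the bound for [|F_n| + |G_n|], so a solution [f] of norm at most [C^-1]
   cannot have inner product 1 with [F_n + G_n]. *)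
pose C := Num.sqrt K + 2; have C0 : 0 < C by rewrite ltr_wpDl // sqrtr_ge0.
have [N /(_ N (leqnn N))] := strong C^-1 ltac:(by rewrite invr_gt0).
apply/negP; rewrite -ltNge -[ltLHS]div1r ltr_pdivrMr //.
have [h1 h2 h3 _] := hp N; have [a h4] := hf N.
have := solves_sym mc ms c1 s1 cs1 h4 h1.
rewrite (_ : val (F N - f N) = (p N).1 - val (f N)) // (ipDl sip) (ipNl sip) h2.
set u := val (f N) => e1.
have e2 := le_trans (ler_norm _) (ip_cauchy sip u (p N).2).
have e3 := le_trans (ler_norm _) (ip_cauchy sip u (p N).1).
have e4 : `[(p N).1] = 1 by rewrite /inorm h2 sqrtr1.
have e5 : `[(p N).2] <= Num.sqrt K by rewrite /inorm ler_sqrt // ltW.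
have u0 := inorm_ge0 ip u.
rewrite e4 mulr1 in e3; have e6 := ler_wpM2l u0 e5.
have [nu|nu] := eqVneq `[u] 0; first by rewrite nu mul0r in e6; move: e1 e2 e3; rewrite nu; lra.
have : 0 < `[u] by rewrite lt_def nu.
rewrite dom_normE -/u /C mulrDr; lra.
Qed.

Hypothesis cpt : compact_relation dom_ip op.
Hypothesis onto : forall w d, d != 0 -> forall h : domT, exists u v gu gv : domT,
  [/\ op u gu, op v gv, inorm dom_ip (gu - w *: u + d *: v - h) = 0 &
    inorm dom_ip (gv - w *: v - d *: u) = 0].

Lemma compact_regular w : (forall f : domT, op f (w *: f) -> inorm dom_ip f = 0) ->
  regular_value dom_ip op w.
Proof.
move=> ker; apply: (compact_onto dom_semi_inner dom_complete op_symmetric reg1).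
  exact: (compact_below dom_semi_inner dom_complete op_symmetric reg1 cpt).
exact: onto.
Qed.

Theorem compact_discrete w : regular_value dom_ip op w \/
  (exists2 f : domT, op f (w *: f) & inorm dom_ip f <> 0) /\
  exists2 e, 0 < e & forall w', 0 < `|w' - w| < e -> regular_value dom_ip op w'.
Proof.
have [h|h] := pselect (forall f : domT, op f (w *: f) -> inorm dom_ip f = 0).
  by left; exact: compact_regular.
right; split.
  by apply: contrapT => nf; apply: h => f hf; apply: contrapT => nf0; apply: nf; exists f.
have [e e0 he] := compact_isolated dom_semi_inner op_symmetric cpt w.
exists e; first exact: e0.
by move=> w' hw'; apply: compact_regular => f hf; exact: (he w' hw' f hf).
Qed.

End RealModel.

(** * Functions and their coordinate along [e_phi] *)

Section Projection.
Variable R : realType.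
Implicit Types (a : R) (v : 'cV[R[i]]_2).

Lemma proj_dirE a i j : proj_dir a i j = evec a i 0 * evec a j 0.
Proof. by rewrite /proj_dir !mxE big_ord_recl big_ord0 addr0 !mxE. Qed.

Lemma complex_Re_mulr (r : R) z : complex.Re (real_complex R r * z) = r * complex.Re z.
Proof. by case: z => x y /=; rewrite mul0r subr0. Qed.

Lemma complex_Im_mulr (r : R) z : complex.Im (real_complex R r * z) = r * complex.Im z.
Proof. by case: z => x y /=; rewrite mul0r addr0. Qed.

Definition dircoord a v : R[i] :=
  real_complex R (cos a) * v 0 0 + real_complex R (sin a) * v 1 0.

Lemma proj_dir_mul a v (i : 'I_2) :
  (cplx_mx (proj_dir a) *m v) i 0 = real_complex R (evec a i 0) * dircoord a v.
Proof.
have e j : cplx_mx (proj_dir a) i j = real_complex R (evec a i 0 * evec a j 0).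
  by rewrite mxE proj_dirE.
rewrite mxE !big_ord_recl big_ord0 addr0 !e (_ : lift ord0 ord0 = 1); last exact/val_inj.
rewrite /dircoord !rmorphM /= [evec a 0 0]mxE [evec a 1 0]mxE /=.
by rewrite mulrDr !mulrA.
Qed.

Lemma qform_proj a v : qform (proj_dir a) v =
  complex.Re (dircoord a v) ^+ 2 + complex.Im (dircoord a v) ^+ 2.
Proof.
rewrite /qform -mulmxA mxE !big_ord_recl big_ord0 addr0 !proj_dir_mul.
rewrite (_ : lift ord0 ord0 = 1); last exact/val_inj.
rewrite !mxE /= /dircoord; case: (v 0 0) => x0 y0; case: (v 1 0) => x1 y1 /=.
by ring.
Qed.

Lemma rotJ_mul v : (rotJ R *m v) 0 0 = - v 1 0 /\ (rotJ R *m v) 1 0 = v 0 0.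
Proof.
rewrite !mxE !big_ord_recl !big_ord0 !addr0 !mxE /= (_ : lift ord0 ord0 = 1); last exact/val_inj.
by rewrite /= subrr mul0r add0r sub0r mulN1r subr0 mul1r mul0r addr0.
Qed.

End Projection.

Section Components.
Variable R : realType.
Local Notation mu := (@lebesgue_measure R).
Local Notation D := (`]0, +oo[%classic : set R).
Local Notation ip := (@l2ip R).
Local Notation "`[ x ]" := (inorm ip x) (format "`[ x ]").
Let sip := @l2_semi_inner R.
Implicit Types (u v : l2fun R) (f g : R -> 'cV[R[i]]_2) (x : R).

Variables (H : R -> 'M[R]_2) (phi : R -> R).
Hypothesis mphi : measurable_fun D phi.
Hypothesis Hphi : {ae mu, forall x, 0 < x -> H x = proj_dir (phi x)}.

Let mD : measurable (D : set (measurableTypeR R)). Proof. exact: measurable_itv. Qed.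
Let DE x : (x \in D) = (0 < x). Proof. by rewrite mem_setE in_itv /= andbT. Qed.
Let inD x : D x -> 0 < x. Proof. by rewrite /= in_itv /= andbT. Qed.

Lemma continuous_comp_restrict (h : R -> R) (k : R) : continuous h ->
  measurable_fun setT ((fun x => h (phi x - k)) \_ D).
Proof.
move=> ch; apply/(measurable_restrictT _ mD).
apply: (measurableT_comp (continuous_measurable_fun ch)).
exact: measurable_funB.
Qed.

(* The complex function [u + i v] is the coordinate of [f] along the direction
   [e_phi], the only part of [f] that [H] sees. *)
Definition rep f u v :=
  {ae mu, forall x, 0 < x -> dircoord (phi x) (f x) = Complex (val u x) (val v x)}.

Definition emb u v x : 'cV[R[i]]_2 :=
  \col_i (real_complex R (evec (phi x) i 0) * Complex (val u x) (val v x)).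

Lemma rep_emb u v : rep (emb u v) u v.
Proof.
have ? := ae_filter_ringOfSetsType mu; apply: nearW => x _.
rewrite /dircoord !mxE /= !mulrA -mulrDl -!rmorphM -rmorphD /= -!expr2 cos2Dsin2.
by rewrite mul1r.
Qed.

Lemma rep0 : rep 0 0 0.
Proof.
by have ? := ae_filter_ringOfSetsType mu; apply: nearW => x _; rewrite /dircoord !mxE !mulr0 addr0.
Qed.

Lemma repB f u v f' u' v' : rep f u v -> rep f' u' v' -> rep (f - f') (u - u') (v - v').
Proof.
apply: ae_imp2 => x h h' x0; have := h x0; have := h' x0.
rewrite /dircoord !l2valB !mxE => e' e; apply/eqP; rewrite eq_complex /=.
move: e e'; case: (f x 0 0) => a1 b1; case: (f x 1 0) => a2 b2.
case: (f' x 0 0) => a3 b3; case: (f' x 1 0) => a4 b4 /= [<- <-] [<- <-].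
by apply/andP; split; apply/eqP; ring.
Qed.

Lemma repZ z f u v : rep f u v ->
  rep (z *: f) (complex.Re z *: u - complex.Im z *: v) (complex.Re z *: v + complex.Im z *: u).
Proof.
apply: ae_imp => x h x0; have := h x0.
rewrite /dircoord l2valB l2valD !l2valZ !mxE => e; apply/eqP; rewrite eq_complex /=.
move: e; case: z => a b; case: (f x 0 0) => a1 b1; case: (f x 1 0) => a2 b2 /= [<- <-].
by apply/andP; split; apply/eqP; ring.
Qed.

Lemma L2int_coord f (q : R -> R) : measurable_fun D q -> (forall x, 0 <= q x) ->
  {ae mu, forall x, 0 < x ->
     complex.Re (dircoord (phi x) (f x)) ^+ 2 + complex.Im (dircoord (phi x) (f x)) ^+ 2 = q x} ->
  L2int H f = (\int[mu]_(x in D) (q x)%:E)%E.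
Proof.
(* On a null set the integrand may be negative, so it is split into positive and negative parts,
   each equal almost everywhere to a nonnegative Borel function. *)
move=> mq q0 hq; rewrite /L2int integralE; set F := (fun x => _%:E).
have Fq : {ae mu, forall x, D x -> F x = (q x)%:E}.
  by apply: ae_imp2 hq Hphi => x h1 h2 /inD x0; rewrite /F h2 // qform_proj h1.
rewrite (@ge0_integral_ae_on _ _ (F^\+)%E (EFin \o q)) //; first last.
- apply: ae_imp Fq => x h Dx; rewrite funeposE h //=.
  by apply/max_idPl; rewrite lee_fin.
- by apply/measurable_EFinP.
- by move=> x _ /=; rewrite lee_fin.
rewrite (@ge0_integral_ae_on _ _ (F^\-)%E (cst 0%E)) ?integral0 ?sube0 //.
apply: ae_imp Fq => x h Dx; rewrite funenegE h //=.
by apply/max_idPr; rewrite lee_fin oppr_le0.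
Qed.

Lemma L2int_rep f u v : rep f u v -> L2int H f = (ip u u + ip v v)%:E.
Proof.
move=> h; have mq w : measurable_fun D (fun x => val (w : l2fun R) x ^+ 2).
  by apply: measurable_funX; exact: measurable_l2.
rewrite (@L2int_coord f (fun x => val u x ^+ 2 + val v x ^+ 2)).
- rewrite EFinD !l2ip_EFin -ge0_integralD //;
    by [move=> x _; rewrite lee_fin sqr_ge0 | apply/measurable_EFinP; exact: mq].
- by apply: measurable_funD; exact: mq.
- by move=> x; rewrite addr_ge0 ?sqr_ge0.
- by apply: ae_imp h => x hx x0; rewrite hx.
Qed.

Lemma L2norm_rep f u v : rep f u v -> L2norm H f = Num.sqrt (ip u u + ip v v).
Proof. by move=> h; rewrite /L2norm (L2int_rep h). Qed.

Lemma L2eq_rep f g u v u' v' : rep f u v -> rep g u' v' ->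
  L2eq H f g <-> `[u - u'] = 0 /\ `[v - v'] = 0.
Proof.
move=> hf hg; rewrite /L2eq (L2int_rep (repB hf hg)) -!(inorm_sqr sip).
split=> [[/eqP]|[-> ->]]; last by rewrite expr0n addr0.
by rewrite paddr_eq0 ?sqr_ge0 // !sqrf_eq0 => /andP[/eqP -> /eqP ->].
Qed.

(** The components are replaced by Borel functions before the coordinate is formed, and all factors
    are cut to the half line so that [sqint] can hold on the whole line. *)
Lemma rep_ex f : L2 H f -> exists u v, rep f u v.
Proof.
move=> [mf if2].
have mc := continuous_comp_restrict 0 (@continuous_cos R).
have ms := continuous_comp_restrict 0 (@continuous_sin R).
have [[g0 mg0 e0] [h0 mh0 k0]] := mf 0; have [[g1 mg1 e1] [h1 mh1 k1]] := mf 1.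
pose U := (fun x => cos (phi x - 0)) \_ D \* (g0 \_ D) \+ ((fun x => sin (phi x - 0)) \_ D) \* (g1 \_ D).
pose V := (fun x => cos (phi x - 0)) \_ D \* (h0 \_ D) \+ ((fun x => sin (phi x - 0)) \_ D) \* (h1 \_ D).
have mU : measurable_fun setT U.
  by apply: measurable_funD; apply: measurable_funM => //; apply/(measurable_restrictT _ mD).
have mV : measurable_fun setT V.
  by apply: measurable_funD; apply: measurable_funM => //; apply/(measurable_restrictT _ mD).
have hUV : {ae mu, forall x, 0 < x -> dircoord (phi x) (f x) = Complex (U x) (V x)}.
  have {}e0 := ae_imp2 (fun x a b => conj a b) e0 k0.
  have {}e1 := ae_imp2 (fun x a b => conj a b) e1 k1.
  apply: ae_imp2 e0 e1 => x [a1 a2] [a3 a4] x0.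
  rewrite /U /V /= !patchE !DE x0 subr0 -a1 // -a2 // -a3 // -a4 //; apply/eqP; rewrite eq_complex /dircoord.
  case: (f x 0 0) => p q; case: (f x 1 0) => p' q' /=.
  by apply/andP; split; apply/eqP; ring.
have m2 (W : R -> R) : measurable_fun setT W -> measurable_fun D (fun x => W x ^+ 2).
  by move=> mW; apply: measurable_funX; exact: measurable_funTS.
have iUV : L2int H f = (\int[mu]_(x in D) (U x ^+ 2 + V x ^+ 2)%:E)%E.
  apply: L2int_coord.
  - by apply: measurable_funD; exact: m2.
  - by move=> x; rewrite addr_ge0 ?sqr_ge0.
  - by apply: ae_imp hUV => x h x0; rewrite h.
rewrite iUV in if2.
have sq (W : R -> R) : measurable_fun setT W -> (forall x, W x ^+ 2 <= U x ^+ 2 + V x ^+ 2) ->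
    (forall x, x \notin D -> W x = 0) -> sqint W.
  move=> mW WUV W0; split => //.
  have -> : EFin \o (fun x => W x ^+ 2) = (EFin \o (fun x => W x ^+ 2)) \_ D.
    by apply/funext => x; rewrite patchE; case: ifPn => // /W0 /= ->; rewrite expr0n.
  apply/(integrable_restrict _ _) => //; rewrite setTI.
  apply/integrableP; split; first by apply/measurable_EFinP; exact: m2.
  apply: le_lt_trans if2; apply: ge0_le_integral => //.
  - by apply/measurable_EFinP; apply: measurableT_comp => //; exact: m2.
  - by apply/measurable_EFinP; apply: measurable_funD; exact: m2.
  - by move=> x _; rewrite /= lee_fin ger0_norm ?sqr_ge0.
have U0 x : x \notin D -> U x = 0 by move=> /negPf xD; rewrite /U /= !patchE xD !mulr0 addr0.
have V0 x : x \notin D -> V x = 0 by move=> /negPf xD; rewrite /V /= !patchE xD !mulr0 addr0.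
have sU : sqint U by apply: (sq U mU _ U0) => x; rewrite lerDl sqr_ge0.
have sV : sqint V by apply: (sq V mV _ V0) => x; rewrite lerDr sqr_ge0.
by exists (Subset_lmod (@sqint_linear R) sU), (Subset_lmod (@sqint_linear R) sV).
Qed.

Lemma measurable_emb u v : leb_measurable_vec (emb u v).
Proof.
have mt i : measurable_fun D (fun x => evec (phi x) i 0).
  have mc := continuous_comp_restrict 0 (@continuous_cos R).
  have ms := continuous_comp_restrict 0 (@continuous_sin R).
  have [ei|ei] := eqVneq i 0.
    move/(measurable_restrictT _ mD): mc; apply: eq_measurable_fun => x _.
    by rewrite subr0 ei mxE.
  move/(measurable_restrictT _ mD): ms; apply: eq_measurable_fun => x _.
  by rewrite subr0 mxE (negPf ei).
have ? := ae_filter_ringOfSetsType mu.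
move=> i; split; [exists (fun x => evec (phi x) i 0 * val u x)|exists (fun x => evec (phi x) i 0 * val v x)].
- by apply: measurable_funM => //; exact: measurable_l2.
- by apply: nearW => x _; rewrite mxE complex_Re_mulr.
- by apply: measurable_funM => //; exact: measurable_l2.
- by apply: nearW => x _; rewrite mxE complex_Im_mulr.
Qed.

Lemma L2_rep f u v : leb_measurable_vec f -> rep f u v -> L2 H f.
Proof. by move=> mf h; split=> //; rewrite (L2int_rep h) ltry. Qed.

End Components.

(** * The canonical system in rotated coordinates *)

Section SystemRelation.
Variable R : realType.
Local Notation mu := (@lebesgue_measure R).
Local Notation D := (`]0, +oo[%classic : set R).
Local Notation ip := (@l2ip R).
Local Notation "`[ x ]" := (inorm ip x) (format "`[ x ]").
Implicit Types (u v : l2fun R) (f g : R -> 'cV[R[i]]_2) (x a : R).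

(** Set to 0 outside the half line, where [phi] is arbitrary; [c^2 + s^2 = 1] therefore holds for
    [x > 0] only. *)
Definition angle_cos (phi : R -> R) l := (fun x => cos (phi x - l)) \_ D.
Definition angle_sin (phi : R -> R) l := (fun x => sin (phi x - l)) \_ D.

Lemma angle_cosE phi l x : 0 < x -> angle_cos phi l x = cos (phi x - l).
Proof. by move=> x0; rewrite /angle_cos patchE mem_setE in_itv /= x0. Qed.

Lemma angle_sinE phi l x : 0 < x -> angle_sin phi l x = sin (phi x - l).
Proof. by move=> x0; rewrite /angle_sin patchE mem_setE in_itv /= x0. Qed.

Lemma angle_cos_le1 phi l x : `|angle_cos phi l x| <= 1.
Proof.
rewrite /angle_cos patchE; case: ifP => _; last by rewrite normr0.
by rewrite ler_norml cos_geN1 cos_le1.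
Qed.

Lemma angle_sin_le1 phi l x : `|angle_sin phi l x| <= 1.
Proof.
rewrite /angle_sin patchE; case: ifP => _; last by rewrite normr0.
by rewrite ler_norml sin_geN1 sin_le1.
Qed.

Lemma angle_cos2Dsin2 phi l x : 0 < x -> angle_cos phi l x ^+ 2 + angle_sin phi l x ^+ 2 = 1.
Proof. by move=> x0; rewrite angle_cosE // angle_sinE // cos2Dsin2. Qed.

Lemma cos_angle phi l x : 0 < x ->
  cos (phi x) = cos l * angle_cos phi l x - sin l * angle_sin phi l x.
Proof.
move=> x0; rewrite angle_cosE // angle_sinE // -[in LHS](subrK l (phi x)) [LHS]cosD; ring.
Qed.

Lemma sin_angle phi l x : 0 < x ->
  sin (phi x) = sin l * angle_cos phi l x + cos l * angle_sin phi l x.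
Proof.
move=> x0; rewrite angle_cosE // angle_sinE // -[in LHS](subrK l (phi x)) [LHS]sinD; ring.
Qed.

Lemma is_derive_comb k m (p q : R -> R) x dp dq : is_derive x 1 p dp -> is_derive x 1 q dq ->
  is_derive x 1 (fun y => k * p y + m * q y) (k * dp + m * dq).
Proof. by move=> hp hq; exact: (is_deriveD (is_deriveZ k hp) (is_deriveZ m hq)). Qed.

Variables (H : R -> 'M[R]_2) (phi : R -> R) (l : R).
Hypothesis mphi : measurable_fun D phi.
Hypothesis Hphi : {ae mu, forall x, 0 < x -> H x = proj_dir (phi x)}.
Local Notation c := (angle_cos phi l).
Local Notation s := (angle_sin phi l).

Lemma measurable_angle_cos : measurable_fun setT c.
Proof. exact: (continuous_comp_restrict mphi l (@continuous_cos R)). Qed.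

Lemma measurable_angle_sin : measurable_fun setT s.
Proof. exact: (continuous_comp_restrict mphi l (@continuous_sin R)). Qed.

Let mc := measurable_angle_cos.
Let ms := measurable_angle_sin.
Let c1 := angle_cos_le1 phi l.
Let s1 := angle_sin_le1 phi l.

Let dsys (p1 p2 : R -> R) (g : l2fun R) x :=
  is_derive x 1 p1 (- (sin (phi x) * val g x)) /\ is_derive x 1 p2 (cos (phi x) * val g x).

(* The rotation by [l] turns the two components into [sol_al] and [sol_be]. *)
Lemma system_solves (p1 p2 : R -> R) (u g : l2fun R) :
  (forall b, 0 < b -> abs_continuous 0 b p1 /\ abs_continuous 0 b p2) ->
  {ae mu, forall x, 0 < x -> dsys p1 p2 g x} -> p2 0 = 0 ->
  {ae mu, forall x, 0 < x -> cos (phi x) * p1 x + sin (phi x) * p2 x = val u x} ->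
  solves c s l (p1 0) u g.
Proof.
move=> ac dp p20; apply: ae_imp => x hx x0; rewrite -hx //.
have [ac1 ac2] := ac x x0.
have eA : - cos l * p1 x + - sin l * p2 x - (- cos l * p1 0 + - sin l * p2 0) =
    prim (fun t => s t * val g t) x - prim (fun t => s t * val g t) 0.
  apply: (@ac_ftc _ 0 x (fun y => - cos l * p1 y + - sin l * p2 y)) => //; first exact: ltW.
  - by apply: acD; exact: acZ.
  - exact: locint_bmul.
  - apply: ae_imp dp => t ht /andP[t0 _]; have [d1 d2] := ht t0.
    have := is_derive_comb (- cos l) (- sin l) d1 d2; congr is_derive.
    by rewrite angle_sinE // sinB; ring.
have eB : - sin l * p1 x + cos l * p2 x - (- sin l * p1 0 + cos l * p2 0) =
    prim (fun t => c t * val g t) x - prim (fun t => c t * val g t) 0.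
  apply: (@ac_ftc _ 0 x (fun y => - sin l * p1 y + cos l * p2 y)) => //; first exact: ltW.
  - by apply: acD; exact: acZ.
  - exact: locint_bmul.
  - apply: ae_imp dp => t ht /andP[t0 _]; have [d1 d2] := ht t0.
    have := is_derive_comb (- sin l) (cos l) d1 d2; congr is_derive.
    by rewrite angle_cosE // cosB; ring.
rewrite prim0 subr0 p20 in eA; rewrite prim0 subr0 p20 in eB.
rewrite /sol /sol_al /sol_be -eA -eB (cos_angle _ l x0) (sin_angle _ l x0).
by ring.
Qed.

(** The inverse rotation. The second component starts at 0 because [(a cos l, - a sin l)] is the
    rotated [(a, 0)]. *)
Lemma solves_system a (u g : l2fun R) : solves c s l a u g -> exists p1 p2 : R -> R,
  [/\ measurable_fun setT p1 /\ measurable_fun setT p2,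
    forall b, 0 < b -> abs_continuous 0 b p1 /\ abs_continuous 0 b p2,
    {ae mu, forall x, 0 < x -> dsys p1 p2 g x}, p2 0 = 0 &
    {ae mu, forall x, 0 < x -> cos (phi x) * p1 x + sin (phi x) * p2 x = val u x}].
Proof.
move=> h; pose A := sol_al s l a g; pose B := sol_be c l a g.
have mA : measurable_fun setT A.
  apply: measurable_funB => //; apply: continuous_measurable_fun.
  by apply: prim_continuous; exact: locint_bmul.
have mB : measurable_fun setT B.
  apply: measurable_funD => //; apply: continuous_measurable_fun.
  by apply: prim_continuous; exact: locint_bmul.
have aA b : abs_continuous 0 b A by exact: sol_al_ac.
have aB b : abs_continuous 0 b B by exact: sol_be_ac.
exists (fun y => cos l * A y + - sin l * B y), (fun y => sin l * A y + cos l * B y); split.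
- by split; apply: measurable_funD; exact: measurable_funM.
- by move=> b b0; split; apply: acD; exact: acZ.
- have dA := sol_al_derive l ms s1 a g; have dB := sol_be_derive l mc c1 a g.
  apply: ae_imp2 dA dB => x dA dB x0; have {}dA := dA x0; have {}dB := dB x0; split.
    have := is_derive_comb (cos l) (- sin l) dA dB; congr is_derive.
    by rewrite (sin_angle _ l x0); ring.
  have := is_derive_comb (sin l) (cos l) dA dB; congr is_derive.
  by rewrite (cos_angle _ l x0); ring.
- by rewrite /A /B /sol_al /sol_be !prim0; ring.
- apply: ae_imp h => x h x0; rewrite h // (cos_angle _ l x0) (sin_angle _ l x0) /sol -/A -/B.
  transitivity ((cos l ^+ 2 + sin l ^+ 2) * (A x * c x + B x * s x)).
    by ring.
  by rewrite cos2Dsin2 mul1r.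
Qed.

End SystemRelation.

Section SystemOperator.
Variable R : realType.
Local Notation mu := (@lebesgue_measure R).
Local Notation D := (`]0, +oo[%classic : set R).
Local Notation ip := (@l2ip R).
Local Notation "`[ x ]" := (inorm ip x) (format "`[ x ]").
Let sip := @l2_semi_inner R.
Implicit Types (u v : l2fun R) (f g : R -> 'cV[R[i]]_2) (x a t : R).

Variables (H : R -> 'M[R]_2) (phi : R -> R) (l : R).
Hypothesis mphi : measurable_fun D phi.
Hypothesis Hphi : {ae mu, forall x, 0 < x -> H x = proj_dir (phi x)}.
Local Notation c := (angle_cos phi l).
Local Notation s := (angle_sin phi l).
Let mc := measurable_angle_cos l mphi.
Let ms := measurable_angle_sin l mphi.
Let c1 := angle_cos_le1 phi l.
Let s1 := angle_sin_le1 phi l.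
Local Notation rel := (rel c s l).
Local Notation K := (dom_closure c s l).
Local Notation rep := (rep phi).
Local Notation emb := (emb phi).

Let rel_of_system (p1 p2 : R -> R) u u' (w : l2fun R) :
  (forall b, 0 < b -> abs_continuous 0 b p1 /\ abs_continuous 0 b p2) ->
  {ae mu, forall x, 0 < x -> is_derive x 1 p1 (- (sin (phi x) * val w x)) /\
     is_derive x 1 p2 (cos (phi x) * val w x)} -> p2 0 = 0 ->
  {ae mu, forall x, 0 < x -> cos (phi x) * p1 x + sin (phi x) * p2 x = val u' x} ->
  `[u - u'] = 0 -> rel u w.
Proof.
move=> h1 h2 h3 h4 h5.
have r : rel u' w by exists (p1 0); exact: (system_solves l mphi h1 h2 h3 h4).
by apply: (rel_null mc ms c1 s1 r h5); rewrite subrr (inorm0 sip).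
Qed.

(** [H], [J] and the boundary condition are real, so the equation separates into one for the real
    and one for the imaginary part of the coordinate. Conversely [f0] is assembled from two real
    solutions. *)
Lemma sysrel_rep f g u v u' v' : leb_measurable_vec f -> leb_measurable_vec g ->
  rep f u v -> rep g u' v' -> sysrel H f g <-> rel u u' /\ rel v v'.
Proof.
move=> mf mg rf rg; split=> [[L2f L2g [f0 [[L2f0 eqf] acf0 df0 f00]]]|[[a1 h1] [a2 h2]]].
  have [u0 [v0 rf0]] := rep_ex mphi Hphi L2f0.
  have [eu ev] := (L2eq_rep Hphi rf rf0).1 eqf.
  have dv : {ae mu, forall x, 0 < x ->
      (is_derive x 1 (fun y => complex.Re (f0 y 0 0)) (- (sin (phi x) * val u' x)) /\
       is_derive x 1 (fun y => complex.Re (f0 y 1 0)) (cos (phi x) * val u' x)) /\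
      (is_derive x 1 (fun y => complex.Im (f0 y 0 0)) (- (sin (phi x) * val v' x)) /\
       is_derive x 1 (fun y => complex.Im (f0 y 1 0)) (cos (phi x) * val v' x))}.
    have Hg := ae_imp2 (fun x p q => conj p q) Hphi rg.
    apply: ae_imp2 Hg df0 => x [hH hg] hd x0; have [w hw] := hd x0.
    rewrite hH // => /matrixP hv.
    have e1 := hv 0 0; have e2 := hv 1 0; move: e1 e2.
    have [-> ->] := rotJ_mul w; rewrite ![fun_of_matrix (- _) _ _]mxE !proj_dir_mul hg // !mxE /=.
    move=> /oppr_inj e1 e2; have [d1 d2] := hw 0; have [d3 d4] := hw 1.
    move: d1 d2 d3 d4; rewrite e1 e2 /= !mul0r !subr0 !addr0.
    by split; split.
  have val0 : {ae mu, forall x, 0 < x ->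
      cos (phi x) * complex.Re (f0 x 0 0) + sin (phi x) * complex.Re (f0 x 1 0) = val u0 x /\
      cos (phi x) * complex.Im (f0 x 0 0) + sin (phi x) * complex.Im (f0 x 1 0) = val v0 x}.
    apply: ae_imp rf0 => x h x0; have := h x0; rewrite /dircoord.
    case: (f0 x 0 0) => p q; case: (f0 x 1 0) => p' q' /= [<- <-].
    by split; ring.
  split.
    apply: (@rel_of_system (fun y => complex.Re (f0 y 0 0)) (fun y => complex.Re (f0 y 1 0)) _ u0) eu.
    - by move=> b b0; split; [have [] := acf0 b 0 b0 | have [] := acf0 b 1 b0].
    - by apply: ae_imp dv => x h x0; have [] := h x0.
    - by rewrite f00.
    - by apply: ae_imp val0 => x h x0; have [] := h x0.
  apply: (@rel_of_system (fun y => complex.Im (f0 y 0 0)) (fun y => complex.Im (f0 y 1 0)) _ v0) ev.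
  - by move=> b b0; split; [have [] := acf0 b 0 b0 | have [] := acf0 b 1 b0].
  - by apply: ae_imp dv => x h x0; have [] := h x0.
  - by rewrite f00.
  - by apply: ae_imp val0 => x h x0; have [] := h x0.
have [p1 [p2 [[mp1 mp2] acp dp p20 ep]]] := solves_system mphi h1.
have [q1 [q2 [[mq1 mq2] acq dq q20 eq]]] := solves_system mphi h2.
pose f0 x : 'cV[R[i]]_2 := \col_i (if i == 0 then Complex (p1 x) (q1 x) else Complex (p2 x) (q2 x)).
have rf0 : rep f0 u v.
  apply: ae_imp2 ep eq => x e1 e2 x0; rewrite /dircoord !mxE /= -e1 // -e2 //.
  by apply/eqP; rewrite eq_complex /=; apply/andP; split; apply/eqP; ring.
have i01 (i : 'I_2) : i = 0 \/ i = 1.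
  by case: i => [[|[|//]] hi]; [left | right]; exact: val_inj.
have R0 : (fun x => complex.Re (f0 x 0 0)) = p1 by apply/funext => x; rewrite mxE.
have R1 : (fun x => complex.Re (f0 x 1 0)) = p2 by apply/funext => x; rewrite mxE.
have I0 : (fun x => complex.Im (f0 x 0 0)) = q1 by apply/funext => x; rewrite mxE.
have I1 : (fun x => complex.Im (f0 x 1 0)) = q2 by apply/funext => x; rewrite mxE.
split; [exact: L2_rep rf | exact: L2_rep rg | exists f0; split].
- split.
    apply: L2_rep rf0 => // i; have ? := ae_filter_ringOfSetsType mu.
    split; [exists (if i == 0 then p1 else p2) | exists (if i == 0 then q1 else q2)].
    + by apply: measurable_funTS; case: ifP.
    + by apply: nearW => x _; rewrite mxE; case: ifP.
    + by apply: measurable_funTS; case: ifP.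
    + by apply: nearW => x _; rewrite mxE; case: ifP.
  by apply/(L2eq_rep Hphi rf rf0); rewrite !subrr (inorm0 sip).
- move=> b i b0; have [a3 a4] := acp b b0; have [a5 a6] := acq b b0.
  by case: (i01 i) => ->; rewrite ?R0 ?R1 ?I0 ?I1.
- have {}dp := ae_imp2 (fun x p q => conj p q) dp dq.
  have Hg := ae_imp2 (fun x p q => conj p q) Hphi rg.
  apply: ae_imp2 dp Hg => x [d1 d2] [hH hg] x0.
  have {}d1 := d1 x0; have {}d2 := d2 x0.
  exists (\col_i (if i == 0 then Complex (- (sin (phi x) * val u' x)) (- (sin (phi x) * val v' x))
      else Complex (cos (phi x) * val u' x) (cos (phi x) * val v' x))).
    have [d3 d4] := d1; have [d5 d6] := d2.
    by move=> i; case: (i01 i) => ->; rewrite ?R0 ?R1 ?I0 ?I1 mxE.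
  apply/matrixP => i j; rewrite (ord1 j) hH // [RHS]mxE proj_dir_mul hg //.
  set w := \col_i _; have [w0 w1] := rotJ_mul w.
  by case: (i01 i) => ->; rewrite ?w0 ?w1 !mxE /=; apply/eqP; rewrite eq_complex /=;
    apply/andP; split; apply/eqP; ring.
- by rewrite mxE /= p20 q20.
Qed.

End SystemOperator.

(** * Transfer of spectral properties between the real model and the system *)

Section Spectrum.
Variable R : realType.
Local Notation mu := (@lebesgue_measure R).
Local Notation D := (`]0, +oo[%classic : set R).
Local Notation ip := (@l2ip R).
Local Notation "`[ x ]" := (inorm ip x) (format "`[ x ]").
Let sip := @l2_semi_inner R.
Implicit Types (u v : l2fun R) (f g : R -> 'cV[R[i]]_2) (x a t : R).

Variables (H : R -> 'M[R]_2) (phi : R -> R) (l : R).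
Hypothesis mphi : measurable_fun D phi.
Hypothesis Hphi : {ae mu, forall x, 0 < x -> H x = proj_dir (phi x)}.
Local Notation c := (angle_cos phi l).
Local Notation s := (angle_sin phi l).
Let mc := measurable_angle_cos l mphi.
Let ms := measurable_angle_sin l mphi.
Let c1 := angle_cos_le1 phi l.
Let s1 := angle_sin_le1 phi l.
Let cs1 := @angle_cos2Dsin2 R phi l.
Local Notation rel := (rel c s l).
Local Notation K := (dom_closure c s l).
Local Notation rep := (rep phi).
Local Notation emb := (emb phi).
Let lin := dom_closure_linear l mc ms c1 s1 : linear_subset K.
Local Notation dom := (domT l mc ms c1 s1).
Local Notation dip := (@dom_ip R c s l mc ms c1 s1).
Local Notation dop := (@op R c s l mc ms c1 s1).

Let K0 : K 0. Proof. exact: lin.1. Qed.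
Let KD (F : dom) : K (val F). Proof. exact: subset_lmodP. Qed.
Let inD u (Ku : K u) : dom := Subset_lmod lin Ku.

Lemma sysdom_closure_rep f u v : leb_measurable_vec f -> rep f u v ->
  sysdom_closure H f <-> K u /\ K v.
Proof.
move=> mf rf; split=> [[_ cl]|[Ku Kv]].
  have norms f' u' v' : rep f' u' v' -> forall e, 0 < e -> L2norm H (f - f') < e ->
      `[u - u'] < e /\ `[v - v'] < e.
    move=> rf' e e0; rewrite (L2norm_rep Hphi (repB rf rf')) => he.
    split; apply: le_lt_trans he; rewrite /inorm ler_wsqrtr // ?lerDl ?lerDr; exact: (ip_ge0 sip).
  have comps e : 0 < e -> exists u' v', [/\ exists w, rel u' w, exists w, rel v' w,
      `[u - u'] < e & `[v - v'] < e].
    move=> e0; have [f' [g sg] fe] := cl e e0; have [L2f L2g _] := sg.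
    have [u' [v' rf']] := rep_ex mphi Hphi L2f; have [u2 [v2 rg]] := rep_ex mphi Hphi L2g.
    have [r1 r2] := (sysrel_rep l mphi Hphi L2f.1 L2g.1 rf' rg).1 sg.
    by have [n1 n2] := norms _ _ _ rf' e e0 fe; exists u', v'; split=> //; [exists u2 | exists v2].
  split=> e e0; have [u' [v' [h1 h2 h3 h4]]] := comps e e0; [by exists u' | by exists v'].
split=> [|e e0]; first exact: L2_rep rf.
have e2 : 0 < e / 2 by rewrite divr_gt0.
have [u' [u2 ru] hu] := Ku _ e2; have [v' [v2 rv] hv] := Kv _ e2.
exists (emb u' v').
  exists (emb u2 v2).
  by apply/(sysrel_rep l mphi Hphi (measurable_emb mphi u' v') (measurable_emb mphi u2 v2)
    (rep_emb phi u' v') (rep_emb phi u2 v2)).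
rewrite (L2norm_rep Hphi (repB rf (rep_emb phi u' v'))) -!(inorm_sqr sip).
rewrite -(ltr_pXn2r (n := 2)) ?nnegrE ?sqrtr_ge0 ?(ltW e0) // sqr_sqrtr ?addr_ge0 ?sqr_ge0 //.
have h (r : R) : 0 <= r -> r < e / 2 -> r ^+ 2 < (e / 2) ^+ 2.
  by move=> r0 re; rewrite ltr_pXn2r ?nnegrE ?(ltW e2).
have := h _ (inorm_ge0 _ _) hu; have := h _ (inorm_ge0 _ _) hv.
by have := sqr_ge0 e; rewrite expr_div_n -natrX; lra.
Qed.

Lemma sysop_rep f g u v u' v' : leb_measurable_vec f -> leb_measurable_vec g ->
  rep f u v -> rep g u' v' ->
  sysop H f g <-> [/\ rel u u', rel v v', K u', K v' & K u /\ K v].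
Proof.
move=> mf mg rf rg; split.
  move=> [/(sysrel_rep l mphi Hphi mf mg rf rg)[r1 r2]].
  by move=> /(sysdom_closure_rep mf rf)[k1 k2] /(sysdom_closure_rep mg rg)[k3 k4].
move=> [r1 r2 k3 k4 [k1 k2]]; split.
- exact/(sysrel_rep l mphi Hphi mf mg rf rg).
- exact/(sysdom_closure_rep mf rf).
- exact/(sysdom_closure_rep mg rg).
Qed.

Let sysop_L2 f g : sysop H f g -> L2 H f /\ L2 H g.
Proof. by move=> [[h1 h2 _] _ _]. Qed.

Lemma sysop_emb (F F' G G' : dom) : dop F G -> dop F' G' ->
  sysop H (emb (val F) (val F')) (emb (val G) (val G')).
Proof.
move=> h h'; apply/(sysop_rep (measurable_emb mphi (val F) (val F')) (measurable_emb mphi (val G) (val G'))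
  (rep_emb phi _ _) (rep_emb phi _ _)); split => //; try exact: KD; split; exact: KD.
Qed.

(** Multiplication by [w + i d] mixes the two parts; this is the origin of the pair of real
    equations in [compact_onto]. *)
Lemma rep_shift w d f g u v u' v' : rep f u v -> rep g u' v' ->
  rep (g - Complex w d *: f) (u' - w *: u + d *: v) (v' - w *: v - d *: u).
Proof.
move=> rf rg; have := repB rg (repZ (Complex w d) rf) => /=.
by rewrite !opprD opprK !addrA.
Qed.

Let rep_rshift w f g u v u' v' : rep f u v -> rep g u' v' ->
  rep (g - real_complex R w *: f) (u' - w *: u) (v' - w *: v).
Proof. by move=> rf rg; have := rep_shift w 0 rf rg; rewrite !scale0r subr0 addr0. Qed.

Let op0 : dop 0 0. Proof. exact: (rel0 l mc ms c1 s1). Qed.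

(** Real data are embedded with imaginary part 0. As [w] is real, the real part of a complex
    solution solves the real problem. *)
Lemma regular_of_resolvent w : resolvent_set H (real_complex R w) -> regular_value dip dop w.
Proof.
move=> [_ ont [M hM]]; split.
  exists M => F G FG; have := hM _ _ (sysop_emb FG op0).
  rewrite (L2norm_rep Hphi (rep_emb phi (val F) 0)).
  rewrite (L2norm_rep Hphi (rep_rshift w (rep_emb phi (val F) 0) (rep_emb phi (val G) 0))).
  by rewrite scaler0 subr0 !(ip0l sip) !addr0 !dom_normE.
move=> h; have rh := rep_emb phi (val h) 0.
have mh := measurable_emb mphi (val h) 0.
have [f [g [fg eq]]] := ont _ ((sysdom_closure_rep mh rh).2 (conj (KD h) K0)).
have [L2f L2g] := sysop_L2 fg.
have [u [v rf]] := rep_ex mphi Hphi L2f; have [u' [v' rg]] := rep_ex mphi Hphi L2g.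
have [r1 r2 k3 k4 [k1 k2]] := (sysop_rep L2f.1 L2g.1 rf rg).1 fg.
have [e1 _] := (L2eq_rep Hphi (rep_rshift w rf rg) rh).1 eq.
by exists (inD k1), (inD k3); split => //; rewrite dom_normE.
Qed.

Lemma resolvent_onto w d : resolvent_set H (Complex w d) -> forall h : dom,
  exists u v gu gv : dom, [/\ dop u gu, dop v gv,
    inorm dip (gu - w *: u + d *: v - h) = 0 & inorm dip (gv - w *: v - d *: u) = 0].
Proof.
move=> [_ ont _] h; have rh := rep_emb phi (val h) 0.
have mh := measurable_emb mphi (val h) 0.
have [f [g [fg eq]]] := ont _ ((sysdom_closure_rep mh rh).2 (conj (KD h) K0)).
have [L2f L2g] := sysop_L2 fg.
have [u [v rf]] := rep_ex mphi Hphi L2f; have [u' [v' rg]] := rep_ex mphi Hphi L2g.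
have [r1 r2 k3 k4 [k1 k2]] := (sysop_rep L2f.1 L2g.1 rf rg).1 fg.
have [e1 e2] := (L2eq_rep Hphi (rep_shift w d rf rg) rh).1 eq; rewrite subr0 in e2.
by exists (inD k1), (inD k2), (inD k3), (inD k4); split => //; rewrite dom_normE.
Qed.

(** At a real point the two parts decouple. The bounds are combined as squares, the complex norm
    being the root of a sum of two squares. *)
Lemma resolvent_of_regular w : regular_value dip dop w -> resolvent_set H (real_complex R w).
Proof.
move=> [[M0 hM0] ont].
have hM u u' : rel u u' -> K u -> K u' -> ip u u <= `|M0| ^+ 2 * ip (u' - w *: u) (u' - w *: u).
  move=> r k k'; have := hM0 (inD k) (inD k') r; rewrite !dom_normE -!(inorm_sqr sip) -exprMn => h.
  have h' : `[u] <= `|M0| * `[u' - w *: u].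
    by apply: le_trans h _; rewrite ler_wpM2r ?inorm_ge0 // ler_norm.
  by rewrite ler_pXn2r // nnegrE ?mulr_ge0 ?inorm_ge0.
have bound f g : sysop H f g -> L2norm H f <= `|M0| * L2norm H (g - real_complex R w *: f).
  move=> fg; have [L2f L2g] := sysop_L2 fg.
  have [u [v rf]] := rep_ex mphi Hphi L2f; have [u' [v' rg]] := rep_ex mphi Hphi L2g.
  have [r1 r2 k3 k4 [k1 k2]] := (sysop_rep L2f.1 L2g.1 rf rg).1 fg.
  rewrite (L2norm_rep Hphi rf) (L2norm_rep Hphi (rep_rshift w rf rg)).
  rewrite -(normr_id M0) -sqrtr_sqr -sqrtrM ?sqr_ge0 // ler_wsqrtr // mulrDr.
  by apply: lerD; exact: hM.
split; last by exists `|M0|.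
- move=> f g fg eq; have [L2f L2g] := sysop_L2 fg.
  have [u [v rf]] := rep_ex mphi Hphi L2f; have [u' [v' rg]] := rep_ex mphi Hphi L2g.
  have [r1 r2 k3 k4 [k1 k2]] := (sysop_rep L2f.1 L2g.1 rf rg).1 fg.
  have [e1 e2] := (L2eq_rep Hphi (rep_rshift w rf rg) (rep0 phi)).1 eq.
  rewrite !subr0 in e1 e2; apply/(L2eq_rep Hphi rf (rep0 phi)); rewrite !subr0.
  by split; apply/le_anti; rewrite inorm_ge0 andbT -(ler_pXn2r (n := 2)) ?nnegrE ?inorm_ge0 //
    (inorm_sqr sip); [apply: le_trans (hM _ _ r1 k1 k3) _ | apply: le_trans (hM _ _ r2 k2 k4) _];
    rewrite -(inorm_sqr sip) ?e1 ?e2 expr0n mulr0.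
- move=> h ch; have [L2h _] := ch; have [u [v rh]] := rep_ex mphi Hphi L2h.
  have [ku kv] := (sysdom_closure_rep L2h.1 rh).1 ch.
  have [F [G [FG e1]]] := ont (inD ku); have [F' [G' [FG' e2]]] := ont (inD kv).
  exists (emb (val F) (val F')), (emb (val G) (val G')); split; first exact: sysop_emb.
  rewrite dom_normE !subset_valB !subset_valZ in e1.
  rewrite dom_normE !subset_valB !subset_valZ in e2.
  exact: (L2eq_rep Hphi (rep_rshift w (rep_emb phi (val F) (val F'))
    (rep_emb phi (val G) (val G'))) rh).2 (conj e1 e2).
Qed.

Lemma eigenfun_emb w (F : dom) : dop F (w *: F) -> eigenfun H (real_complex R w) (emb (val F) 0).
Proof.
move=> h; have := sysop_emb h op0; rewrite subset_valZ (_ : val (0 : dom) = 0) // => hs.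
exists (emb (w *: val F) 0); first exact: hs.
apply/(L2eq_rep Hphi (rep_emb phi _ _) (repZ (real_complex R w) (rep_emb phi _ _))).
by rewrite /= !scale0r !scaler0 subr0 addr0 !subrr (inorm0 sip).
Qed.

Lemma eigenfun_rep w f : eigenfun H (real_complex R w) f ->
  exists F F' : dom, [/\ rep f (val F) (val F'), dop F (w *: F) & dop F' (w *: F')].
Proof.
move=> [g fg eq]; have [L2f L2g] := sysop_L2 fg.
have [u [v rf]] := rep_ex mphi Hphi L2f; have [u' [v' rg]] := rep_ex mphi Hphi L2g.
have [r1 r2 k3 k4 [k1 k2]] := (sysop_rep L2f.1 L2g.1 rf rg).1 fg.
have [] := (L2eq_rep Hphi rg (repZ (real_complex R w) rf)).1 eq.
rewrite /= !scale0r subr0 addr0 => e1 e2.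
exists (inD k1), (inD k2); split=> //.
  by apply: (rel_null mc ms c1 s1 r1); rewrite ?subrr ?(inorm0 sip) // (inormB sip).
by apply: (rel_null mc ms c1 s1 r2); rewrite ?subrr ?(inorm0 sip) // (inormB sip).
Qed.

(** One real eigenfunction spans the complex eigenspace: the two real multipliers form one complex
    coefficient. *)
Lemma eigenfun_finite w : finite_multiplicity H (real_complex R w).
Proof.
have [b [hb one]] := op_simple l mc ms c1 s1 cs1 w.
exists 1%N, (fun=> emb (val b) 0); split=> [_|f /eigenfun_rep[F [F' [rf h h']]]].
  exact: eigenfun_emb.
have [k e1] := one F h; have [k' e2] := one F' h'.
exists (fun=> Complex k k'); rewrite big_ord1.
rewrite dom_normE subset_valB subset_valZ in e1; rewrite dom_normE subset_valB subset_valZ in e2.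
apply/(L2eq_rep Hphi rf (repZ (Complex k k') (rep_emb phi (val b) 0))).
by rewrite /= !scaler0 subr0 add0r.
Qed.

Lemma discrete_of_isolated w (F : dom) e : dop F (w *: F) -> inorm dip F <> 0 -> 0 < e ->
  spectrum H `<=` [set real_complex R t | t in [set t : R | 0 <= t]] ->
  (forall w', 0 < `|w' - w| < e -> regular_value dip dop w') ->
  discrete_spectrum H (real_complex R w).
Proof.
move=> FwF F0 e0 sp reg; split.
- move=> [inj _ _]; apply: F0; have [G Gs Ge] := eigenfun_emb FwF.
  have [[_ L2G _] _ _] := Gs; have [u [v rG]] := rep_ex mphi Hphi L2G.
  have rF := rep_emb phi (val F) 0.
  have eq0 : L2eq H (G - real_complex R w *: emb (val F) 0) 0 by rewrite /L2eq subr0.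
  have [] := (L2eq_rep Hphi rF (rep0 phi)).1 (inj _ _ Gs eq0).
  by rewrite subr0 dom_normE.
(* A nearby spectral point is again real by [sp], so isolation among real points is enough. *)
- exists e => // z sz; have [t _ tz] := sp z sz; rewrite -tz in sz *.
  rewrite -rmorphB /= => h; have {}h : `|t - w| < e.
    by move: h; rewrite normc_def /= expr0n addr0 sqrtr_sqr ltcR.
  have [->//|tw] := eqVneq t w; exfalso.
  have ns : ~ resolvent_set H (real_complex R t) := sz.
  apply: ns; apply: resolvent_of_regular; apply: reg.
  by rewrite normr_gt0 subr_eq0 tw.
- exists (emb (val F) 0); first exact: eigenfun_emb.
  move=> h; apply: F0; have [] := (L2eq_rep Hphi (rep_emb phi _ _) (rep0 phi)).1 h.
  by rewrite subr0 dom_normE.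
- exact: eigenfun_finite.
Qed.

End Spectrum.

(** * The monotone angle *)

Section SmallAngles.
Variable R : realType.
Implicit Types t x y : R.

Lemma sin_mean_value x y : x <= y ->
  exists2 z, x <= z <= y & sin y - sin x = cos z * (y - x).
Proof.
move=> xy; have [z] := @MVT_segment R sin cos x y xy (fun t _ => is_derive_sin t)
  (continuous_subspaceT (@continuous_sin R)).
by rewrite in_itv /= => hz e; exists z.
Qed.

Lemma sin_le_id t : 0 <= t -> sin t <= t.
Proof.
move=> t0; have [z _] := sin_mean_value t0; rewrite sin0 !subr0 => ->.
by rewrite -[leRHS]mul1r ler_wpM2r // cos_le1.
Qed.

Lemma small_angle_cos : exists2 r : R, 0 < r & forall t, 0 <= t -> t <= r -> 1 / 2 <= cos t.
Proof.
have h : (1 / 2 : R) < cos 0 by rewrite cos0 ltr_pdivrMr // mul1r ltr1n.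
have : \forall t \near 0, (1 / 2 : R) < cos t by exact: (cvgr_gt _ (@continuous_cos R 0) _ h).
move=> [r /= r0 hr]; exists (r / 2) => [|t t0 tr]; first by rewrite divr_gt0.
apply/ltW/hr; rewrite /= sub0r normrN ger0_norm //.
by apply: le_lt_trans tr _; rewrite ltr_pdivrMr // mulr_natr mulr2n ltrDl.
Qed.

(** Mean value theorem with derivative at least one half; it makes small angles and their sines
    comparable. *)
Lemma sin_growth r x y : (forall t, 0 <= t -> t <= r -> 1 / 2 <= cos t) ->
  0 <= x -> x <= y -> y <= r -> (y - x) / 2 <= sin y - sin x.
Proof.
move=> hr x0 xy yr; have [z /andP[xz zy] ->] := sin_mean_value xy.
rewrite mulrC -[2^-1]mul1r ler_wpM2r ?subr_ge0 // hr //; first exact: le_trans xz.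
exact: le_trans yr.
Qed.

Lemma cos_nonincreasing x y : 0 <= x -> x <= y -> y <= pi -> cos y <= cos x.
Proof.
move=> x0 xy ypi; rewrite leNgt ltr_cos ?in_itv /= -?leNgt //.
  by rewrite ypi (le_trans x0 xy).
by rewrite x0 (le_trans xy ypi).
Qed.

End SmallAngles.

Section MonotoneAngle.
Variable R : realType.
Local Notation mu := (@lebesgue_measure R).
Local Notation D := (`]0, +oo[%classic : set R).
Local Notation ip := (@l2ip R).
Local Notation "`[ x ]" := (inorm ip x) (format "`[ x ]").
Implicit Types x y t : R.

Variables (phi : R -> R) (phi0 l : R).
Hypothesis mono : forall x y, 0 < x -> x <= y -> phi y <= phi x.
Hypothesis lim0 : phi x @[x --> 0^'+] --> phi0.
Hypothesis limoo : phi x @[x --> +oo] --> l.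
Hypotheses (phi0_le : phi0 <= pi / 2) (l_ge : - (pi / 2) <= l).

Lemma angle_le0 x : 0 < x -> phi x <= phi0.
Proof.
move=> x0; rewrite leNgt; apply/negP => h.
have h1 : \forall y \near 0^'+, phi y < phi x by exact: (cvgr_lt _ lim0 _ h).
near (0 : R)^'+ => y.
have h2 : phi y < phi x by near: y.
have y0 : 0 < y by near: y; exact: nbhs_right_gt.
have yx : y < x by near: y; exact: nbhs_right_lt.
by move: h2; apply/negP; rewrite -leNgt; exact: mono (ltW yx).
Unshelve. all: by end_near. Qed.

Lemma angle_ge x : 0 < x -> l <= phi x.
Proof.
move=> x0; rewrite leNgt; apply/negP => h.
have : \forall y \near +oo, phi x < phi y by exact: (cvgr_gt _ limoo _ h).
move=> [M [_ hM]].
have := hM (Num.max M x + 1).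
rewrite (le_lt_trans _ (_ : Num.max M x < _)) ?le_max ?lexx ?ltrDl //.
move=> /(_ isT); apply/negP; rewrite -leNgt; apply: mono => //.
by apply: le_trans (_ : x <= Num.max M x) _; rewrite ?le_max ?lexx ?orbT // lerDl.
Qed.

Lemma angle_small e : 0 < e -> exists2 X, 0 < X & forall x, X <= x -> phi x - l <= e.
Proof.
move=> e0; have h : l < l + e by rewrite ltrDl.
have : \forall y \near +oo, phi y < l + e by exact: (cvgr_lt _ limoo _ h).
move=> [M [_ hM]].
exists (Num.max M 0 + 1); first by rewrite ltr_wpDl // le_max lexx orbT.
move=> x hx; rewrite lerBlDl; apply/ltW/hM; apply: lt_le_trans hx.
by apply: le_lt_trans (_ : Num.max M 0 < _); rewrite ?le_max ?lexx ?ltrDl.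
Qed.

Lemma angle_bounds x : 0 < x -> 0 <= phi x - l <= pi.
Proof.
move=> x0; have h1 := angle_le0 x0; have h2 := angle_ge x0.
apply/andP; split; first by rewrite subr_ge0.
by rewrite [leRHS]splitr; apply: lerD; [exact: le_trans phi0_le | rewrite lerNl].
Qed.

(** Extended by [phi0] to the left, [phi] is nonincreasing on the whole line. *)
Lemma measurable_angle : measurable_fun D phi.
Proof.
have mD : measurable (D : set (measurableTypeR R)) by exact: measurable_itv.
pose psi x := if 0 < x then phi x else phi0.
apply: (@eq_measurable_fun _ _ _ _ D psi).
  by move=> x; rewrite mem_setE in_itv /= andbT /psi => ->.
apply: nonincreasing_measurable => // x y xy; rewrite /psi.
have [x0|x0] := ltP 0 x; first by rewrite (lt_le_trans x0 xy); exact: mono.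
by case: ifPn => // y0; exact: angle_le0.
Qed.

Local Notation c := (angle_cos phi l).
Local Notation s := (angle_sin phi l).
Let mc := measurable_angle_cos l measurable_angle.
Let ms := measurable_angle_sin l measurable_angle.
Let c1 := angle_cos_le1 phi l.
Let s1 := angle_sin_le1 phi l.
Let cs1 := @angle_cos2Dsin2 R phi l.

(** Once the angle is below [r], its cosine is at least [1 / 2] and its sine at least half the
    angle, so [test_functions] applies with [eta / 2]. *)
Lemma angle_test_functions eta : 0 < eta ->
  (forall Y, exists2 X, Y <= X & eta <= X * (phi X - l)) ->
  exists2 K : R, 0 < K & forall M d : R, 0 < d ->
  exists F G : l2fun R, [/\ solves c s l 0 F G, ip F F = 1, ip G G <= K &
    forall x, 0 < x -> x <= M -> val F x ^+ 2 <= d].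
Proof.
move=> eta0 large; have [r r0 hr] := small_angle_cos R.
have [E E0 hE] := angle_small r0.
(* Were the angle 0 at some point, it would stay 0 and contradict [large]. *)
have dpos x : 0 < x -> 0 < phi x - l.
  move=> x0; have [X xX hX] := large x.
  have X0 : 0 < X by exact: lt_le_trans xX.
  apply: lt_le_trans (_ : phi X - l <= _); last by rewrite lerB // mono.
  by rewrite -(pmulr_rgt0 _ X0); exact: lt_le_trans hX.
have sge x : E <= x -> (phi x - l) / 2 <= s x.
  move=> Ex; have x0 : 0 < x by exact: lt_le_trans Ex.
  have := sin_growth hr (lexx 0) (ltW (dpos x x0)) (hE x Ex).
  by rewrite sin0 !subr0 angle_sinE.
have eta2 : 0 < eta / 2 by rewrite divr_gt0.
apply: (test_functions l mc ms c1 s1 cs1 (E := E) (eta := eta / 2)) => //.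
- move=> x Ex; have x0 : 0 < x by exact: lt_le_trans Ex.
  split; last by apply: lt_le_trans (sge x Ex); rewrite divr_gt0 // dpos.
  by rewrite angle_cosE //; exact: hr (ltW (dpos x x0)) (hE x Ex).
- move=> x y Ex xy; have x0 : 0 < x by exact: lt_le_trans Ex.
  have y0 : 0 < y by exact: lt_le_trans xy.
  have dxy : phi y - l <= phi x - l by rewrite lerB // mono.
  rewrite !angle_cosE // !angle_sinE //; split; last first.
    by apply: cos_nonincreasing; rewrite ?(ltW (dpos y y0)) //; have /andP[] := angle_bounds x0.
  rewrite -subr_ge0; apply: le_trans (sin_growth hr (ltW (dpos y y0)) dxy (hE x Ex)).
  by rewrite divr_ge0 // subr_ge0.
- move=> e Y e0; have [X X0 hX] := angle_small e0.
  have m0 : 0 < Num.max X Y by rewrite lt_max X0.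
  exists (Num.max X Y); first by rewrite le_max lexx orbT.
  rewrite angle_sinE //; apply: le_trans (sin_le_id (ltW (dpos _ m0))) _.
  by apply: hX; rewrite le_max lexx.
- move=> Y; have [X YX hX] := large (Num.max Y E); exists X.
    by apply: le_trans YX; rewrite le_max lexx.
  have EX : E <= X by apply: le_trans YX; rewrite le_max lexx orbT.
  have X0 : 0 < X by exact: lt_le_trans EX.
  apply: le_trans (_ : X * ((phi X - l) / 2) <= _); last by rewrite ler_pM2l // sge.
  by rewrite mulrA ler_pM2r // invr_gt0.
Qed.

Lemma angle_vanish : (forall eps, 0 < eps -> exists T, forall x, T < x -> phi x - l <= eps / x) ->
  forall eta, 0 < eta -> exists2 T, 1 <= T &
    forall x, T <= x -> `|s x| * x <= eta /\ 1 / 2 <= c x ^+ 2.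
Proof.
(* The cap [1 / 2] forces [s <= 1 / 2] for [x >= 1], hence [c^2 >= 3 / 4]. *)
move=> small eta eta0; pose e := Num.min eta (1 / 2).
have e0 : 0 < e by rewrite lt_min eta0 divr_gt0.
have [T hT] := small e e0; exists (Num.max T 0 + 1); first by rewrite lerDr le_max lexx orbT.
move=> x Tx; have x1 : 1 <= x by apply: le_trans Tx; rewrite lerDr le_max lexx orbT.
have x0 : 0 < x by exact: lt_le_trans x1.
have T_x : T < x.
  by apply: lt_le_trans Tx; apply: le_lt_trans (_ : Num.max T 0 < _); rewrite ?le_max ?lexx ?ltrDl.
have /andP[d0 dpi] := angle_bounds x0.
have ss : 0 <= s x <= phi x - l.
  by rewrite angle_sinE // sin_ge0_pi ?sin_le_id // d0.
have [s0 sd] := andP ss.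
have sx : s x * x <= e by rewrite -ler_pdivlMr //; exact: le_trans sd (hT x T_x).
split; first by rewrite ger0_norm //; apply: le_trans sx _; rewrite ge_min lexx.
have s2 : s x <= 1 / 2.
  apply: le_trans (_ : s x * x <= _); first by rewrite ler_peMr.
  by apply: le_trans sx _; rewrite ge_min lexx orbT.
have := cs1 x0; have := ler_pM s0 s0 s2 s2; rewrite -!expr2; lra.
Qed.

(** On [[-pi/2, pi/2]] the cosine is nonnegative, rising and then falling, so by monotonicity of
    [phi] two points with nonzero cosine bound it from below in between. Otherwise [cos phi]
    vanishes except perhaps at one point; then the second component of a solution has derivative 0
    and stays 0, and [F] is null. *)
Lemma angle_initial :
  (exists2 C, 0 < C & forall a F G, solves c s l a F G -> a ^+ 2 <= C * (ip F F + ip G G)) \/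
  (forall F G, rel c s l F G -> `[F] = 0).
Proof.
have pih x : 0 < x -> - (pi / 2) <= phi x <= pi / 2.
  by move=> x0; rewrite (le_trans l_ge (angle_ge x0)) (le_trans (angle_le0 x0)).
have cge0 x : 0 < x -> 0 <= cos (phi x) by move=> x0; exact: cos_ge0_pihalf (pih x x0).
have pi2 : pi / 2 <= pi :> R by rewrite [leRHS]splitr lerDl divr_ge0 // pi_ge0.
have [[p [q [p0 pq cp cq]]]|none] := pselect (exists p q, [/\ 0 < p, p < q,
    cos (phi p) != 0 & cos (phi q) != 0]).
  left; have q0 : 0 < q by exact: lt_trans pq.
  have k0 : 0 < Num.min (cos (phi p)) (cos (phi q)).
    by rewrite lt_min !lt_def cp cq !cge0.
  have k2 : 0 < Num.min (cos (phi p)) (cos (phi q)) ^+ 2 by rewrite exprn_gt0.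
  apply: (initial_bound mc ms c1 s1 cs1 (ltW p0) pq k2) => x /andP[px xq].
  have x0 : 0 < x by exact: lt_trans px.
  rewrite -cos_angle // ler_pXn2r ?nnegrE ?(ltW k0) ?cge0 // ge_min.
  have [h|h] := leP 0 (phi x); apply/orP; [left | right].
    apply: cos_nonincreasing => //; first exact: mono (ltW px).
    by have /andP[_ h1] := pih p p0; exact: le_trans pi2.
  rewrite -[cos (phi x)]cosN -[cos (phi q)]cosN; apply: cos_nonincreasing.
  - by rewrite oppr_ge0 ltW.
  - by rewrite lerN2; exact: mono (ltW xq).
  - by have /andP[h1 _] := pih q q0; apply: le_trans pi2; rewrite lerNl.
right; have ae0 : {ae mu, forall x, 0 < x -> cos (phi x) = 0}.
  have ? := ae_filter_ringOfSetsType mu.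
  have [[y y0 cy]|no] := pselect (exists2 y, 0 < y & cos (phi y) != 0); last first.
    apply: nearW => x x0; apply/eqP; apply: contrapT => /negP h; apply: no; exists x => //.
  exists [set y]; split; [exact: measurable_set1 | exact: lebesgue_measure_set1 |].
  move=> x /= hx; apply: contrapT => xy; apply: hx => x0; apply/eqP/negPn/negP => cx.
  apply: none; have [xlty|yltx] := ltP x y; [exists x, y | exists y, x]; split => //.
  by rewrite lt_neqAle yltx andbT; apply/eqP => e; apply: xy.
move=> F G [a /(solves_system measurable_angle)[p1 [p2 [_ acp dp p20 ep]]]].
apply/l2_null; apply: ae_imp2 (ae0) ep => x cx hx x0; rewrite -hx // cx // mul0r add0r.
have [_ ac2] := acp x x0.
have lc0 : locint (fun t => 0 * val G t).
  by apply: (locint_bmul (m := fun=> 0)) => // ?; rewrite normr0.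
have : p2 x - p2 0 = prim (fun t => 0 * val G t) x - prim (fun t => 0 * val G t) 0.
  apply: ac_ftc => //; first exact: ltW.
  by apply: ae_imp2 ae0 dp => t ct dt /andP[t0 _]; have [_] := dt t0; rewrite ct.
have pz y : prim (fun t => 0 * val G t) y = 0.
  have -> : (fun t => 0 * val G t) = cst 0 by apply/funext => t; rewrite mul0r.
  by rewrite /prim /Rintegral (_ : (fun t => _) = cst 0%E) ?integral0.
by rewrite p20 !pz subrr subr0 => ->; rewrite mulr0.
Qed.

End MonotoneAngle.

Theorem theorem1p4 (R : realType) (H : R -> 'M[R]_2) (phi : R -> R)
    (phi0 phioo : R) :
  Cplus H ->
  {ae (@lebesgue_measure R), forall x, 0 < x -> H x = proj_dir (phi x)} ->
  (forall x y : R, 0 < x -> x <= y -> phi y <= phi x) ->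
  phi x @[x --> 0^'+] --> phi0 ->
  phi x @[x --> +oo] --> phioo ->
  phi0 <= pi / 2 -> phioo <= phi0 -> - (pi / 2) <= phioo ->
  essential_spectrum H = set0 <->
  (fun x : R => phi x - phioo) =o_ +oo (fun x : R => x^-1).
Proof.
move=> [_ sp] Hphi mono lim0 limoo phi0_le _ l_ge.
pose mphi := measurable_angle mono lim0.
have res_neg t : t < 0 -> resolvent_set H (real_complex R t).
  move=> t0; apply: contrapT => /sp[r /= r0 [rt]].
  by move: t0; rewrite -rt ltNge r0.
have res_nonreal w d : d != 0 -> resolvent_set H (Complex w d).
  by move=> d0; apply: contrapT => /sp[r /= r0 [_ d_eq]]; rewrite -d_eq eqxx in d0.
have reg1 := regular_of_resolvent phioo mphi Hphi (res_neg _ (ltrN10 R)).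
have cs1 := @angle_cos2Dsin2 R phi phioo.
have dge x : 0 < x -> 0 <= phi x - phioo.
  by move=> x0; have /andP[] := angle_bounds mono lim0 limoo phi0_le l_ge x0.
split=> [ess|small].
  apply/eqoP => eps eps0; apply: contrapT => nsmall.
  apply: (isolated_no_test_functions cs1 reg1).
    move=> w; have [r|nr] := pselect (resolvent_set H (real_complex R w)).
      by left; exact: (regular_of_resolvent phioo mphi Hphi r).
    right; have [_ [e e0 he] _ _] : discrete_spectrum H (real_complex R w).
      by apply: contrapT => nd; have : essential_spectrum H (real_complex R w) by []; rewrite ess.
    exists e; first exact: e0.
    move=> w' /andP[w1 w2]; apply: (regular_of_resolvent phioo mphi Hphi).
    apply: contrapT => nr'; have : real_complex R w' = real_complex R w.
      apply: (he _ nr'); rewrite -rmorphB /= normc_def /= expr0n addr0 sqrtr_sqr ltcR; exact: w2.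
    by move=> [ww]; rewrite ww subrr normr0 ltxx in w1.
  (* Failure of the little-o bound for [eps] supplies, beyond any [Y], a point [X] with
     [X (phi X - phioo) >= eps]. *)
  apply: (@angle_test_functions R phi phi0 phioo mono lim0 limoo phi0_le l_ge eps eps0) => Y.
  apply: contrapT => nX; apply: nsmall; exists (Num.max Y 0); split; first exact: num_real.
  move=> x; rewrite gt_max => /andP[Yx x0]; rewrite ger0_norm ?dge // ger0_norm ?invr_ge0 ?(ltW x0) //.
  rewrite ler_pdivlMr // mulrC leNgt; apply/negP => hx.
  by apply: nX; exists x; exact: ltW.
have vanish : forall eps, 0 < eps -> exists T, forall x, T < x -> phi x - phioo <= eps / x.
  move=> eps eps0; have [M [_ hM]] := (eqoP _ _ _).1 small eps eps0.
  exists (Num.max M 0) => x; rewrite gt_max => /andP[Mx x0].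
  by have := hM x Mx; rewrite ger0_norm ?dge // ger0_norm ?invr_ge0 ?(ltW x0).
have cpt := op_compact cs1 (angle_vanish mono lim0 limoo phi0_le l_ge vanish)
  (angle_initial mono lim0 limoo phi0_le l_ge).
(* A spectral point is some real [t]. It cannot be regular, so it is an isolated eigenvalue, which
   makes it discrete. *)
rewrite -subset0 => z [sz nd]; have [t _ tz] := sp z sz; rewrite -tz in sz nd.
have [reg|[[F hF F0] [e e0 he]]] := compact_discrete cs1 reg1 (cpt _ _ _ _)
  (fun w d d0 => resolvent_onto Hphi (res_nonreal w d d0)) t.
  by apply: sz; exact: resolvent_of_regular reg.
by apply: nd; exact: discrete_of_isolated hF F0 e0 sp he.
Qed.
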